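(* Let $\lambda\in K$ with $\lambda\neq0,1$, and let $\Lambda$ be either the triangle algebra $T(\lambda)$ or the spherical algebra $S(\lambda)$. Let $M$ be the right $\Lambda$-module $$M=\Lambda\oplus\Big[\bigoplus_{i\in\Gamma}S_i\Big]\oplus\Big[\bigoplus_{\nu\notin\Gamma}\Omega^2(S_\nu)\Big],$$ where $\Gamma=\{2\}$ if $\Lambda=T(\lambda)$ and $\Gamma=\{1,3\}$ if $\Lambda=S(\lambda)$, and $\nu$ runs over the remaining vertices. Then $M$ is a 3-cluster tilting module.
   Context: $K$ is an algebraically closed field of arbitrary characteristic. Modules are finite-dimensional right modules; paths are composed left to right; $S_i$ is the simple module at vertex $i$ and $\Omega$ is the syzygy operator (kernel of a projective cover). A module $M$ is 3-cluster tilting if $$\mathrm{add}(M)=\{N\mid \mathrm{Ext}^i(M,N)=0,\ i=1,2\}=\{N\mid\mathrm{Ext}^i(N,M)=0,\ i=1,2\}.$$ The triangle algebra $T(\lambda)$ is the path algebra of the quiver with vertices $1,2,3$ and arrows $\alpha:1\to2$, $\beta:2\to1$, $\gamma:2\to3$, $\delta:3\to2$, modulo the relations $\alpha\beta\alpha=\alpha\gamma\delta$, $\delta\beta\alpha=\lambda\delta\gamma\delta$, $\beta\alpha\beta=\gamma\delta\beta$, $\beta\alpha\gamma=\lambda\gamma\delta\gamma$, $\alpha\beta\alpha\gamma=0$, $\beta\alpha\beta\alpha\beta=0$, $\delta\gamma\delta\beta=0$, $\gamma\delta\gamma\delta\gamma=0$, $\alpha\beta\alpha\beta\alpha=0$,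 $\delta\gamma\delta\gamma\delta=0$, $\delta\beta\alpha\beta=0$. The spherical algebra $S(\lambda)$ is the path algebra of the quiver with vertices $1,\dots,6$ and arrows $\alpha:1\to2$, $\beta:2\to3$, $\nu:3\to5$, $\delta:5\to1$, $\varrho:1\to6$, $\omega:6\to3$, $\gamma:3\to4$, $\sigma:4\to1$, modulo the relations $\alpha\beta\nu=\varrho\omega\nu$, $\beta\nu\delta=\lambda\beta\gamma\sigma$, $\nu\delta\alpha=\lambda\gamma\sigma\alpha$, $\delta\alpha\beta=\delta\varrho\omega$, $\gamma\sigma\varrho=\nu\delta\varrho$, $\sigma\varrho\omega=\lambda\sigma\alpha\beta$, $\varrho\omega\gamma=\lambda\alpha\beta\gamma$, $\omega\gamma\sigma=\omega\nu\delta$, and the following paths are zero: $\alpha\beta\nu\delta\alpha$, $\beta\nu\delta\varrho$, $\nu\delta\alpha\beta\nu$, $\delta\alpha\beta\gamma$, $\gamma\sigma\varrho\omega\gamma$, $\sigma\varrho\omega\nu$, $\varrho\omega\gamma\sigma\varrho$, $\omega\gamma\sigma\alpha$, $\beta\gamma\sigma\varrho$, $\sigma\alpha\beta\nu$, $\delta\varrho\omega\gamma$, $\omega\nu\delta\alpha$, $\beta\nu\delta\alpha\beta$, $\delta\alpha\beta\nu\delta$, $\sigma\varrho\omega\gamma\sigma$, $\omega\gamma\sigma\varrho\omega$. *)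

(* Defs.v *)
(* [boolp] is used only to turn membership in an ideal into a boolean. *)
From HB Require Import structures.
From mathcomp Require Import all_boot all_order all_algebra.
From mathcomp Require Import finmap.
From mathcomp.multinomials Require Import monalg.
From mathcomp.classical Require Import boolp.

Set Implicit Arguments.
Unset Strict Implicit.
Unset Printing Implicit Defensive.

Import GRing.Theory.
Local Open Scope ring_scope.

(* [vertex0] only asserts that there is a vertex, so that path algebras are
   nonzero rings as [algType] demands. *)
Record quiver := Quiver {
  vertex : finType;
  arrow : finType;
  source : arrow -> vertex;
  target : arrow -> vertex;
  vertex0 : vertex }.

Section Paths.
Variable Q : quiver.

Fixpoint walk (v : vertex Q) (s : seq (arrow Q)) : bool :=
  if s is a :: s' then (source a == v) && walk (target a) s' else true.

Definition walk_end (v : vertex Q) (s : seq (arrow Q)) : vertex Q :=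
  last v [seq target a | a <- s].

(* A path is its starting vertex together with its list of arrows, read from
   left to right; the empty list gives the trivial path at a vertex. *)
Record qpath := QPath {
  qpath_val : vertex Q * seq (arrow Q);
  _ : walk qpath_val.1 qpath_val.2 }.

HB.instance Definition _ := [isSub for qpath_val].
HB.instance Definition _ := [Choice of qpath by <:].

Definition psource (p : qpath) : vertex Q := (val p).1.
Definition parrows (p : qpath) : seq (arrow Q) := (val p).2.
Definition ptarget (p : qpath) : vertex Q := walk_end (psource p) (parrows p).

Definition ptriv (v : vertex Q) : qpath := @QPath (v, [::]) isT.

Fact parrow_subproof (a : arrow Q) : walk (source a) [:: a].
Proof. by rewrite /= eqxx. Qed.
Definition parrow (a : arrow Q) : qpath :=
  @QPath (source a, [:: a]) (parrow_subproof a).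

Lemma walk_cat v s1 s2 : walk v (s1 ++ s2) = walk v s1 && walk (walk_end v s1) s2.
Proof. by elim: s1 v => //= a s1 IH v; rewrite IH andbA. Qed.

Lemma walk_end_cat v s1 s2 :
  walk_end v (s1 ++ s2) = walk_end (walk_end v s1) s2.
Proof. by rewrite /walk_end map_cat last_cat. Qed.

Definition pcat (p q : qpath) : option qpath :=
  if ptarget p == psource q then insub (psource p, parrows p ++ parrows q)
  else None.

Variant pcat_spec (p q : qpath) : option qpath -> Type :=
| PcatSome r of ptarget p = psource q & psource r = psource p
    & ptarget r = ptarget q & parrows r = parrows p ++ parrows q :
    pcat_spec p q (Some r)
| PcatNone of ptarget p <> psource q : pcat_spec p q None.

Lemma pcatP p q : pcat_spec p q (pcat p q).
Proof.
rewrite /pcat; case: eqP => [e|ne]; last exact: PcatNone.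
case: insubP => [r _ er|/=].
  apply: PcatSome => //; rewrite /ptarget /psource /parrows er //=.
  by rewrite walk_end_cat -/(psource p) -/(parrows p) -/(ptarget p) e.
rewrite walk_cat -/(ptarget p) e.
by rewrite (valP p) (valP q).
Qed.

Lemma qpath_eq (p q : qpath) :
  psource p = psource q -> parrows p = parrows q -> p = q.
Proof.
by move=> e1 e2; apply: val_inj; apply/eqP; rewrite -pair_eqE /pair_eq /= -/(psource p)
  -/(parrows p) e1 e2 !eqxx.
Qed.

Lemma pcatA p q r :
  oapp (pcat p) None (pcat q r) = oapp (pcat^~ r) None (pcat p q).
Proof.
case: (pcatP q r) => [s e1 es et ea|ne1] /=;
case: (pcatP p q) => [t f1 fs ft fa|nf1] //=.
- case: (pcatP p s) => [u g1 gs gt ga|]; last by rewrite es.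
  case: (pcatP t r) => [w h1 hs ht ha|]; last by rewrite ft.
  congr Some; apply: qpath_eq; first by rewrite gs hs fs.
  by rewrite ga ha ea fa catA.
- by case: (pcatP p s) => // u; rewrite es => /nf1.
- by case: (pcatP t r) => // u; rewrite ft => /ne1.
Qed.

End Paths.

Definition path_algebra (K : fieldType) (Q : quiver) : Type := {malg K[qpath Q]}.

Section PathAlgebra.
Variables (K : fieldType) (Q : quiver).
Local Notation KQ := (path_algebra K Q).
Implicit Types (x y z : KQ) (p q r : qpath Q) (c : K).

HB.instance Definition _ := GRing.Lmodule.copy KQ {malg K[qpath Q]}.

Fact path_algebra_key : unit. Proof. by []. Qed.

(* [pbasis] and [pa_mul] below are locked only to keep unification from
   unfolding them. *)
Definition pbasis := locked_with path_algebra_key (fun c p => << c *g p >> : KQ).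
Lemma pbasisE c p : pbasis c p = << c *g p >>.
Proof. by rewrite /pbasis unlock. Qed.

Definition pcoeff p x : K := mcoeff p x.
Definition obasis (o : option (qpath Q)) c : KQ := oapp (pbasis c) 0 o.

Definition pa_one : KQ := \sum_(v : vertex Q) pbasis 1 (ptriv v).

Definition pa_mul_def x y : KQ :=
  \sum_(p <- msupp x) \sum_(q <- msupp y)
    obasis (pcat p q) (pcoeff p x * pcoeff q y).

Definition pa_mul := locked_with path_algebra_key pa_mul_def.

Lemma pa_mulE x y : pa_mul x y = \sum_(p <- msupp x) \sum_(q <- msupp y)
  obasis (pcat p q) (pcoeff p x * pcoeff q y).
Proof. by rewrite /pa_mul unlock. Qed.

Lemma obasis_zmod o : zmod_morphism (obasis o).
Proof. by case: o => [p|] x y /=; rewrite ?subr0 // !pbasisE raddfB. Qed.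

HB.instance Definition _ o :=
  GRing.isZmodMorphism.Build K KQ (obasis o) (obasis_zmod o).

Lemma pcoeff_zmod p : zmod_morphism (pcoeff p).
Proof. by move=> x y; rewrite /pcoeff raddfB. Qed.

HB.instance Definition _ p :=
  GRing.isZmodMorphism.Build KQ K (pcoeff p) (pcoeff_zmod p).

Lemma obasis0 o : obasis o 0 = 0.
Proof. exact: (raddf0 (obasis o)). Qed.

Lemma pcoeffZ p c x : pcoeff p (c *: x) = c * pcoeff p x.
Proof. exact: mcoeffZ. Qed.

Lemma pcoeff_basis p c q : pcoeff p (pbasis c q) = c *+ (q == p).
Proof. by rewrite pbasisE; exact: mcoeffU. Qed.

Lemma scale_basis c d p : c *: pbasis d p = pbasis (c * d) p.
Proof.
by apply/malgP => q; rewrite [LHS]pcoeffZ [RHS]pcoeff_basis pcoeff_basis mulrnAr.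
Qed.

Lemma pa_mulw (d1 d2 : {fset qpath Q}) x y :
  (msupp x `<=` d1)%fset -> (msupp y `<=` d2)%fset ->
  pa_mul x y = \sum_(p <- d1) \sum_(q <- d2)
    obasis (pcat p q) (pcoeff p x * pcoeff q y).
Proof.
move=> le1 le2; rewrite pa_mulE (big_fset_incl _ le1) /=.
  apply: eq_bigr => p _; apply: big_fset_incl => // q _ /mcoeff_outdom h.
  by rewrite /pcoeff h mulr0 obasis0.
move=> p _ /mcoeff_outdom h; rewrite big1 // => q _.
by rewrite /pcoeff h mul0r obasis0.
Qed.

Lemma pa_mulDl : left_distributive pa_mul +%R.
Proof.
move=> x y z.
rewrite (pa_mulw (msuppD_le x y) (fsubset_refl (msupp z))).
rewrite (pa_mulw (fsubsetUl (msupp x) (msupp y)) (fsubset_refl (msupp z))).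
rewrite (pa_mulw (fsubsetUr (msupp x) (msupp y)) (fsubset_refl (msupp z))).
rewrite -big_split /=; apply: eq_bigr => p _.
rewrite -big_split /=; apply: eq_bigr => q _.
by rewrite raddfD mulrDl (raddfD (obasis _)).
Qed.

Lemma pa_mulDr : right_distributive pa_mul +%R.
Proof.
move=> z x y.
rewrite (pa_mulw (fsubset_refl (msupp z)) (msuppD_le x y)).
rewrite (pa_mulw (fsubset_refl (msupp z)) (fsubsetUl (msupp x) (msupp y))).
rewrite (pa_mulw (fsubset_refl (msupp z)) (fsubsetUr (msupp x) (msupp y))).
rewrite -big_split /=; apply: eq_bigr => p _.
rewrite -big_split /=; apply: eq_bigr => q _.
by rewrite raddfD mulrDr (raddfD (obasis _)).
Qed.

Lemma pa_mulZl c x y : c *: pa_mul x y = pa_mul (c *: x) y.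
Proof.
rewrite (pa_mulw (msuppZ_le c x) (fsubset_refl (msupp y))) pa_mulE scaler_sumr.
apply: eq_bigr => p _; rewrite scaler_sumr; apply: eq_bigr => q _.
rewrite pcoeffZ -mulrA.
by case: (pcat p q) => [r|] /=; rewrite ?scaler0 // scale_basis.
Qed.

Lemma pa_mulZr c x y : c *: pa_mul x y = pa_mul x (c *: y).
Proof.
rewrite (pa_mulw (fsubset_refl (msupp x)) (msuppZ_le c y)) pa_mulE scaler_sumr.
apply: eq_bigr => p _; rewrite scaler_sumr; apply: eq_bigr => q _.
rewrite pcoeffZ mulrCA.
by case: (pcat p q) => [r|] /=; rewrite ?scaler0 // scale_basis.
Qed.

Lemma pa_mul0l y : pa_mul 0 y = 0.
Proof. by rewrite -[0 in LHS](scale0r 0) -pa_mulZl scale0r. Qed.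

Lemma pa_mul0r x : pa_mul x 0 = 0.
Proof. by rewrite -[0 in LHS](scale0r 0) -pa_mulZr scale0r. Qed.

Lemma pa_mulBB c d p q :
  pa_mul (pbasis c p) (pbasis d q) = obasis (pcat p q) (c * d).
Proof.
rewrite (pa_mulw (d1 := [fset p]%fset) (d2 := [fset q]%fset)) ?pbasisE ?msuppU_le //.
rewrite -!pbasisE.
by rewrite !big_seq_fset1 !pcoeff_basis !eqxx !mulr1n.
Qed.

Lemma pa_expand x : x = \sum_(p <- msupp x) pbasis (pcoeff p x) p.
Proof.
rewrite {1}(monalgE (x : {malg K[qpath Q]})).
by apply: eq_bigr => p _; rewrite pbasisE.
Qed.

Lemma pa_ind (P : KQ -> Prop) :
  P 0 -> (forall x y, P x -> P y -> P (x + y)) ->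
  (forall c p, P (pbasis c p)) -> forall x, P x.
Proof.
move=> P0 PD Pb x; rewrite (pa_expand x).
by elim/big_ind: _ => // p _; exact: Pb.
Qed.

Lemma pa_mulA : associative pa_mul.
Proof.
move=> x y z; elim/pa_ind: x => [|x1 x2 h1 h2|c p].
- by rewrite !pa_mul0l.
- by rewrite !(pa_mulDl x1 x2) h1 h2 pa_mulDl.
elim/pa_ind: y => [|y1 y2 h1 h2|d q].
- by rewrite pa_mul0l pa_mul0r pa_mul0l.
- by rewrite (pa_mulDl y1 y2) !(pa_mulDr (pbasis c p)) h1 h2 pa_mulDl.
elim/pa_ind: z => [|z1 z2 h1 h2|e r].
- by rewrite !pa_mul0r.
- by rewrite !(pa_mulDr _ z1 z2) pa_mulDr h1 h2.
rewrite !pa_mulBB.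
transitivity (obasis (oapp (pcat p) None (pcat q r)) (c * d * e)).
  by case: (pcat q r) => [s|] /=; rewrite ?pa_mul0r // pa_mulBB mulrA.
rewrite pcatA.
by case: (pcat p q) => [s|] /=; rewrite ?pa_mul0l // pa_mulBB.
Qed.

Lemma pa_one_basis c p : pa_mul pa_one (pbasis c p) = pbasis c p.
Proof.
rewrite /pa_one.
have h (r : seq (vertex Q)) :
    pa_mul (\sum_(v <- r) pbasis 1 (ptriv v)) (pbasis c p) =
    \sum_(v <- r) (if v == psource p then pbasis c p else 0).
  elim: r => [|v r IH]; first by rewrite !big_nil pa_mul0l.
  rewrite !big_cons pa_mulDl IH pa_mulBB mul1r; congr (_ + _).
  case: pcatP => [q e es et ea|ne] /=; last by case: eqP => // e; case: ne.
  have e' : v = psource p by [].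
  by rewrite e' eqxx; congr pbasis; apply: qpath_eq; rewrite ?ea // es.
by rewrite h -big_mkcond big_pred1_eq.
Qed.

Lemma pa_basis_one c p : pa_mul (pbasis c p) pa_one = pbasis c p.
Proof.
rewrite /pa_one.
have h (r : seq (vertex Q)) :
    pa_mul (pbasis c p) (\sum_(v <- r) pbasis 1 (ptriv v)) =
    \sum_(v <- r) (if v == ptarget p then pbasis c p else 0).
  elim: r => [|v r IH]; first by rewrite !big_nil pa_mul0r.
  rewrite !big_cons pa_mulDr IH pa_mulBB mulr1; congr (_ + _).
  case: pcatP => [q e es et ea|ne] /=.
    have -> : v = ptarget p by rewrite e.
    by rewrite eqxx; congr pbasis; apply: qpath_eq; rewrite ?es // ea cats0.
  by case: eqP => // e; case: ne; rewrite -e.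
by rewrite h -big_mkcond big_pred1_eq.
Qed.

Lemma pa_mul1l : left_id pa_one pa_mul.
Proof.
move=> x; elim/pa_ind: x => [|x y hx hy|c p].
- exact: pa_mul0r.
- by rewrite pa_mulDr hx hy.
- exact: pa_one_basis.
Qed.

Lemma pa_mul1r : right_id pa_one pa_mul.
Proof.
move=> x; elim/pa_ind: x => [|x y hx hy|c p].
- exact: pa_mul0l.
- by rewrite pa_mulDl hx hy.
- exact: pa_basis_one.
Qed.

Definition vertex_coeff (v : vertex Q) (x : KQ) : K := pcoeff (ptriv v) x.

Lemma vertex_coeff1 v : vertex_coeff v pa_one = 1.
Proof.
rewrite /vertex_coeff /pa_one raddf_sum (bigD1 v) //= pcoeff_basis eqxx.
rewrite big1 ?addr0 // => w nw; rewrite pcoeff_basis.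
by case: eqP => // -[e]; rewrite e eqxx in nw.
Qed.

Lemma pa_one_neq0 : pa_one != 0.
Proof.
apply/eqP => /(congr1 (vertex_coeff (vertex0 Q))); rewrite vertex_coeff1.
by rewrite /vertex_coeff raddf0 => /eqP; rewrite oner_eq0.
Qed.

HB.instance Definition _ := GRing.Zmodule_isNzRing.Build KQ
  pa_mulA pa_mul1l pa_mul1r pa_mulDl pa_mulDr pa_one_neq0.
HB.instance Definition _ := GRing.Lmodule_isLalgebra.Build K KQ pa_mulZl.
HB.instance Definition _ := GRing.Lalgebra_isAlgebra.Build K KQ pa_mulZr.

Lemma vertex_coeff_zmod v : zmod_morphism (vertex_coeff v).
Proof. by move=> x y; rewrite /vertex_coeff raddfB. Qed.

HB.instance Definition _ v :=
  GRing.isZmodMorphism.Build KQ K (vertex_coeff v) (vertex_coeff_zmod v).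

Lemma vertex_coeff_basis v c p :
  vertex_coeff v (pbasis c p) = c *+ (p == ptriv v).
Proof. exact: pcoeff_basis. Qed.

Lemma vertex_coeff_monoid v : monoid_morphism (vertex_coeff v).
Proof.
split=> [|x y]; first exact: vertex_coeff1.
rewrite (pa_expand x) (pa_expand y) mulr_suml !raddf_sum mulr_suml /=.
apply: eq_bigr => p _; rewrite mulr_sumr !raddf_sum mulr_sumr /=.
apply: eq_bigr => q _; rewrite [_ * _ in LHS]pa_mulBB !vertex_coeff_basis.
case: pcatP => [r e es et ea|ne] /=; last first.
  rewrite raddf0; case: eqP => [ep|_]; last by rewrite mulr0n mul0r.
  case: eqP => [eq|_]; last by rewrite mulr0n mulr0.
  by rewrite ep eq in ne.
rewrite vertex_coeff_basis.
have [ep|np] := eqVneq p (ptriv v).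
  have -> : (r == ptriv v) = (q == ptriv v); last by rewrite mulr1n mulrnAr.
  congr (_ == _); apply: qpath_eq; last by rewrite ea ep.
  by rewrite es -e ep.
rewrite mulr0n mul0r; case: eqP => // er; case/eqP: np.
have := ea; rewrite er /=; move/esym/eqP; rewrite -size_eq0 size_cat addn_eq0.
rewrite !size_eq0 => /andP[/eqP ep _].
by apply: qpath_eq; rewrite ?ep // -es er.
Qed.

HB.instance Definition _ v :=
  GRing.isMonoidMorphism.Build KQ K (vertex_coeff v) (vertex_coeff_monoid v).

Lemma vertex_coeffZ v c x : vertex_coeff v (c *: x) = c * vertex_coeff v x.
Proof. exact: pcoeffZ. Qed.

Definition qarrow (a : arrow Q) : KQ := pbasis 1 (parrow a).

Lemma vertex_coeff_arrow v a : vertex_coeff v (qarrow a) = 0.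
Proof. by rewrite vertex_coeff_basis; case: eqP. Qed.

End PathAlgebra.

(* The last field says that the relations have no terms of length 0. It makes
   the quotient nonzero and the simple modules at the vertices well defined. *)
Record bound_quiver (K : fieldType) := BoundQuiver {
  bq_quiver :> quiver;
  bq_rels : seq (path_algebra K bq_quiver);
  bq_rels_vertex : forall v, {in bq_rels, forall r, vertex_coeff v r = 0} }.

Section BoundQuiverAlgebra.
Variables (K : fieldType) (B : bound_quiver K).
Local Notation KQ := (path_algebra K B).

Inductive in_ideal : KQ -> Prop :=
| InIdeal0 : in_ideal 0
| InIdealD x a r b : in_ideal x -> r \in bq_rels B -> in_ideal (x + a * r * b).

Lemma in_idealD x y : in_ideal x -> in_ideal y -> in_ideal (x + y).
Proof.
move=> hx; elim=> [|z a r b _ IH hr]; first by rewrite addr0.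
by rewrite addrA; exact: InIdealD.
Qed.

Lemma in_idealM c x d : in_ideal x -> in_ideal (c * x * d).
Proof.
elim=> [|z a r b _ IH hr]; first by rewrite mulr0 mul0r; exact: InIdeal0.
have -> : c * (z + a * r * b) * d = c * z * d + (c * a) * r * (b * d).
  by rewrite mulrDr mulrDl !mulrA.
exact: InIdealD.
Qed.

Definition bq_ideal : pred KQ := fun x => `[< in_ideal x >].

Lemma bq_idealP x : reflect (in_ideal x) (x \in bq_ideal).
Proof. exact: asboolP. Qed.

Fact bq_ideal_zmod : zmod_closed bq_ideal.
Proof.
split=> [|x y /bq_idealP hx /bq_idealP hy]; apply/bq_idealP.
  exact: InIdeal0.
apply: in_idealD => //.
by have := in_idealM (-1) 1 hy; rewrite mulr1 mulN1r.
Qed.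

HB.instance Definition _ := GRing.isZmodClosed.Build KQ bq_ideal bq_ideal_zmod.

Lemma bq_idealMl c x : x \in bq_ideal -> c * x \in bq_ideal.
Proof.
move=> /bq_idealP h; apply/bq_idealP.
by have := in_idealM c 1 h; rewrite mulr1.
Qed.

Lemma bq_idealMr c x : x \in bq_ideal -> x * c \in bq_ideal.
Proof.
move=> /bq_idealP h; apply/bq_idealP.
by have := in_idealM 1 c h; rewrite mul1r.
Qed.

Lemma bq_ideal_vertex v x : x \in bq_ideal -> vertex_coeff v x = 0.
Proof.
move/bq_idealP; elim=> [|z a r b _ IH hr]; first by rewrite raddf0.
by rewrite raddfD /= IH add0r !rmorphM /= (bq_rels_vertex _ hr) mulr0 mul0r.
Qed.

Definition bq_ideal_closed : GRing.ZmodClosed.type KQ :=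
  GRing.ZmodClosed.clone KQ bq_ideal _.
Definition bq_algebra : Type := Quotient.quot bq_ideal_closed.

HB.instance Definition _ := GRing.Zmodule.on bq_algebra.

Definition bq_class (x : KQ) : bq_algebra := \pi_(Quotient.quot bq_ideal_closed)%qT x.
Definition bq_repr (x : bq_algebra) : KQ := repr (x : Quotient.quot bq_ideal_closed).

Lemma bq_reprK x : bq_class (bq_repr x) = x.
Proof. exact: reprK. Qed.

Lemma bq_classP x y : bq_class x = bq_class y <-> x - y \in bq_ideal.
Proof.
rewrite -/(is_true _) Quotient.idealrBE.
by split=> [/eqP|/eqP].
Qed.

Lemma bq_class_zmod : zmod_morphism bq_class.
Proof. exact: pi_is_zmod_morphism. Qed.

HB.instance Definition _ :=
  GRing.isZmodMorphism.Build KQ bq_algebra bq_class bq_class_zmod.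

Definition bq_one : bq_algebra := bq_class 1.
Definition bq_mul (x y : bq_algebra) : bq_algebra :=
  bq_class (bq_repr x * bq_repr y).
Definition bq_scale (c : K) (x : bq_algebra) : bq_algebra :=
  bq_class (c *: bq_repr x).

Lemma bq_mulE x y : bq_mul (bq_class x) (bq_class y) = bq_class (x * y).
Proof.
apply/bq_classP.
set x' := bq_repr _; set y' := bq_repr _.
have hx : x' - x \in bq_ideal by apply/bq_classP; rewrite bq_reprK.
have hy : y' - y \in bq_ideal by apply/bq_classP; rewrite bq_reprK.
have -> : x' * y' - x * y = (x' - x) * y' + x * (y' - y).
  by rewrite mulrBl mulrBr addrA subrK.
by apply: rpredD; [exact: bq_idealMr|exact: bq_idealMl].
Qed.

Lemma bq_scaleE c x : bq_scale c (bq_class x) = bq_class (c *: x).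
Proof.
apply/bq_classP; set x' := bq_repr _.
have hx : x' - x \in bq_ideal by apply/bq_classP; rewrite bq_reprK.
by rewrite -scalerBr -mulr_algl; exact: bq_idealMl.
Qed.

Lemma bq_ind (P : bq_algebra -> Prop) :
  (forall x, P (bq_class x)) -> forall x, P x.
Proof. by move=> h x; rewrite -(bq_reprK x). Qed.

Lemma bq_mulA : associative bq_mul.
Proof.
by elim/bq_ind=> x; elim/bq_ind=> y; elim/bq_ind=> z; rewrite !bq_mulE mulrA.
Qed.

Lemma bq_mul1l : left_id bq_one bq_mul.
Proof. by elim/bq_ind=> x; rewrite bq_mulE mul1r. Qed.

Lemma bq_mul1r : right_id bq_one bq_mul.
Proof. by elim/bq_ind=> x; rewrite bq_mulE mulr1. Qed.

Lemma bq_mulDl : left_distributive bq_mul +%R.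
Proof.
elim/bq_ind=> x; elim/bq_ind=> y; elim/bq_ind=> z.
by rewrite -raddfD !bq_mulE -raddfD mulrDl.
Qed.

Lemma bq_mulDr : right_distributive bq_mul +%R.
Proof.
elim/bq_ind=> x; elim/bq_ind=> y; elim/bq_ind=> z.
by rewrite -raddfD !bq_mulE -raddfD mulrDr.
Qed.

Lemma bq_one_neq0 : bq_one != 0.
Proof.
apply/eqP; rewrite -(raddf0 bq_class) => /bq_classP; rewrite subr0.
move/(bq_ideal_vertex (vertex0 B)); rewrite rmorph1 => /eqP.
by rewrite oner_eq0.
Qed.

HB.instance Definition _ := GRing.Zmodule_isNzRing.Build bq_algebra
  bq_mulA bq_mul1l bq_mul1r bq_mulDl bq_mulDr bq_one_neq0.

Lemma bq_scaleA c d x : bq_scale c (bq_scale d x) = bq_scale (c * d) x.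
Proof. by elim/bq_ind: x => x; rewrite !bq_scaleE scalerA. Qed.

Lemma bq_scale1 : left_id 1 bq_scale.
Proof. by elim/bq_ind=> x; rewrite bq_scaleE scale1r. Qed.

Lemma bq_scaleDr : right_distributive bq_scale +%R.
Proof.
move=> c; elim/bq_ind=> x; elim/bq_ind=> y.
by rewrite -raddfD !bq_scaleE -raddfD scalerDr.
Qed.

Lemma bq_scaleDl x : {morph bq_scale^~ x : c d / c + d}.
Proof. by elim/bq_ind: x => x c d; rewrite !bq_scaleE -raddfD scalerDl. Qed.

HB.instance Definition _ := GRing.Zmodule_isLmodule.Build K bq_algebra
  bq_scaleA bq_scale1 bq_scaleDr bq_scaleDl.

Lemma bq_scaleAl c (x y : bq_algebra) : c *: (x * y) = (c *: x) * y.
Proof.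
elim/bq_ind: x => x; elim/bq_ind: y => y.
by rewrite [RHS]/GRing.mul/= [in RHS]/GRing.scale/= bq_scaleE bq_mulE
  [in LHS]/GRing.mul/= bq_mulE [LHS]bq_scaleE scalerAl.
Qed.

Lemma bq_scaleAr c (x y : bq_algebra) : c *: (x * y) = x * (c *: y).
Proof.
elim/bq_ind: x => x; elim/bq_ind: y => y.
by rewrite [RHS]/GRing.mul/= [in RHS]/GRing.scale/= bq_scaleE bq_mulE
  [in LHS]/GRing.mul/= bq_mulE [LHS]bq_scaleE scalerAr.
Qed.

HB.instance Definition _ :=
  GRing.Lmodule_isLalgebra.Build K bq_algebra bq_scaleAl.
HB.instance Definition _ :=
  GRing.Lalgebra_isAlgebra.Build K bq_algebra bq_scaleAr.

Lemma bq_class_monoid : monoid_morphism bq_class.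
Proof. by split=> // x y; rewrite -bq_mulE. Qed.

HB.instance Definition _ :=
  GRing.isMonoidMorphism.Build KQ bq_algebra bq_class bq_class_monoid.

Definition bq_vertex_coeff (v : vertex B) (x : bq_algebra) : K :=
  vertex_coeff v (bq_repr x).

Lemma bq_vertex_coeffE v x : bq_vertex_coeff v (bq_class x) = vertex_coeff v x.
Proof.
apply/eqP; rewrite -subr_eq0 -raddfB; apply/eqP.
by apply: bq_ideal_vertex; apply/bq_classP; rewrite bq_reprK.
Qed.

End BoundQuiverAlgebra.

(* A right [A]-module is a left module over the converse ring [A^c]: for
   [a : A^c], the vector [a *: x] is the product of [x] with [a] on the right. *)
Notation rmodType A := (GRing.Lmodule.type A^c).

Section SimpleModule.
Variables (K : fieldType) (B : bound_quiver K) (v : vertex B).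
Local Notation L := (bq_algebra B).

Definition simple_at : Type := K.

HB.instance Definition _ := GRing.Zmodule.on simple_at.

Definition simple_scale (a : L^c) (x : simple_at) : simple_at :=
  (x : K) * bq_vertex_coeff v a.

Lemma simple_scaleA a b x :
  simple_scale a (simple_scale b x) = simple_scale (a * b) x.
Proof.
elim/bq_ind: a => a; elim/bq_ind: b => b; rewrite /simple_scale.
have -> : ((bq_class a : L^c) * bq_class b : L^c) = bq_class (b * a).
  by rewrite rmorphM.
by rewrite !bq_vertex_coeffE rmorphM /= mulrA.
Qed.

Lemma simple_scale1 : left_id 1 simple_scale.
Proof. by move=> x; rewrite /simple_scale bq_vertex_coeffE rmorph1 mulr1. Qed.

Lemma simple_scaleDr : right_distributive simple_scale +%R.
Proof. by move=> a x y; rewrite /simple_scale mulrDl. Qed.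

Lemma simple_scaleDl x : {morph simple_scale^~ x : a b / a + b}.
Proof.
elim/bq_ind=> a; elim/bq_ind=> b; rewrite /simple_scale.
have -> : ((bq_class a : L^c) + bq_class b : L^c) = bq_class (a + b).
  by rewrite raddfD.
by rewrite !bq_vertex_coeffE raddfD /= mulrDr.
Qed.

HB.instance Definition _ := GRing.Zmodule_isLmodule.Build L^c simple_at
  simple_scaleA simple_scale1 simple_scaleDr simple_scaleDl.

Definition simple_rmod : rmodType L := simple_at.

End SimpleModule.

Section RightModules.
Variables (K : fieldType) (A : algType K).
Implicit Types U V W P M N : rmodType A.

Definition regular_rmod : rmodType A := (A^c)^o.

Definition rmod_iso V W : Prop := exists f : {linear V -> W}, bijective f.

Definition surjective_fun (X Y : Type) (f : X -> Y) : Prop :=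
  forall y, exists x, f x = y.

Definition kscale V (c : K) (x : V) : V := ((c%:A : A) : A^c) *: x.

Definition fin_dim V : Prop :=
  exists (n : nat) (b : 'I_n -> V), forall x : V,
  exists c : 'I_n -> K, x = \sum_(i < n) kscale (c i) (b i).

Fixpoint dsum (s : seq (rmodType A)) : rmodType A :=
  if s is V :: s' then (V * dsum s')%type else 'rV[A^c]_0.

Definition in_add M N : Prop :=
  exists (n : nat) (N' : rmodType A), rmod_iso (N * N')%type (dsum (nseq n M)).

Definition projective P : Prop :=
  forall (V W : rmodType A) (g : {linear V -> W}) (f : {linear P -> W}),
  surjective_fun g -> exists h : {linear P -> V}, forall x, g (h x) = f x.

Definition superfluous P (X : P -> Prop) : Prop :=
  forall Y : {pred P}, GRing.submod_closed Y ->
  (forall p, exists x y, [/\ X x, y \in Y & p = x + y]) -> forall p, p \in Y.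

Definition projective_cover P V (f : {linear P -> V}) : Prop :=
  [/\ projective P, surjective_fun f & superfluous (fun x => f x = 0)].

(* [W] is isomorphic to the syzygy of [V], which is only defined up to
   isomorphism. *)
Definition is_syzygy V W : Prop :=
  exists (P : rmodType A) (f : {linear P -> V}) (g : {linear W -> P}),
  [/\ projective_cover f, injective g
    & forall x, f x = 0 <-> exists y, g y = x].

Definition is_syzygy2 V W : Prop :=
  exists U : rmodType A, is_syzygy V U /\ is_syzygy U W.

Record proj_resolution V := ProjResolution {
  res_obj : nat -> rmodType A;
  res_d : forall n, {linear res_obj n.+1 -> res_obj n};
  res_aug : {linear res_obj 0%N -> V};
  res_projective : forall n, projective (res_obj n);
  res_aug_surj : surjective_fun res_aug;
  res_exact0 : forall x, res_aug x = 0 <-> exists y, res_d 0 y = x;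
  res_exactS : forall n x, res_d n x = 0 <-> exists y, res_d n.+1 y = x }.

Section Cochains.
Variables (V W : rmodType A) (R : proj_resolution V).

Definition cocycle n (f : {linear res_obj R n -> W}) : Prop :=
  forall x, f (res_d R n x) = 0.

Definition coboundary n : {linear res_obj R n -> W} -> Prop :=
  match n with
  | 0%N => fun f => forall x, f x = 0
  | m.+1 => fun f =>
      exists g : {linear res_obj R m -> W}, forall x, f x = g (res_d R m x)
  end.

End Cochains.

(* [Ext^n(V, W)] is the [n]-th cohomology of [Hom(R, W)]. It is, up to
   isomorphism, independent of the projective resolution [R] of [V], and free
   resolutions always exist. *)
Definition ext_zero (n : nat) V W : Prop :=
  forall (R : proj_resolution V) (f : {linear res_obj R n -> W}),
  cocycle f -> coboundary f.

Definition cluster_tilting3 M : Prop :=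
  fin_dim M /\
  forall N, fin_dim N ->
    (in_add M N <-> forall i, i \in [:: 1; 2]%N -> ext_zero i M N) /\
    (in_add M N <-> forall i, i \in [:: 1; 2]%N -> ext_zero i N M).

End RightModules.

Definition candidate (K : fieldType) (B : bound_quiver K)
    (Gamma : {set vertex B}) (X : vertex B -> rmodType (bq_algebra B)) :
    rmodType (bq_algebra B) :=
  (regular_rmod (bq_algebra B)
   * (dsum [seq simple_rmod i | i <- enum Gamma]
      * dsum [seq X i | i <- enum (~: Gamma)]))%type.

Inductive tri_vertex := T1 | T2 | T3.
Inductive tri_arrow := Talpha | Tbeta | Tgamma | Tdelta.

Definition tri_vertex_ord (v : tri_vertex) : 'I_3 :=
  match v with T1 => inord 0 | T2 => inord 1 | T3 => inord 2 end.
Definition tri_vertex_of (i : 'I_3) : tri_vertex := nth T1 [:: T1; T2; T3] i.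
Lemma tri_vertex_ordK : cancel tri_vertex_ord tri_vertex_of.
Proof. by case; rewrite /tri_vertex_of inordK. Qed.
HB.instance Definition _ := Finite.copy tri_vertex (can_type tri_vertex_ordK).

Definition tri_arrow_ord (a : tri_arrow) : 'I_4 :=
  match a with
  | Talpha => inord 0 | Tbeta => inord 1 | Tgamma => inord 2 | Tdelta => inord 3
  end.
Definition tri_arrow_of (i : 'I_4) : tri_arrow :=
  nth Talpha [:: Talpha; Tbeta; Tgamma; Tdelta] i.
Lemma tri_arrow_ordK : cancel tri_arrow_ord tri_arrow_of.
Proof. by case; rewrite /tri_arrow_of inordK. Qed.
HB.instance Definition _ := Finite.copy tri_arrow (can_type tri_arrow_ordK).

Definition tri_source (a : tri_arrow) : tri_vertex :=
  match a with Talpha => T1 | Tbeta => T2 | Tgamma => T2 | Tdelta => T3 end.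
Definition tri_target (a : tri_arrow) : tri_vertex :=
  match a with Talpha => T2 | Tbeta => T1 | Tgamma => T3 | Tdelta => T2 end.

Definition tri_quiver : quiver := Quiver tri_source tri_target T1.

Section Triangle.
Variables (K : fieldType) (lambda : K).

Let alpha := @qarrow K tri_quiver Talpha.
Let beta := @qarrow K tri_quiver Tbeta.
Let gamma := @qarrow K tri_quiver Tgamma.
Let delta := @qarrow K tri_quiver Tdelta.

Definition tri_rels : seq (path_algebra K tri_quiver) :=
  [:: alpha * beta * alpha - alpha * gamma * delta;
      delta * beta * alpha - lambda *: (delta * gamma * delta);
      beta * alpha * beta - gamma * delta * beta;
      beta * alpha * gamma - lambda *: (gamma * delta * gamma);
      alpha * beta * alpha * gamma;
      beta * alpha * beta * alpha * beta;
      delta * gamma * delta * beta;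
      gamma * delta * gamma * delta * gamma;
      alpha * beta * alpha * beta * alpha;
      delta * gamma * delta * gamma * delta;
      delta * beta * alpha * beta].

Lemma tri_rels_vertex v : {in tri_rels, forall r, vertex_coeff v r = 0}.
Proof.
move=> r; rewrite !inE.
do ![case/predU1P=> [->|]]; last move/eqP=> ->;
  by rewrite ?rmorphB /= ?vertex_coeffZ !rmorphM /= !vertex_coeff_arrow
     !(mulr0, subr0).
Qed.

Definition triangle : bound_quiver K := BoundQuiver tri_rels_vertex.

End Triangle.

Definition tri_Gamma : {set tri_vertex} := [set T2].

Inductive sph_vertex := S1 | S2 | S3 | S4 | S5 | S6.
Inductive sph_arrow :=
  Salpha | Sbeta | Snu | Sdelta | Srho | Somega | Sgamma | Ssigma.

Definition sph_vertex_ord (v : sph_vertex) : 'I_6 :=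
  match v with
  | S1 => inord 0 | S2 => inord 1 | S3 => inord 2
  | S4 => inord 3 | S5 => inord 4 | S6 => inord 5
  end.
Definition sph_vertex_of (i : 'I_6) : sph_vertex :=
  nth S1 [:: S1; S2; S3; S4; S5; S6] i.
Lemma sph_vertex_ordK : cancel sph_vertex_ord sph_vertex_of.
Proof. by case; rewrite /sph_vertex_of inordK. Qed.
HB.instance Definition _ := Finite.copy sph_vertex (can_type sph_vertex_ordK).

Definition sph_arrow_ord (a : sph_arrow) : 'I_8 :=
  match a with
  | Salpha => inord 0 | Sbeta => inord 1 | Snu => inord 2 | Sdelta => inord 3
  | Srho => inord 4 | Somega => inord 5 | Sgamma => inord 6 | Ssigma => inord 7
  end.
Definition sph_arrow_of (i : 'I_8) : sph_arrow :=
  nth Salpha [:: Salpha; Sbeta; Snu; Sdelta; Srho; Somega; Sgamma; Ssigma] i.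
Lemma sph_arrow_ordK : cancel sph_arrow_ord sph_arrow_of.
Proof. by case; rewrite /sph_arrow_of inordK. Qed.
HB.instance Definition _ := Finite.copy sph_arrow (can_type sph_arrow_ordK).

Definition sph_source (a : sph_arrow) : sph_vertex :=
  match a with
  | Salpha => S1 | Sbeta => S2 | Snu => S3 | Sdelta => S5
  | Srho => S1 | Somega => S6 | Sgamma => S3 | Ssigma => S4
  end.
Definition sph_target (a : sph_arrow) : sph_vertex :=
  match a with
  | Salpha => S2 | Sbeta => S3 | Snu => S5 | Sdelta => S1
  | Srho => S6 | Somega => S3 | Sgamma => S4 | Ssigma => S1
  end.

Definition sph_quiver : quiver := Quiver sph_source sph_target S1.

Section Spherical.
Variables (K : fieldType) (lambda : K).

Let alpha := @qarrow K sph_quiver Salpha.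
Let beta := @qarrow K sph_quiver Sbeta.
Let nu := @qarrow K sph_quiver Snu.
Let delta := @qarrow K sph_quiver Sdelta.
Let rho := @qarrow K sph_quiver Srho.
Let omega := @qarrow K sph_quiver Somega.
Let gamma := @qarrow K sph_quiver Sgamma.
Let sigma := @qarrow K sph_quiver Ssigma.

Definition sph_rels : seq (path_algebra K sph_quiver) :=
  [:: alpha * beta * nu - rho * omega * nu;
      beta * nu * delta - lambda *: (beta * gamma * sigma);
      nu * delta * alpha - lambda *: (gamma * sigma * alpha);
      delta * alpha * beta - delta * rho * omega;
      gamma * sigma * rho - nu * delta * rho;
      sigma * rho * omega - lambda *: (sigma * alpha * beta);
      rho * omega * gamma - lambda *: (alpha * beta * gamma);
      omega * gamma * sigma - omega * nu * delta;
      alpha * beta * nu * delta * alpha;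
      beta * nu * delta * rho;
      nu * delta * alpha * beta * nu;
      delta * alpha * beta * gamma;
      gamma * sigma * rho * omega * gamma;
      sigma * rho * omega * nu;
      rho * omega * gamma * sigma * rho;
      omega * gamma * sigma * alpha;
      beta * gamma * sigma * rho;
      sigma * alpha * beta * nu;
      delta * rho * omega * gamma;
      omega * nu * delta * alpha;
      beta * nu * delta * alpha * beta;
      delta * alpha * beta * nu * delta;
      sigma * rho * omega * gamma * sigma;
      omega * gamma * sigma * rho * omega].

Lemma sph_rels_vertex v : {in sph_rels, forall r, vertex_coeff v r = 0}.
Proof.
move=> r; rewrite !inE.
do ![case/predU1P=> [->|]]; last move/eqP=> ->;
  by rewrite ?rmorphB /= ?vertex_coeffZ !rmorphM /= !vertex_coeff_arrow
     !(mulr0, subr0).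
Qed.

Definition spherical : bound_quiver K := BoundQuiver sph_rels_vertex.

End Spherical.

Definition sph_Gamma : {set sph_vertex} := [set S1; S3].

(* Main.v *)
(* The triangle and the spherical algebra have the same shape, the second being
   a double cover of the first: hubs (the vertices in Gamma) such that any two
   consecutive ones are joined by two paths of length 2, each through its own
   spoke. The relations say that a trace supported on the cycles of length 4
   makes the algebra A symmetric, so module maps N -> A are linear forms on N.
   As lambda is not 1, the 2 x 2 matrix of products of the paths between hubs
   is invertible, and the simple modules have explicit minimal projective
   presentations which extend to periodic exact complexes. The simple module at
   a spoke has as second syzygy a submodule U of the projective module at a hub,
   the kernel of left multiplication by an arrow.

   Through these complexes, the vanishing of Ext^1 and Ext^2 between N and M, on
   either side, becomes the same four conditions on the action of the arrows on
   N. Conversely, a nonzero N satisfying them has one of the projectives, the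
   modules U or the hub simples as a direct summand, the splitting being given
   by a suitable linear form on N; induction on the dimension then puts N in
   add(M). *)

Require Import Defs.
From HB Require Import structures.
From mathcomp Require Import all_boot all_order all_algebra.
From mathcomp Require Import ring finmap.
From mathcomp.multinomials Require Import monalg.
From mathcomp.classical Require Import boolp.

Set Implicit Arguments.
Unset Strict Implicit.
Unset Printing Implicit Defensive.

Import GRing.Theory.
Local Open Scope ring_scope.

(** * Ext through projective presentations *)

(** The relations only show that certain words span the algebra, and the independence of these words
    is not proved by rewriting. Instead a linear form is put on the path algebra, a cyclically
    invariant weight on the closed paths of length 4, and checked to vanish on the ideal; its values
    on products then separate the words. The same form gives the basis, the symmetry and the
    self-injectivity. That both sides lead to the same conditions reflects a duality: over a
    symmetric algebra, a module X isomorphic to its fourth syzygy has Ext^i(N, X) dual to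
    Ext^(3-i)(X, N). The proof does not invoke this duality but meets it: a condition that comes
    from degree i on one side comes from degree 3-i on the other. The order in which summands are
    split off is forced. Two of the four conditions assume that an arrow into a hub followed by an
    arrow out of it acts as zero on N, and this holds once N has no projective summand. The modules
    U come next; what is then left has hub components only, hence is semisimple. *)

Lemma linear_of_fun (R : nzRingType) (U V : lmodType R) (f : U -> V) :
  linear f -> exists g : {linear U -> V}, g =1 f.
Proof.
move=> fl.
pose b := GRing.isLinear.Build _ _ _ _ f fl.
pose g : {linear U -> V} := HB.pack f b.
by exists g.
Qed.

(** * Submodules given by propositions, and factorizations of linear maps *)

Section Submodule.
Variables (R : nzRingType) (V : lmodType R) (S : pred V).
Definition submodule of GRing.submod_closed S : Type := {x : V | S x}.
Variable hS : GRing.submod_closed S.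
HB.instance Definition _ := SubChoice.on (submodule hS).
HB.instance Definition _ :=
  GRing.SubChoice_isSubLmodule.Build R V S (submodule hS) hS.
End Submodule.

Lemma exists_submodule (R : nzRingType) (V : lmodType R) (S : V -> Prop) :
  S 0 -> (forall a x y, S x -> S y -> S (a *: x + y)) ->
  exists (U : lmodType R) (g : {linear U -> V}),
    injective g /\ forall x, S x <-> exists y, g y = x.
Proof.
move=> S0 SD.
have hS : GRing.submod_closed (fun x => `[< S x >]).
  split; first exact/asboolP.
  by move=> a x y /asboolP sx /asboolP sy; apply/asboolP; apply: SD.
exists (submodule hS), (val : {linear submodule hS -> V}); split.
  exact: val_inj.
move=> x; split=> [sx|[y <-]]; last exact/asboolP/(valP y).
by exists (exist _ x (asboolT sx)).
Qed.

Section LinearMaps.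
Variable R : nzRingType.
Implicit Types U V W Z P : lmodType R.

(** [h] is the composite of [j], the relation inverse to [d], and [f]: the first hypothesis makes it
    single-valued, the second makes it total. Factorizations through injections and surjections, and
    the homotopies between presentations, are instances. *)
Lemma linear_factor U W Z P (f : {linear Z -> W}) (d : {linear Z -> P})
    (j : {linear U -> P}) :
  (forall z, d z = 0 -> f z = 0) -> (forall u, exists z, d z = j u) ->
  exists h : {linear U -> W}, forall u z, d z = j u -> h u = f z.
Proof.
move=> fd jd.
pose s u := sval (cid (jd u)).
have sP u : d (s u) = j u by rewrite /s; case: cid.
have uni z z' : d z = d z' -> f z = f z'.
  move=> e; apply/eqP; rewrite -subr_eq0 -raddfB; apply/eqP/fd.
  by rewrite raddfB /= e subrr.
have [|h hE] := @linear_of_fun _ U W (fun u => f (s u)).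
  move=> a x y; rewrite -linearP; apply: uni.
  by rewrite sP !linearP !sP.
by exists h => u z e; rewrite hE; apply: uni; rewrite sP.
Qed.

Lemma linear_factor_inj U W P (g : {linear U -> P}) (f : {linear W -> P}) :
  injective g -> (forall x, exists y, g y = f x) ->
  exists h : {linear W -> U}, forall x, g (h x) = f x.
Proof.
move=> gi gf.
have [|h hE] := @linear_factor W U U P idfun g f _ gf.
  by move=> z gz; apply: gi; rewrite gz raddf0.
exists h => x; have [z e] := gf x.
by rewrite (hE x z e).
Qed.

Lemma linear_factor_surj V W P (g : {linear P -> V}) (f : {linear P -> W}) :
  surjective_fun g -> (forall x, g x = 0 -> f x = 0) ->
  exists h : {linear V -> W}, forall x, h (g x) = f x.
Proof.
move=> gs gf.
have [h hE] := @linear_factor V W P V f g idfun gf gs.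
by exists h => x; apply: hE.
Qed.

End LinearMaps.

Section Homological.
Variables (K : fieldType) (A : algType K).
Implicit Types U V W P Q Z M N : rmodType A.

Lemma projective_lift P V W (g : {linear V -> W}) (f : {linear P -> W}) :
  projective P -> (forall x, exists v, g v = f x) ->
  exists h : {linear P -> V}, forall x, g (h x) = f x.
Proof.
move=> Pp gf.
(* [projective] only lifts against surjections, so [g] and [f] are first corestricted to the image
   of [g]. *)
have [||I [j [ji jI]]] := @exists_submodule _ W (fun w => exists v, g v = w).
- by exists 0; rewrite raddf0.
- by move=> a x y [u <-] [v <-]; exists (a *: u + v); rewrite linearP.
have [|g' g'E] := @linear_factor_inj _ I V W j g ji.
  by move=> x; apply/jI; exists x.
have [|f' f'E] := @linear_factor_inj _ I P W j f ji.
  by move=> x; apply/jI.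
have [|h hE] := Pp _ _ g' f'.
  move=> y; have [v vE] : exists v, g v = j y by apply/jI; exists y.
  by exists v; apply: ji; rewrite g'E.
by exists h => x; rewrite -g'E hE f'E.
Qed.

Lemma projective_free n : projective ('rV[A^c]_n : rmodType A).
Proof.
move=> V W g f gs.
pose s i := sval (cid (gs (f (delta_mx 0 i)))).
have sP i : g (s i) = f (delta_mx 0 i) by rewrite /s; case: cid.
have [|h hE] := @linear_of_fun _ 'rV[A^c]_n V
    (fun x => \sum_(i < n) x ord0 i *: s i).
  move=> a x y; rewrite scaler_sumr -big_split /=; apply: eq_bigr => i _.
  by rewrite !mxE scalerDl scalerA.
exists h => x; rewrite hE linear_sum /= {2}(row_sum_delta x) linear_sum /=.
by apply: eq_bigr => i _; rewrite !linearZ /= sP.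
Qed.

Lemma projective_regular : projective (regular_rmod A).
Proof.
move=> V W g f gs.
have [v vE] := gs (f (1 : A^c)).
have [|h hE] := @linear_of_fun _ (regular_rmod A) V (fun x => (x : A^c) *: v).
  by move=> a x y; rewrite scalerDl -scalerA.
exists h => x; rewrite hE linearZ /= vE -linearZ /=; congr (f _).
exact: mulr1.
Qed.

Definition retract V W := exists (c : {linear V -> W}) (c' : {linear W -> V}),
  forall x, c' (c x) = x.

(** [V] is a summand of [W] plus a projective [Q], spelled out in components. Syzygies taken from
    arbitrary presentations agree only up to projective summands, so this is the relation that
    passes to them. *)
Definition stable_retract V W := exists (Q : rmodType A)
  (c : {linear V -> W}) (c' : {linear W -> V})
  (u : {linear V -> Q}) (v : {linear Q -> V}),
  projective Q /\ forall x, c' (c x) + v (u x) = x.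

Lemma retract_refl V : retract V V.
Proof. by exists idfun, idfun. Qed.

Lemma retract_trans V W U : retract V W -> retract W U -> retract V U.
Proof.
move=> [c [c' cK]] [b [b' bK]].
by exists (b \o c), (c' \o b') => x /=; rewrite bK cK.
Qed.

Lemma retract_iso V W : rmod_iso V W -> retract V W /\ retract W V.
Proof.
move=> [f [g fK gK]].
have [|g' g'E] := @linear_of_fun _ W V g.
  by move=> a x y; apply: (can_inj fK); rewrite linearP !gK.
by split; [exists f, g' => x|exists g', f => x]; rewrite g'E ?fK ?gK.
Qed.

Lemma retract_projective V W : retract V W -> projective W -> projective V.
Proof.
move=> [c [c' cK]] Wp X Y g f gs.
have [h hE] := Wp _ _ g (f \o c') gs.
by exists (h \o c) => x /=; rewrite hE /= cK.
Qed.

Lemma retract_fst V W : retract V (V * W)%type.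
Proof.
have [|c cE] := @linear_of_fun _ V (V * W)%type (fun x => (x, 0)).
  by move=> a x y; congr (_, _) => //=; rewrite scaler0 addr0.
by exists c, fst => x; rewrite cE.
Qed.

Lemma retract_snd V W : retract W (V * W)%type.
Proof.
have [|c cE] := @linear_of_fun _ W (V * W)%type (fun x => (0, x)).
  by move=> a x y; congr (_, _) => //=; rewrite scaler0 addr0.
by exists c, snd => x; rewrite cE.
Qed.

Lemma linear_pair U V W (f : {linear U -> V}) (g : {linear U -> W}) :
  exists h : {linear U -> (V * W)%type}, forall x, h x = (f x, g x).
Proof.
by apply: linear_of_fun => a x y; rewrite !linearP.
Qed.

Lemma linear_copair U V W (f : {linear V -> U}) (g : {linear W -> U}) :
  exists h : {linear (V * W)%type -> U}, forall x, h x = f x.1 + g x.2.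
Proof.
apply: linear_of_fun => a x y /=.
by rewrite !linearP /= scalerDr addrACA.
Qed.

Lemma projective_prod V W :
  projective V -> projective W -> projective (V * W)%type.
Proof.
move=> Vp Wp X Y g f gs.
have [i iE] : exists i : {linear V -> (V * W)%type}, forall x, i x = (x, 0).
  by apply: linear_of_fun => a x y; congr (_, _) => //=; rewrite scaler0 addr0.
have [j jE] : exists j : {linear W -> (V * W)%type}, forall x, j x = (0, x).
  by apply: linear_of_fun => a x y; congr (_, _) => //=; rewrite scaler0 addr0.
have [h1 h1E] := Vp _ _ g (f \o i) gs.
have [h2 h2E] := Wp _ _ g (f \o j) gs.
have [h hE] := linear_copair h1 h2.
exists h => -[x y]; rewrite hE /= raddfD /= h1E h2E /= iE jE -raddfD /=.
by congr (f (_, _)); rewrite /= ?addr0 ?add0r.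
Qed.

Lemma retract_prod V V' W W' :
  retract V V' -> retract W W' -> retract (V * W)%type (V' * W')%type.
Proof.
move=> [c [c' cK]] [b [b' bK]].
have [f fE] := linear_pair (c \o fst : {linear (V * W)%type -> V'}) (b \o snd).
have [g gE] := linear_pair (c' \o fst : {linear (V' * W')%type -> V}) (b' \o snd).
by exists f, g => -[x y]; rewrite gE fE /= cK bK.
Qed.

Lemma retract_stable V W : retract V W -> stable_retract V W.
Proof.
move=> [c [c' cK]].
exists (regular_rmod A), c, c', \0, \0; split; first exact: projective_regular.
by move=> x /=; rewrite cK addr0.
Qed.

Definition exact_at U V W (d : {linear U -> V}) (d' : {linear V -> W}) :=
  forall x, d' x = 0 <-> exists y, d y = x.

(** A map on [Z] killing the kernel of [d] is a map on the image of [d]. As [d] may fail to be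
    injective, the same notion serves a syzygy embedded in [P] and the next term of a resolution. *)
Definition extends_along Z P (d : {linear Z -> P}) W :=
  forall f : {linear Z -> W}, (forall z, d z = 0 -> f z = 0) ->
  exists k : {linear P -> W}, forall z, f z = k (d z).

Definition ext1_zero V W := forall P Z (p : {linear P -> V}) (d : {linear Z -> P}),
  projective P -> surjective_fun p -> exact_at d p -> extends_along d W.

(** One presentation, of a module having [V] as a summand up to a projective, decides for all
    presentations of [V]. Comparison maps [a] and [a'] carry the extension problem over and back;
    the error of the round trip lands in the kernel of [p1] and is absorbed by a homotopy [s]. *)
Lemma ext1_zero_pres V V' W P Z (p : {linear P -> V'}) (d : {linear Z -> P}) :
  stable_retract V V' ->
  projective P -> surjective_fun p -> exact_at d p -> extends_along d W ->
  ext1_zero V W.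
Proof.
move=> [Q [c [c' [u [v [Qp cE]]]]]] Pp ps ex ed P1 Z1 p1 d1 P1p p1s ex1 f fd.
have [a aE] := P1p _ _ p (c \o p1) ps.
have [a' a'E] := Pp _ _ p1 (c' \o p) p1s.
have [v' v'E] := Qp _ _ p1 v p1s.
have pd z : p (d z) = 0 by apply/ex; exists z.
have p1d1 z : p1 (d1 z) = 0 by apply/ex1; exists z.
(* [h] is [f] transported to [Z] along [a']. *)
have [|h hE] := linear_factor (j := a' \o d) fd.
  by move=> z; apply/ex1; rewrite /= a'E /= pd raddf0.
have hd z : d z = 0 -> h z = 0.
  move=> dz; rewrite (hE z 0) ?raddf0 //=.
  by rewrite dz raddf0.
have [k kE] := ed h hd.
have [|s sE] := linear_factor
    (j := (idfun : {linear P1 -> P1}) \- (a' \o a) \- (v' \o u \o p1)) fd.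
  move=> x; apply/ex1; rewrite !raddfB /= a'E /= aE /= v'E.
  by rewrite -{1}(cE (p1 x)) addrAC addrK subrr.
exists (s \+ (k \o a)) => z /=.
have [z' z'E] : exists z', d z' = a (d1 z).
  by apply/ex; rewrite aE /= p1d1 raddf0.
have [y yE] : exists y, d1 y = a' (d z').
  by apply/ex1; rewrite a'E /= pd raddf0.
rewrite -z'E -kE (hE z' y yE) (sE (d1 z) (z - y)); first by rewrite raddfB subrK.
by rewrite raddfB /= p1d1 !raddf0 addr0 yE z'E.
Qed.

Lemma ext1_zero_stable V V' W :
  stable_retract V V' -> ext1_zero V' W ->
  (exists P Z (p : {linear P -> V'}) (d : {linear Z -> P}),
    [/\ projective P, surjective_fun p & exact_at d p]) ->
  ext1_zero V W.
Proof.
move=> VV' e [P [Z [p [d [Pp ps ex]]]]].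
exact: (ext1_zero_pres VV' Pp ps ex (e _ _ p d Pp ps ex)).
Qed.

(** A one-sided form of Schanuel's lemma. The projective that absorbs the error is [P] itself,
    entered by [g] and left by the homotopy [s]. *)
Lemma syzygy_stable V V' P U P' U' (p : {linear P -> V}) (g : {linear U -> P})
    (p' : {linear P' -> V'}) (g' : {linear U' -> P'}) :
  stable_retract V V' ->
  projective P -> surjective_fun p -> injective g -> exact_at g p ->
  projective P' -> surjective_fun p' -> injective g' -> exact_at g' p' ->
  stable_retract U U'.
Proof.
move=> [Q [c [c' [u [v [Qp cE]]]]]] Pp ps gi ex Pp' ps' gi' ex'.
have [a aE] := Pp _ _ p' (c \o p) ps'.
have [a' a'E] := Pp' _ _ p (c' \o p') ps.
have [v' v'E] := Qp _ _ p v ps.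
have pg z : p (g z) = 0 by apply/ex; exists z.
have pg' z : p' (g' z) = 0 by apply/ex'; exists z.
have [|b bE] := linear_factor_inj (f := a \o g) gi'.
  by move=> z; apply/ex'; rewrite /= aE /= pg raddf0.
have [|b' b'E] := linear_factor_inj (f := a' \o g') gi.
  by move=> z; apply/ex; rewrite /= a'E /= pg' raddf0.
have [|s sE] := linear_factor_inj
    (f := (idfun : {linear P -> P}) \- (a' \o a) \- (v' \o u \o p)) gi.
  move=> x; apply/ex; rewrite !raddfB /= a'E /= aE /= v'E.
  by rewrite -{1}(cE (p x)) addrAC addrK subrr.
exists P, b, b', g, s; split=> // x; apply: gi.
by rewrite raddfD /= b'E /= bE /= sE /= pg !raddf0 addr0 addrC subrK.
Qed.

Lemma stable_retract_refl V : stable_retract V V.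
Proof. exact/retract_stable/retract_refl. Qed.

Lemma exists_kernel V W (p : {linear V -> W}) :
  exists (U : rmodType A) (g : {linear U -> V}), injective g /\ exact_at g p.
Proof.
have [||U [g [gi gE]]] := @exists_submodule _ V (fun x => p x = 0).
- exact: raddf0.
- by move=> a x y px py; rewrite linearP /= px py scaler0 addr0.
by exists U, g.
Qed.

(** Dimension shift: Ext^2 of [V] is Ext^1 of any first syzygy. *)
Definition ext2_zero V W := forall P U (p : {linear P -> V}) (g : {linear U -> P}),
  projective P -> surjective_fun p -> injective g -> exact_at g p ->
  ext1_zero U W.

(** [ext_zero] quantifies over all resolutions and would hold vacuously if there were none; hence
    the inhabitant. *)
Lemma ext_zero1E V W : inhabited (proj_resolution V) ->
  ext_zero 1 V W <-> ext1_zero V W.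
Proof.
move=> [R]; split=> [e|e R' f fc].
  apply: (ext1_zero_pres (stable_retract_refl V) (@res_projective _ _ _ R 0)
    (@res_aug_surj _ _ _ R) (@res_exact0 _ _ _ R)) => f fd.
  apply: (e R f) => x; apply: fd.
  by apply/(@res_exactS _ _ _ R 0); exists x.
apply: (e _ _ _ _ (@res_projective _ _ _ R' 0) (@res_aug_surj _ _ _ R')
  (@res_exact0 _ _ _ R')) => z.
by move/(@res_exactS _ _ _ R' 0) => [y <-]; apply: fc.
Qed.

Lemma ext_zero2E V W : inhabited (proj_resolution V) ->
  ext_zero 2 V W <-> ext2_zero V W.
Proof.
(* The first differential is split into a surjection onto the first syzygy and its embedding, so
   that the tail of the resolution presents the syzygy. *)
have key (R : proj_resolution V) : exists U (g : {linear U -> res_obj R 0})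
    (p : {linear res_obj R 1 -> U}),
    [/\ injective g, exact_at g (res_aug R), (forall x, g (p x) = res_d R 0 x),
      surjective_fun p & exact_at (res_d R 1) p].
  have [U [g [gi gE]]] := exists_kernel (res_aug R).
  have [|p pE] := linear_factor_inj (f := res_d R 0) gi.
    by move=> x; apply/gE/(@res_exact0 _ _ _ R); exists x.
  exists U, g, p; split=> // [u|x].
    have /(@res_exact0 _ _ _ R)[x xE] : res_aug R (g u) = 0 by apply/gE; exists u.
    by exists x; apply: gi; rewrite pE.
  split=> [px|[y <-]]; first by apply/(@res_exactS _ _ _ R 0); rewrite -pE px raddf0.
  apply: gi; rewrite pE raddf0.
  by apply/(@res_exactS _ _ _ R 0); exists y.
move=> [R]; split=> [e P U p g Pp ps gi ex|e R' f fc].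
  have [U' [g' [p' [gi' ex' p'E p's ex'']]]] := key R.
  apply: (ext1_zero_pres (syzygy_stable (stable_retract_refl V) Pp ps gi ex
    (@res_projective _ _ _ R 0) (@res_aug_surj _ _ _ R) gi' ex')
    (@res_projective _ _ _ R 1) p's ex'') => f fd.
  apply: (e R f) => x; apply: fd.
  by apply/(@res_exactS _ _ _ R 1); exists x.
have [U' [g' [p' [gi' ex' p'E p's ex'']]]] := key R'.
have := e _ _ _ _ (@res_projective _ _ _ R' 0) (@res_aug_surj _ _ _ R') gi' ex'.
move=> /(_ _ _ _ _ (@res_projective _ _ _ R' 1) p's ex'') h.
apply: h => z /(@res_exactS _ _ _ R' 1) [y <-]; exact: fc.
Qed.

End Homological.

(** * Finite-dimensional modules *)

Lemma subspace_rowspace (K : fieldType) n (T : 'rV[K]_n -> Prop) :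
  T 0 -> (forall c x y, T x -> T y -> T (c *: x + y)) ->
  exists B : 'M[K]_n, forall y, T y <-> (y <= B)%MS.
Proof.
move=> T0 TD.
(* A matrix of maximal rank with rows in [T] has [T] as row space, since a further vector of [T]
   would raise the rank. *)
pose Q k := `[< exists B : 'M[K]_n, (forall i, T (row i B)) /\ \rank B = k >].
have exQ : exists k, Q k.
  exists 0%N; apply/asboolP; exists 0; split; last exact: mxrank0.
  by move=> i; rewrite row0.
have ubQ k : Q k -> (k <= n)%N.
  by move=> /asboolP[B [_ <-]]; apply: rank_leq_row.
case: (ex_maxnP exQ ubQ) => k /asboolP[B [BT rB]] kmax.
have Tcomb m (C : 'M[K]_(m, n)) y : (forall i, T (row i C)) -> (y <= C)%MS -> T y.
  move=> CT /submxP[D ->]; rewrite mulmx_sum_row.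
  elim/big_ind: _ => // [x x' hx hx'|i _].
    by rewrite -(scale1r x); apply: TD.
  by rewrite -[_ *: _]addr0; apply: TD.
exists B => y; split=> [Ty|]; last exact: Tcomb.
have rows i : T (row i (B + y)%MS).
  apply: (Tcomb _ (col_mx B y)).
    by move=> j; rewrite -(splitK j); case: (split j) => j' /=;
      rewrite ?(rowKu, rowKd) // row_id.
  by apply: submx_trans (row_sub _ _) _; rewrite addsmxE.
have : (\rank (B + y)%MS <= \rank B)%N.
  by rewrite [leqRHS]rB; apply: kmax; apply/asboolP; exists (B + y)%MS.
rewrite (geq_leqif (mxrank_leqif_sup (addsmxSl B y))).
by apply: submx_trans; exact: addsmxSr.
Qed.

Section FiniteDimension.
Variables (K : fieldType) (A : algType K).
Implicit Types U V W P Q Z M N : rmodType A.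

Lemma kscaleDr V c (x y : V) : kscale c (x + y) = kscale c x + kscale c y.
Proof. exact: scalerDr. Qed.

Lemma kscaleDl V c d (x : V) : kscale (c + d) x = kscale c x + kscale d x.
Proof. by rewrite /kscale scalerDl; exact: scalerDl. Qed.

Lemma kscaleA V c d (x : V) : kscale c (kscale d x) = kscale (c * d) x.
Proof.
rewrite /kscale scalerA; congr (_ *: _).
rewrite -[LHS]/((d%:A : A) * c%:A).
by rewrite -scalerAl mul1r scalerA mulrC.
Qed.

Lemma kscale1 V (x : V) : kscale 1 x = x.
Proof. by rewrite /kscale scale1r; apply: scale1r. Qed.

Lemma kscale0 V (x : V) : kscale 0 x = 0.
Proof. by rewrite /kscale scale0r; apply: scale0r. Qed.

Lemma kscaler0 V c : kscale c (0 : V) = 0.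
Proof. exact: scaler0. Qed.

Lemma kscale_act V c (a : A) (x : V) :
  (a : A^c) *: kscale c x = kscale c ((a : A^c) *: x).
Proof.
rewrite /kscale !scalerA; congr (_ *: _).
rewrite -[LHS]/((c%:A : A) * a) -[RHS]/(a * (c%:A : A)).
by rewrite -scalerAl -scalerAr mul1r mulr1.
Qed.

Lemma scale_act V c (a : A) (x : V) :
  ((c *: a : A) : A^c) *: x = kscale c ((a : A^c) *: x).
Proof.
rewrite /kscale scalerA; congr (_ *: _).
by rewrite -[RHS]/(a * (c%:A : A)) -scalerAr mulr1.
Qed.

Lemma linear_kscale V W (f : {linear V -> W}) c x : f (kscale c x) = kscale c (f x).
Proof. exact: linearZ. Qed.

Lemma kscale_sum V c n (b : 'I_n -> V) :
  kscale c (\sum_i b i) = \sum_i kscale c (b i).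
Proof. exact: scaler_sumr. Qed.

Definition spans V n (b : 'I_n -> V) :=
  forall x, exists c : 'I_n -> K, x = \sum_(i < n) kscale (c i) (b i).

(** Pulling back along [lincomb b] turns subspaces of [V] into row spaces. The family [b] only
    spans, so a vector has no canonical coordinates. *)
Definition lincomb V n (b : 'I_n -> V) (r : 'rV[K]_n) := \sum_(i < n) kscale (r 0 i) (b i).

Lemma lincombP V n (b : 'I_n -> V) c r r' :
  lincomb b (c *: r + r') = kscale c (lincomb b r) + lincomb b r'.
Proof.
rewrite /lincomb kscale_sum -big_split /=; apply: eq_bigr => i _.
by rewrite !mxE kscaleDl kscaleA.
Qed.

Lemma spans_lincomb V n (b : 'I_n -> V) : spans b -> forall x, exists r, lincomb b r = x.
Proof.
move=> bs x; have [c ->] := bs x; exists (\row_i c i).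
by apply: eq_bigr => i _; rewrite mxE.
Qed.

Definition ksubspace V (S : V -> Prop) :=
  S 0 /\ forall c x y, S x -> S y -> S (kscale c x + y).

Lemma ksubspace_rowspace V n (b : 'I_n -> V) (S : V -> Prop) : ksubspace S ->
  exists B : 'M[K]_n, forall r, S (lincomb b r) <-> (r <= B)%MS.
Proof.
move=> [S0 SD]; apply: subspace_rowspace => [|c x y].
  by rewrite /lincomb big1 // => i _; rewrite mxE kscale0.
by rewrite lincombP; apply: SD.
Qed.

Definition kform V (phi : V -> K) := forall c x y, phi (kscale c x + y) = c * phi x + phi y.

Lemma kform0 V (phi : V -> K) : kform phi -> phi 0 = 0.
Proof.
move=> h; have := h 1 0 0; rewrite kscaler0 addr0 mul1r => /eqP.
by rewrite -subr_eq0 opprD addNKr oppr_eq0 => /eqP.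
Qed.

Lemma kformD V (phi : V -> K) x y : kform phi -> phi (x + y) = phi x + phi y.
Proof. by move=> h; have := h 1 x y; rewrite kscale1 mul1r. Qed.

Lemma kformZ V (phi : V -> K) c x : kform phi -> phi (kscale c x) = c * phi x.
Proof. by move=> h; have := h c x 0; rewrite !addr0 (kform0 h) addr0. Qed.

Lemma separating_form V (S : V -> Prop) x : fin_dim V -> ksubspace S -> ~ S x ->
  exists phi : V -> K, [/\ kform phi, phi x = 1 & forall y, S y -> phi y = 0].
Proof.
move=> [n [b bs]] SS nSx.
have [B BE] := ksubspace_rowspace b SS.
pose coord y := sval (cid (spans_lincomb bs y)).
have coordK y : lincomb b (coord y) = y by rewrite /coord; case: cid.
pose C := cokermx B.
have [j jx] : exists j, (coord x *m C) 0 j != 0.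
  have : ~~ (coord x <= B)%MS by apply/negP => /BE; rewrite coordK.
  rewrite submxE; case: (pickP (fun j => (coord x *m C) 0 j != 0)) => [j hj _|h].
    by exists j.
  by case/eqP; apply/rowP => j; rewrite [RHS]mxE; apply/eqP; move/negbFE: (h j).
(* [coord] is a mere choice and not linear. Its defects of linearity are coordinate vectors of 0,
   and [C] kills these because [S] contains 0. *)
pose phi y := (coord y *m C) 0 j / (coord x *m C) 0 j.
have zero r : S (lincomb b r) -> r *m C = 0.
  by move/BE; rewrite submxE => /eqP.
exists phi; split.
- move=> c y z; rewrite /phi mulrA -mulrDl; congr (_ / _).
  have : (coord (kscale c y + z) - (c *: coord y + coord z)) *m C = 0.
    apply: zero; case: (SS) => S0 _.
    rewrite -[_ - _]addrC -scaleN1r lincombP lincombP !coordK.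
    have -> t : kscale (-1) t + t = 0 :> V; last by [].
    by rewrite -{2}(kscale1 t) -kscaleDl addNr kscale0.
  rewrite mulmxBl => /eqP; rewrite subr_eq0 => /eqP ->.
  by rewrite mulmxDl -scalemxAl !mxE.
- by rewrite /phi divff.
- by move=> y Sy; rewrite /phi zero ?coordK // mxE mul0r.
Qed.

Lemma fin_dim_inj U V (g : {linear U -> V}) : injective g -> fin_dim V -> fin_dim U.
Proof.
move=> gi [n [b bs]].
have [|B BE] := @ksubspace_rowspace V n b (fun x => exists y, g y = x).
  split; first by exists 0; rewrite raddf0.
  by move=> c x y [u <-] [v <-]; exists (kscale c u + v); rewrite raddfD /= linear_kscale.
have hs i : exists y, g y = lincomb b (row i B) by apply/BE/row_sub.
pose s i := sval (cid (hs i)).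
have sP i : g (s i) = lincomb b (row i B) by rewrite /s; case: cid.
exists n, s => x.
have [r rE] := spans_lincomb bs (g x).
have /submxP[D DE] : (r <= B)%MS by apply/BE; exists x; rewrite rE.
exists (fun i => D 0 i); apply: gi; rewrite raddf_sum /= -rE DE mulmx_sum_row.
have -> : lincomb b (\sum_i D 0 i *: row i B) = \sum_i kscale (D 0 i) (lincomb b (row i B)).
  elim/big_ind2: _ => [|r1 x1 r2 x2 <- <-|i _].
  - by rewrite /lincomb big1 // => i _; rewrite mxE kscale0.
  - by have := lincombP b 1 x1 x2; rewrite scale1r kscale1.
  have := lincombP b (D 0 i) (row i B) 0; rewrite addr0 => ->.
  by rewrite [lincomb _ 0]big1 ?addr0 // => j _; rewrite mxE kscale0.
by apply: eq_bigr => i _; rewrite linear_kscale sP.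
Qed.

Lemma fin_dim_surj V W (p : {linear V -> W}) : surjective_fun p -> fin_dim V -> fin_dim W.
Proof.
move=> ps [n [b bs]]; exists n, (fun i => p (b i)) => y.
have [x <-] := ps y; have [c ->] := bs x; exists c.
by rewrite raddf_sum; apply: eq_bigr => i _; rewrite /= linear_kscale.
Qed.

Lemma fin_dim_prod V W : fin_dim V -> fin_dim W -> fin_dim (V * W)%type.
Proof.
move=> [n [b bs]] [m [d ds]].
exists (n + m)%N, (fun i => match split i with inl j => (b j, 0) | inr j => (0, d j) end).
move=> [x y]; have [c cE] := bs x; have [e eE] := ds y.
exists (fun i => match split i with inl j => c j | inr j => e j end).
rewrite big_split_ord /=.
under eq_bigr => i _ do rewrite -/(unsplit (inl i)) unsplitK.
under [X in _ + X]eq_bigr => i _ do rewrite -/(unsplit (inr i)) unsplitK.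
rewrite [LHS]surjective_pairing; congr (_, _); rewrite /= raddf_sum raddf_sum /=.
  rewrite [X in _ + X]big1 ?addr0 // => i _; exact: kscaler0.
rewrite [X in X + _]big1 ?add0r // => i _; exact: kscaler0.
Qed.

Lemma fin_dim_retract V W : retract V W -> fin_dim W -> fin_dim V.
Proof.
move=> [c [c' cK]]; apply: (@fin_dim_surj W V c') => x; by exists (c x).
Qed.

Lemma fin_dim0 : fin_dim ('rV[A^c]_0 : rmodType A).
Proof.
exists 0%N, (fun=> 0) => x; exists (fun=> 0).
by rewrite big_ord0; apply/rowP => -[].
Qed.

(** Takes the place of a dimension count: dividing by a nonzero vector shortens a spanning family.
    The induction that splits off summands runs on this length. *)
Lemma spans_quotient V W n (b : 'I_n -> V) (p : {linear V -> W}) w :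
  spans b -> surjective_fun p -> w != 0 -> p w = 0 ->
  exists m (d : 'I_m -> W), (m < n)%N /\ spans d.
Proof.
move=> bs ps w0 pw.
have [c cE] := bs w.
have [i ci] : exists i, c i != 0.
  case: (pickP (fun i => c i != 0)) => [i|h]; first by exists i.
  case/eqP: w0; rewrite cE big1 // => i _.
  by move/negbFE/eqP: (h i) => ->; rewrite kscale0.
case: n b bs c cE i ci => [|n] b bs c cE i ci; first by case: i ci.
exists n, (fun j => p (b (lift i j))); split=> // y.
have [x <-] := ps y; have [e ->] := bs x.
(* The relation [p w = 0] expresses [p (b i)] through the other generators. *)
exists (fun j => e (lift i j) - e i / c i * c (lift i j)).
have : kscale (e i / c i) (p w) = 0 by rewrite pw kscaler0.
rewrite {1}cE raddf_sum kscale_sum /= => h0.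
rewrite raddf_sum /= -[LHS]subr0 -[X in _ - X]h0 -sumrB (bigD1_ord i) //=.
rewrite !(linear_kscale p) kscaleA divfK // subrr add0r.
apply: eq_bigr => j _; rewrite !(linear_kscale p) kscaleA.
by apply/eqP; rewrite subr_eq -kscaleDl subrK.
Qed.

End FiniteDimension.

(** * Ext over a finite-dimensional algebra *)

Section FiniteDimensionalAlgebra.
Variables (K : fieldType) (A : algType K).
Hypothesis A_fin : fin_dim (regular_rmod A).
Implicit Types U V W P Q Z M N I J : rmodType A.

Lemma fin_dim_free n : fin_dim ('rV[A^c]_n : rmodType A).
Proof.
elim: n => [|n IH]; first exact: fin_dim0.
have [|f fE] := @linear_of_fun _ (regular_rmod A * 'rV[A^c]_n)%type 'rV[A^c]_n.+1
    (fun x => row_mx (x.1 : A^c)%:M x.2).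
  move=> a x y; apply/rowP => i; rewrite !mxE.
  by case: splitP => j _; rewrite !mxE // mulrnDl -mulrnAr.
apply: (fin_dim_surj (p := f)); last exact: fin_dim_prod.
move=> y; have [z zE] : exists z : 'rV_(1 + n), z = y by exists y.
exists (lsubmx z 0 0, rsubmx z); rewrite fE /= -zE -{3}(hsubmxK z).
by rewrite [lsubmx z in RHS]mx11_scalar.
Qed.

Lemma exists_presentation V : fin_dim V ->
  exists P U (p : {linear P -> V}) (g : {linear U -> P}),
    [/\ projective P, fin_dim P & fin_dim U] /\
    [/\ surjective_fun p, injective g & exact_at g p].
Proof.
move=> [n [b bs]].
have [|p pE] := @linear_of_fun _ 'rV[A^c]_n V (fun x => \sum_(i < n) x 0 i *: b i).
  move=> a x y; rewrite scaler_sumr -big_split /=; apply: eq_bigr => i _.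
  by rewrite !mxE scalerDl scalerA.
have ps : surjective_fun p.
  move=> y; have [c ->] := bs y; exists (\row_i ((c i)%:A : A)).
  by rewrite pE; apply: eq_bigr => i _; rewrite mxE.
have [U [g [gi gE]]] := exists_kernel p.
exists 'rV[A^c]_n, U, p, g; split=> //; split.
- exact: projective_free.
- exact: fin_dim_free.
- exact/(fin_dim_inj gi)/fin_dim_free.
Qed.

Record presentation V := Presentation {
  pres_P : rmodType A; pres_U : rmodType A;
  pres_p : {linear pres_P -> V}; pres_g : {linear pres_U -> pres_P};
  pres_proj : projective pres_P; pres_fin : fin_dim pres_U;
  pres_surj : surjective_fun pres_p; pres_inj : injective pres_g;
  pres_exact : exact_at pres_g pres_p }.

Lemma exists_resolution V : fin_dim V -> inhabited (proj_resolution V).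
Proof.
move=> Vf.
(* A presentation is a datum. Wrapping it in an existential proposition lets choice select one for
   each finite-dimensional module, and iterating the selection gives a resolution. *)
have ex_pres (X : {U : rmodType A | fin_dim U}) : exists _ : presentation (sval X), True.
  case: X => U Uf /=.
  have [P [U' [p [g [[Pp _ U'f] [ps gi ex]]]]]] := exists_presentation Uf.
  by exists (Presentation Pp U'f ps gi ex).
pose pres X := sval (cid (ex_pres X)).
pose next X : {U : rmodType A | fin_dim U} := exist _ _ (pres_fin (pres X)).
pose syz n := iter n next (exist _ V Vf).
pose d n : {linear pres_P (pres (syz n.+1)) -> pres_P (pres (syz n))} :=
  pres_g (pres (syz n)) \o pres_p (pres (syz n.+1)).
have exd n x : pres_p (pres (syz n)) x = 0 <-> exists y, d n y = x.
  split=> [/pres_exact[u <-]|[y <-]].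
    by have [y <-] := pres_surj (pres (syz n.+1)) u; exists y.
  by apply/pres_exact; exists (pres_p (pres (syz n.+1)) y).
constructor.
apply: (@ProjResolution _ _ V (fun n => pres_P (pres (syz n))) d (pres_p (pres (syz 0)))).
- by move=> n; apply: pres_proj.
- exact: pres_surj.
- exact: exd.
move=> n x; rewrite -exd; split=> [dx|px]; last by rewrite /d /= px raddf0.
by apply: (@pres_inj _ (pres (syz n))); rewrite raddf0.
Qed.

Definition ext12_zero V W := ext1_zero V W /\ ext2_zero V W.

Lemma ext12_zeroE V W : fin_dim V ->
  (forall i, i \in [:: 1; 2]%N -> ext_zero i V W) <-> ext12_zero V W.
Proof.
move=> /exists_resolution r; split=> [e|[e1 e2] i].
  by split; [apply/(ext_zero1E _ r)|apply/(ext_zero2E _ r)]; apply: e.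
by rewrite !inE => /orP[]/eqP->; [apply/(ext_zero1E _ r)|apply/(ext_zero2E _ r)].
Qed.

Lemma ext1_zero_retract V V' W : fin_dim V' ->
  stable_retract V V' -> ext1_zero V' W -> ext1_zero V W.
Proof.
move=> /exists_presentation[P [U [p [g [[Pp _ _] [ps _ ex]]]]]] VV' e.
by apply: (ext1_zero_stable VV' e); exists P, U, p, g.
Qed.

Lemma ext12_zero_retractl V V' W : fin_dim V' ->
  retract V V' -> ext12_zero V' W -> ext12_zero V W.
Proof.
move=> V'f /retract_stable VV' [e1 e2]; split; first exact: ext1_zero_retract e1.
have [P' [U' [p' [g' [[Pp' Pf' Uf'] [ps' gi' ex']]]]]] := exists_presentation V'f.
move=> P U p g Pp ps gi ex.
apply: (ext1_zero_retract Uf' (syzygy_stable VV' Pp ps gi ex Pp' ps' gi' ex')).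
exact: e2 Pp' ps' gi' ex'.
Qed.

Lemma ext1_zero_retractr V W W' : retract W W' -> ext1_zero V W' -> ext1_zero V W.
Proof.
move=> [c [c' cK]] e P Z p d Pp ps ex f fd.
have [|k kE] := e _ _ p d Pp ps ex (c \o f).
  by move=> z dz; rewrite /= fd // raddf0.
by exists (c' \o k) => z; rewrite /= -kE /= cK.
Qed.

Lemma ext12_zero_retractr V W W' : retract W W' -> ext12_zero V W' -> ext12_zero V W.
Proof.
move=> WW' [e1 e2]; split; first exact: ext1_zero_retractr e1.
by move=> P U p g Pp ps gi ex; apply: ext1_zero_retractr (e2 _ _ _ _ Pp ps gi ex).
Qed.

Lemma ext1_zero_prodr V W W' :
  ext1_zero V W -> ext1_zero V W' -> ext1_zero V (W * W')%type.
Proof.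
move=> e e' P Z p d Pp ps ex f fd.
have [|k kE] := e _ _ p d Pp ps ex (fst \o f); first by move=> z /fd /= ->.
have [|k' kE'] := e' _ _ p d Pp ps ex (snd \o f); first by move=> z /fd /= ->.
have [h hE] := linear_pair k k'; exists h => z.
by rewrite hE -kE -kE' -surjective_pairing.
Qed.

Lemma ext12_zero_prodr V W W' :
  ext12_zero V W -> ext12_zero V W' -> ext12_zero V (W * W')%type.
Proof.
move=> [e1 e2] [e1' e2']; split; first exact: ext1_zero_prodr.
move=> P U p g Pp ps gi ex.
by apply: ext1_zero_prodr; [apply: e2 ex|apply: e2' ex].
Qed.

Lemma linear_prodE V V' W (f : {linear (V * V')%type -> W}) :
  exists (f1 : {linear V -> W}) (f2 : {linear V' -> W}),
    forall x, f x = f1 x.1 + f2 x.2.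
Proof.
have [i iE] : exists i : {linear V -> (V * V')%type}, forall x, i x = (x, 0).
  by apply: linear_of_fun => a x y; congr (_, _) => //=; rewrite scaler0 addr0.
have [j jE] : exists j : {linear V' -> (V * V')%type}, forall x, j x = (0, x).
  by apply: linear_of_fun => a x y; congr (_, _) => //=; rewrite scaler0 addr0.
exists (f \o i), (f \o j) => -[x y] /=; rewrite iE jE -raddfD /=.
by congr (f (_, _)); rewrite /= ?addr0 ?add0r.
Qed.

Lemma exact_prod V V' P P' U U' (p : {linear P -> V}) (g : {linear U -> P})
    (p' : {linear P' -> V'}) (g' : {linear U' -> P'}) :
  projective P -> surjective_fun p -> injective g -> exact_at g p ->
  projective P' -> surjective_fun p' -> injective g' -> exact_at g' p' ->
  exists (q : {linear (P * P')%type -> (V * V')%type})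
         (h : {linear (U * U')%type -> (P * P')%type}),
    [/\ projective (P * P')%type, surjective_fun q, injective h & exact_at h q] /\
    forall x, h x = (g x.1, g' x.2).
Proof.
move=> Pp ps gi ex Pp' ps' gi' ex'.
have [q qE] := linear_pair (p \o fst : {linear (P * P')%type -> V}) (p' \o snd).
have [h hE] := linear_pair (g \o fst : {linear (U * U')%type -> P}) (g' \o snd).
exists q, h; split=> //; split.
- exact: projective_prod.
- move=> [y y']; have [x <-] := ps y; have [x' <-] := ps' y'.
  by exists (x, x'); rewrite qE.
- by move=> [x x'] [y y']; rewrite !hE /= => -[/gi -> /gi' ->].
move=> [x x']; split=> [|[[y y'] <-]]; rewrite ?qE ?hE /=.
  move=> [/ex[y <-] /ex'[y' <-]]; by exists (y, y'); rewrite hE.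
congr (_, _); first by apply/ex; exists y.
by apply/ex'; exists y'.
Qed.

Lemma ext1_zero_prodl V V' W : fin_dim V -> fin_dim V' ->
  ext1_zero V W -> ext1_zero V' W -> ext1_zero (V * V')%type W.
Proof.
move=> /exists_presentation[P [U [p [g [[Pp Pf Uf] [ps gi ex]]]]]].
move=> /exists_presentation[P' [U' [p' [g' [[Pp' Pf' Uf'] [ps' gi' ex']]]]]] e e'.
have [q [h [[Qp qs hi exh] hE]]] := exact_prod Pp ps gi ex Pp' ps' gi' ex'.
apply: (ext1_zero_pres (stable_retract_refl _) Qp qs exh) => f _.
have [f1 [f2 fE]] := linear_prodE f.
have [|k kE] := e _ _ p g Pp ps ex f1.
  by move=> z gz; have := gi z 0; rewrite gz raddf0 => ->; rewrite ?raddf0.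
have [|k' kE'] := e' _ _ p' g' Pp' ps' ex' f2.
  by move=> z gz; have := gi' z 0; rewrite gz raddf0 => ->; rewrite ?raddf0.
have [l lE] := linear_copair k k'; exists l => z.
by rewrite lE hE /= fE kE kE'.
Qed.

Lemma ext12_zero_prodl V V' W : fin_dim V -> fin_dim V' ->
  ext12_zero V W -> ext12_zero V' W -> ext12_zero (V * V')%type W.
Proof.
move=> Vf V'f [e1 e2] [e1' e2']; split; first exact: ext1_zero_prodl.
have [P [U [p [g [[Pp Pf Uf] [ps gi ex]]]]]] := exists_presentation Vf.
have [P' [U' [p' [g' [[Pp' Pf' Uf'] [ps' gi' ex']]]]]] := exists_presentation V'f.
have [q [h [[Qp qs hi exh] hE]]] := exact_prod Pp ps gi ex Pp' ps' gi' ex'.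
move=> P1 U1 p1 g1 Pp1 ps1 gi1 ex1.
apply: (ext1_zero_retract (fin_dim_prod Uf Uf')).
  exact: (syzygy_stable (stable_retract_refl _) Pp1 ps1 gi1 ex1 Qp qs hi exh).
by apply: ext1_zero_prodl => //; [apply: e2 ex|apply: e2' ex'].
Qed.

Lemma ext1_zero_projective V W : projective V -> ext1_zero V W.
Proof.
move=> Vp P Z p d Pp ps ex f fd.
have [s sE] := Vp _ _ p idfun ps.
have [|k kE] := linear_factor (j := (idfun : {linear P -> P}) \- (s \o p)) fd.
  by move=> x; apply/ex; rewrite raddfB /= sE subrr.
exists k => z; rewrite (kE (d z) z) //=.
have -> : p (d z) = 0 by apply/ex; exists z.
by rewrite raddf0 subr0.
Qed.

Lemma ext12_zero_projective V W : projective V -> ext12_zero V W.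
Proof.
move=> Vp; split; first exact: ext1_zero_projective.
move=> P U p g Pp ps gi ex; apply: ext1_zero_projective.
have [s sE] := Vp _ _ p idfun ps.
apply: (retract_projective _ Pp).
have [|r rE] := linear_factor_inj (f := (idfun : {linear P -> P}) \- (s \o p)) gi.
  by move=> x; apply/ex; rewrite raddfB /= sE subrr.
exists g, r => x; apply: gi; rewrite rE /=.
have -> : p (g x) = 0 by apply/ex; exists x.
by rewrite raddf0 subr0.
Qed.

(** Extension is asked only into finite-dimensional [P], where linear forms extend by matrix
    algebra; this covers the presentations of finite-dimensional modules. *)
Definition injective_module I := forall U P (g : {linear U -> P}) (h : {linear U -> I}),
  fin_dim P -> injective g -> exists k : {linear P -> I}, forall x, h x = k (g x).

Lemma ext12_zero_injective V I : fin_dim V -> injective_module I -> ext12_zero V I.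
Proof.
move=> Vf Ii.
have e1 U : fin_dim U -> ext1_zero U I.
  move=> /exists_presentation[P [Z [p [g [[Pp Pf _] [ps gi ex]]]]]].
  by apply: (ext1_zero_pres (stable_retract_refl _) Pp ps ex) => f _; apply: Ii.
split=> [|P U p g Pp ps gi ex]; first exact: e1.
have [P' [U' [p' [g' [[Pp' Pf' Uf'] [ps' gi' ex']]]]]] := exists_presentation Vf.
apply: (ext1_zero_retract Uf' _ (e1 _ Uf')).
exact: (syzygy_stable (stable_retract_refl _) Pp ps gi ex Pp' ps' gi' ex').
Qed.

(** This is exactness of the sequence from Hom(N, I) to Hom(N, im r) to Ext^1(N, W), by hand: a lift
    of [h] over [P] restricts on the syzygy to a map into [W]; subtracting an extension of that map
    to [P] makes the lift descend to [N]. *)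
Lemma ext1_zero_lift N W I J (i : {linear W -> I}) (r : {linear I -> J})
    (h : {linear N -> J}) : fin_dim N -> ext1_zero N W ->
  injective i -> exact_at i r -> (forall n, exists x, r x = h n) ->
  exists k : {linear N -> I}, forall n, r (k n) = h n.
Proof.
move=> /exists_presentation[P [U [p [g [[Pp Pf _] [ps gi ex]]]]]] e ii exi hr.
have [|h1 h1E] := projective_lift (g := r) (f := h \o p) Pp.
  by move=> x; apply: hr.
have pg u : p (g u) = 0 by apply/ex; exists u.
have [|f fE] := linear_factor_inj (f := h1 \o g) ii.
  by move=> u; apply/exi; rewrite /= h1E /= pg raddf0.
have [|k0 k0E] := e _ _ p g Pp ps ex f.
  by move=> z gz; apply: ii; rewrite fE /= gz !raddf0.
have [|k kE] := linear_factor_surj (f := h1 \- (i \o k0)) ps.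
  by move=> x /ex[u <-] /=; rewrite -k0E fE /= subrr.
exists k => n; have [x <-] := ps n.
rewrite kE /= raddfB /= h1E /=.
have -> : r (i (k0 x)) = 0 by apply/exi; exists (k0 x).
by rewrite subr0.
Qed.

(** Dimension shift in the first variable: [ext1_zero_lift] is applied to the syzygy [U] of [N], and
    injectivity of [I0] carries the result from [U] to [P]. *)
Lemma ext2_zero_lift N W I0 I1 I2 (i : {linear W -> I0}) (r0 : {linear I0 -> I1})
    (r1 : {linear I1 -> I2}) (h : {linear N -> I2}) :
  fin_dim N -> ext2_zero N W -> injective_module I0 ->
  injective i -> exact_at i r0 -> exact_at r0 r1 ->
  (forall n, exists x, r1 x = h n) ->
  exists k : {linear N -> I1}, forall n, r1 (k n) = h n.
Proof.
move=> /exists_presentation[P [U [p [g [[Pp Pf Uf] [ps gi ex]]]]]] e I0i ii ex0 ex1 hr.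
have [|h1 h1E] := projective_lift (g := r1) (f := h \o p) Pp.
  by move=> x; apply: hr.
have pg u : p (g u) = 0 by apply/ex; exists u.
have [|k0 k0E] := ext1_zero_lift (h := h1 \o g) Uf (e _ _ _ _ Pp ps gi ex) ii ex0.
  by move=> u; apply/ex1; rewrite /= h1E /= pg raddf0.
have [k1 k1E] := I0i _ _ g k0 Pf gi.
have [|k kE] := linear_factor_surj (f := h1 \- (r0 \o k1)) ps.
  by move=> x /ex[u <-] /=; rewrite -k1E k0E /= subrr.
exists k => n; have [x <-] := ps n.
rewrite kE /= raddfB /= h1E /=.
have -> : r1 (r0 (k1 x)) = 0 by apply/ex1; exists (k1 x).
by rewrite subr0.
Qed.

Lemma ext1_zero_extend V W P Z (p : {linear P -> V}) (d : {linear Z -> P})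
    (f : {linear Z -> W}) : ext1_zero V W ->
  projective P -> surjective_fun p -> exact_at d p ->
  (forall z, d z = 0 -> f z = 0) -> exists k : {linear P -> W}, forall z, f z = k (d z).
Proof. by move=> e Pp ps ex; apply: e ex f. Qed.

Lemma syzygy_corestrict V P0 P1 (p : {linear P0 -> V}) (d : {linear P1 -> P0}) :
  exact_at d p -> exists U (g : {linear U -> P0}) (q : {linear P1 -> U}),
    [/\ injective g, exact_at g p, surjective_fun q & forall x, g (q x) = d x].
Proof.
move=> ex; have [U [g [gi gE]]] := exists_kernel p.
have [|q qE] := linear_factor_inj (f := d) gi.
  by move=> x; apply/gE/ex; exists x.
exists U, g, q; split=> // u.
have /ex[x xE] : p (g u) = 0 by apply/gE; exists u.
by exists x; apply: gi; rewrite qE.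
Qed.

Lemma exact_corestrict U P0 P1 P2 (g : {linear U -> P0}) (q : {linear P1 -> U})
    (d : {linear P1 -> P0}) (d' : {linear P2 -> P1}) :
  injective g -> (forall x, g (q x) = d x) -> exact_at d' d -> exact_at d' q.
Proof.
move=> gi qE ex x; split=> [qx|/ex dx]; first by apply/ex; rewrite -qE qx raddf0.
by apply: gi; rewrite qE dx raddf0.
Qed.

Lemma ext2_zero_extend V W P0 P1 Z (p : {linear P0 -> V}) (d0 : {linear P1 -> P0})
    (d1 : {linear Z -> P1}) (f : {linear Z -> W}) : ext2_zero V W ->
  projective P0 -> surjective_fun p -> exact_at d0 p ->
  projective P1 -> exact_at d1 d0 ->
  (forall z, d1 z = 0 -> f z = 0) -> exists k : {linear P1 -> W}, forall z, f z = k (d1 z).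
Proof.
move=> e Pp ps ex0 Pp1 ex1 fd.
have [U [g [q [gi exg qs qE]]]] := syzygy_corestrict ex0.
exact: (ext1_zero_extend (e _ _ _ _ Pp ps gi exg) Pp1 qs (exact_corestrict gi qE ex1)).
Qed.

Lemma ext2_zero_pres V W P0 P1 Z (p : {linear P0 -> V}) (d0 : {linear P1 -> P0})
    (d1 : {linear Z -> P1}) :
  projective P0 -> surjective_fun p -> exact_at d0 p ->
  projective P1 -> exact_at d1 d0 -> extends_along d1 W -> ext2_zero V W.
Proof.
move=> Pp ps ex0 Pp1 ex1 ed P U p' g' Pp' ps' gi' ex'.
have [U1 [g [q [gi exg qs qE]]]] := syzygy_corestrict ex0.
apply: (ext1_zero_pres (syzygy_stable (stable_retract_refl V) Pp' ps' gi' ex'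
  Pp ps gi exg) Pp1 qs (exact_corestrict gi qE ex1) ed).
Qed.

(** Retracts compose without naming a complement; [in_addE] recovers the complement as a kernel. *)
Definition add_closure M N := exists n, retract N (dsum (nseq n M)).

Lemma retract_complement N W (c : {linear N -> W}) (c' : {linear W -> N}) :
  (forall x, c' (c x) = x) ->
  exists N' (g : {linear N' -> W}) (g' : {linear W -> N'}),
    [/\ forall x, c' (g x) = 0, forall x, g' (g x) = x, forall x, g' (c x) = 0
      & forall y, c (c' y) + g (g' y) = y].
Proof.
move=> cK; have [N' [g [gi ex]]] := exists_kernel c'.
have [|g' g'E] := linear_factor_inj (f := (idfun : {linear W -> W}) \- (c \o c')) gi.
  by move=> y; apply/ex; rewrite raddfB /= cK subrr.
have cg x : c' (g x) = 0 by apply/ex; exists x.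
exists N', g, g'; split=> // [x|x|y].
- by apply: gi; rewrite g'E /= cg raddf0 subr0.
- by apply: gi; rewrite g'E /= cK subrr raddf0.
by rewrite g'E /= addrC subrK.
Qed.

Lemma in_addE M N : in_add M N <-> add_closure M N.
Proof.
split=> [[n [N' /retract_iso[h _]]]|[n [c [c' cK]]]].
  by exists n; apply: retract_trans h; apply: retract_fst.
have [N' [g [g' [cg gK gc cgE]]]] := retract_complement cK.
exists n, N'; have [f fE] := linear_copair c g.
exists f; exists (fun y => (c' y, g' y)) => [[x y]|y].
  by rewrite fE /= !raddfD /= cK cg gc gK addr0 add0r.
by rewrite fE /= cgE.
Qed.

Lemma add_closure_retract M N N' : retract N N' -> add_closure M N' -> add_closure M N.
Proof. by move=> r [n h]; exists n; apply: retract_trans h. Qed.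

Lemma retract_dsum_cat (s t : seq (rmodType A)) :
  retract (dsum s * dsum t)%type (dsum (s ++ t)).
Proof.
elim: s => [|V s IH] /=.
  have [|f fE] := @linear_of_fun _ (dsum t) ('rV[A^c]_0 * dsum t)%type (fun x => (0, x)).
    by move=> a x y; congr (_, _) => //=; rewrite scaler0 addr0.
  exists snd, f => -[x y]; rewrite fE /=; congr (_, _).
  by apply/rowP => -[].
apply: retract_trans (retract_prod (retract_refl V) IH).
have [|f fE] := @linear_of_fun _ (V * dsum s * dsum t)%type (V * (dsum s * dsum t))%type
  (fun x => (x.1.1, (x.1.2, x.2))); first by [].
have [|g gE] := @linear_of_fun _ (V * (dsum s * dsum t))%type (V * dsum s * dsum t)%type
  (fun x => ((x.1, x.2.1), x.2.2)); first by [].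
by exists f, g => -[[x y] z]; rewrite gE fE.
Qed.

Lemma add_closure_prod M N N' :
  add_closure M N -> add_closure M N' -> add_closure M (N * N')%type.
Proof.
move=> [n h] [m h']; exists (n + m)%N; rewrite nseqD.
exact: retract_trans (retract_prod h h') (retract_dsum_cat _ _).
Qed.

Lemma add_closure_self M N : retract N M -> add_closure M N.
Proof. by move=> h; exists 1%N => /=; apply: retract_trans h (retract_fst _ _). Qed.

End FiniteDimensionalAlgebra.

(** * Uniqueness of projective covers and of syzygies *)

Section Syzygies.
Variables (K : fieldType) (A : algType K).
Implicit Types U V W P : rmodType A.

Lemma submod_closed_range U V (f : {linear U -> V}) :
  GRing.submod_closed (fun y => `[< exists x, f x = y >] : bool).
Proof.
split; first by apply/asboolP; exists 0; rewrite raddf0.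
move=> a u v /asboolP[x <-] /asboolP[z <-].
by apply/asboolP; exists (a *: x + z); rewrite linearP.
Qed.

Lemma superfluous_range U P (X : P -> Prop) (f : {linear U -> P}) :
  superfluous X -> (forall p, exists x u, X x /\ p = x + f u) -> surjective_fun f.
Proof.
move=> Xs h p; apply/asboolP; apply: (Xs _ (submod_closed_range f)) => {}p.
have [x [u [Xx ->]]] := h p; exists x, (f u); split=> //.
by apply/asboolP; exists u.
Qed.

Lemma projective_cover_iso V P P' (f : {linear P -> V}) (f' : {linear P' -> V}) :
  projective_cover f -> projective_cover f' ->
  exists (h : {linear P -> P'}) (h' : {linear P' -> P}),
    [/\ forall x, f' (h x) = f x, cancel h h' & cancel h' h].
Proof.
move=> [Pp fs fsup] [Pp' fs' fsup'].
have [h hE] := Pp _ _ f' f fs'.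
have hs : surjective_fun h.
  apply: (superfluous_range fsup') => y; have [x xE] := fs (f' y).
  exists (y - h x), x; split; last by rewrite subrK.
  by rewrite raddfB /= hE xE subrr.
have [s sE] := Pp' _ _ h idfun hs.
have ss : surjective_fun s.
  apply: (superfluous_range fsup) => y.
  exists (y - s (h y)), (h y); split; last by rewrite subrK.
  by rewrite -hE raddfB /= sE subrr raddf0.
exists h, s; split=> // x; have [y <-] := ss x.
by rewrite sE.
Qed.

Lemma is_syzygy_unique V W W' : is_syzygy V W -> is_syzygy V W' -> rmod_iso W W'.
Proof.
move=> [P [f [g [fc gi ex]]]] [P' [f' [g' [fc' gi' ex']]]].
have [h [h' [hE hK h'K]]] := projective_cover_iso fc fc'.
have [|k kE] := linear_factor_inj (f := h \o g) gi'.
  by move=> x; apply/ex'; rewrite /= hE; apply/ex; exists x.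
have [|k' k'E] := linear_factor_inj (f := h' \o g') gi.
  by move=> x; apply/ex; rewrite /= -hE h'K; apply/ex'; exists x.
exists k, k' => x.
  by apply: gi; rewrite k'E /= kE /= hK.
by apply: gi'; rewrite kE /= k'E /= h'K.
Qed.

Lemma is_syzygy_iso V V' W : rmod_iso V V' -> is_syzygy V W -> is_syzygy V' W.
Proof.
move=> [h [h' hK h'K]] [P [f [g [[Pp fs fsup] gi ex]]]].
have zero x : (h \o f) x = 0 <-> f x = 0.
  by split=> /= [hx|->]; [apply: (can_inj hK); rewrite hx|]; rewrite raddf0.
exists P, (h \o f), g; split=> //; last by move=> x; rewrite zero.
split=> // [y|Y Yc e].
  by have [x xE] := fs (h' y); exists x; rewrite /= xE h'K.
by apply: fsup Yc _ => p; have [x [y [/zero fx ? ?]]] := e p; exists x, y.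
Qed.

End Syzygies.

(** * Hub algebras *)

Lemma scaled_sum5 (K : fieldType) (V : lmodType K) (a : K) (x1 x2 x3 x4 x5 y1 y2 y3 y4 y5 : V) :
  a *: (x1 + x2 + x3 + x4 + x5) + (y1 + y2 + y3 + y4 + y5) =
  (a *: x1 + y1) + (a *: x2 + y2) + (a *: x3 + y3) + (a *: x4 + y4) + (a *: x5 + y5).
Proof.
rewrite !scalerDr (addrACA _ (a *: x5)) (addrACA _ (a *: x4)).
by rewrite (addrACA _ (a *: x3)) (addrACA _ (a *: x2)).
Qed.

Lemma scaled_pair (K : fieldType) (V : lmodType K) (a b c b' c' : K) (x y : V) :
  a *: (b *: x + c *: y) + (b' *: x + c' *: y) = (a * b + b') *: x + (a * c + c') *: y.
Proof. by rewrite scalerDr !scalerA addrACA -!scalerDl. Qed.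

Section HubAlgebra.
Variables (K : fieldType) (A : algType K) (I : finType) (nx : I -> I) (mu : K).

(** The spoke [(c, i)] lies on the way from the hub [i] to the hub [nx i]. One hub with [nx] the
    identity gives the triangle algebra, two hubs exchanged by [nx] the spherical algebra. *)
Definition hvertex : Type := (I + bool * I)%type.
HB.instance Definition _ := Finite.on hvertex.
Definition hub (i : I) : hvertex := inl i.
Definition spoke (c : bool) (i : I) : hvertex := inr (c, i).

(* [hgram c d] is the scalar of [Z_c Z_d] relative to the socle [z] at a hub,
   where [Z_c = p_c q_c] is the path of length 2 through the spoke [c]. *)
Definition hgram (c d : bool) : K := if c || d then 1 else mu.

Variables (e : hvertex -> A) (p q : bool -> I -> A) (t : A -> K).

Definition hZ c i := p c i * q c i.
Definition hu c i := hZ true i * p c (nx i).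
Definition hv c i := q c i * hZ true (nx i).
Definition hz i := hZ true i * hZ true (nx i).
Definition hzs c i := hv c i * p c i.

(** Relations, generation and values of the trace are asked, but neither a basis nor a dimension.
    The trace is prescribed on all normal-form words except [hzs], where its value follows from
    [h_tC]. *)
Record hub_algebra : Prop := HubAlgebra {
  nxK : involutive nx;
  mu_neq0 : mu != 0;
  mu_neq1 : mu != 1;
  h_idem : forall v w, e v * e w = (if v == w then e v else 0);
  h_one : \sum_v e v = 1;
  h_srcp : forall c i, e (hub i) * p c i = p c i;
  h_tgtp : forall c i, p c i * e (spoke c i) = p c i;
  h_srcq : forall c i, e (spoke c i) * q c i = q c i;
  h_tgtq : forall c i, q c i * e (hub (nx i)) = q c i;
  h_gen : forall P : A -> Prop, P 1 ->
    (forall x y, P x -> P y -> P (x + y)) -> (forall c x, P x -> P (c *: x)) ->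
    (forall v x, P x -> P (e v * x)) -> (forall c i x, P x -> P (p c i * x)) ->
    (forall c i x, P x -> P (q c i * x)) -> forall x, P x;
  h_qZ : forall c d i, q c i * hZ d (nx i) = hgram c d *: hv c i;
  h_Zp : forall c d i, hZ d i * p c (nx i) = hgram d c *: hu c i;
  h_vp : forall c i, hv c i * p (~~ c) i = 0;
  h_zp : forall c i, hz i * p c i = 0;
  h_zsq : forall c i, hzs c i * q c i = 0;
  h_tP : forall c x y, t (c *: x + y) = c * t x + t y;
  h_tC : forall x y, t (x * y) = t (y * x);
  h_te : forall v, t (e v) = 0;
  h_tp : forall c i, t (p c i) = 0;
  h_tq : forall c i, t (q c i) = 0;
  h_tZ : forall c i, t (hZ c i) = 0;
  h_tqp : forall c d i, t (q c i * p d (nx i)) = 0;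
  h_tu : forall c i, t (hu c i) = 0;
  h_tv : forall c i, t (hv c i) = 0;
  h_tz : forall i, t (hz i) = 1 }.

Hypothesis H : hub_algebra.

Lemma epC v c i : e v * p c i = if v == hub i then p c i else 0.
Proof.
rewrite -{1}(h_srcp H) mulrA (h_idem H).
by case: eqP => [->|_]; rewrite ?(h_srcp H) ?mul0r.
Qed.

Lemma eqC v c i : e v * q c i = if v == spoke c i then q c i else 0.
Proof.
rewrite -{1}(h_srcq H) mulrA (h_idem H).
by case: eqP => [->|_]; rewrite ?(h_srcq H) ?mul0r.
Qed.

Lemma pe v c i : p c i * e v = if v == spoke c i then p c i else 0.
Proof.
rewrite -{1}(h_tgtp H) -mulrA (h_idem H) eq_sym.
by case: eqP => _; rewrite ?(h_tgtp H) ?mulr0.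
Qed.

Lemma qe v c i : q c i * e v = if v == hub (nx i) then q c i else 0.
Proof.
rewrite -{1}(h_tgtq H) -mulrA (h_idem H) eq_sym.
by case: eqP => _; rewrite ?(h_tgtq H) ?mulr0.
Qed.

Lemma pp c i d j : p c i * p d j = 0.
Proof. by rewrite -(h_srcp H d) mulrA pe mul0r. Qed.

Lemma qq c i d j : q c i * q d j = 0.
Proof. by rewrite -(h_srcq H d) mulrA qe mul0r. Qed.

Lemma hgramC c d : hgram c d = hgram d c.
Proof. by rewrite /hgram orbC. Qed.

Lemma hgram_neq0 c d : hgram c d != 0.
Proof. by rewrite /hgram; case: ifP; rewrite ?oner_neq0 ?(mu_neq0 H). Qed.

Lemma hgramT c : hgram c true = 1. Proof. by rewrite /hgram orbT. Qed.

Lemma h_uq c i : hu c i * q c (nx i) = hz i.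
Proof.
have h : hZ true i * hZ c (nx i) = hz i.
  by case: c => //; rewrite {1}/hZ -mulrA (h_qZ H) scale1r /hv mulrA.
by rewrite /hu -mulrA.
Qed.

Lemma h_pv c i : p c i * hv c i = hz i.
Proof.
by rewrite /hv mulrA -/(hZ c i) mulrA (h_Zp H) hgramT scale1r /hz mulrA.
Qed.

Lemma h_qu c d i : q c i * hu d (nx i) = if c == d then hzs c i else 0.
Proof.
rewrite /hu mulrA (h_qZ H) hgramT scale1r (nxK H) /hzs.
case: eqP => [->//|ne]; have -> : d = ~~ c by case: c d ne => -[].
exact: (h_vp H).
Qed.

Lemma h_qz c i : q c i * hz (nx i) = 0.
Proof.
rewrite /hz mulrA (h_qZ H) hgramT scale1r (nxK H).
have [E|ne] := eqVneq c true.
  by rewrite E /hZ mulrA -/(hzs true i) (h_zsq H).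
have -> : c = false by case: c ne.
by rewrite /hZ mulrA (h_vp H false i) mul0r.
Qed.

Lemma h_pzs c i : p c i * hzs c i = 0.
Proof. by rewrite /hzs mulrA h_pv (h_zp H). Qed.

Lemma hZ_Z c d i : hZ c i * hZ d (nx i) = hgram c d *: hz i.
Proof. by rewrite [hZ d _]/hZ mulrA (h_Zp H) -scalerAl h_uq. Qed.

(** [hubc] and [spokec] are the normal forms in the right ideals at a hub (8 coordinates) and at a
    spoke (6 coordinates), ordered by path length from 0 to 4. They turn later identities in the
    algebra into identities between scalars. *)
Definition hubc i (c0 : K) (c k l : bool -> K) (c4 : K) : A :=
  c0 *: e (hub i) + (c true *: p true i + c false *: p false i)
  + (k true *: hZ true i + k false *: hZ false i)
  + (l true *: hu true i + l false *: hu false i) + c4 *: hz i.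

Definition spokec c i (s0 s1 : K) (s2 : bool -> K) (s3 s4 : K) : A :=
  s0 *: e (spoke c i) + s1 *: q c i
  + (s2 true *: (q c i * p true (nx i)) + s2 false *: (q c i * p false (nx i)))
  + s3 *: hv c i + s4 *: hzs c i.

Definition kron (c : bool) (x : K) (d : bool) : K := if c == d then x else 0.

(** With [p_spokec], this describes left multiplication by the arrows on normal forms; the other
    products of normal forms are computed from these two. *)
Lemma q_hubc c i c0 cc k l c4 :
  q c i * hubc (nx i) c0 cc k l c4 =
  spokec c i 0 c0 cc (hgram c true * k true + hgram c false * k false) (l c).
Proof.
rewrite /hubc /spokec !mulrDr -!scalerAr (h_tgtq H) !(h_qZ H) !h_qu h_qz scaler0 addr0.
rewrite scale0r add0r !scalerA -scalerDl [k true * _]mulrC [k false * _]mulrC.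
by case: c => /=; rewrite !scaler0 ?addr0 ?add0r.
Qed.

Lemma p_spokec c i s0 s1 s2 s3 s4 :
  p c i * spokec c i s0 s1 s2 s3 s4 =
  hubc i 0 (kron c s0) (kron c s1) (fun d => hgram c d * s2 d) s3.
Proof.
rewrite /hubc /spokec !mulrDr -!scalerAr (h_tgtp H) h_pv h_pzs scaler0 addr0.
rewrite !(mulrA (p c i) (q c i)) -/(hZ c i) !(h_Zp H) !scalerA.
rewrite scale0r add0r [s2 true * _]mulrC [s2 false * _]mulrC.
by case: c => /=; rewrite /kron /= !scale0r ?addr0 ?add0r.
Qed.

Lemma ev_hubc v i c0 c k l c4 : e v * hubc i c0 c k l c4 =
  if v == hub i then hubc i c0 c k l c4 else 0.
Proof.
rewrite /hubc /hz /hu /hZ !mulrDr -!scalerAr !mulrA !epC (h_idem H).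
by case: eqP => [->|_] //; rewrite !(mul0r, scaler0, addr0).
Qed.

Lemma ev_spokec v c i s0 s1 s2 s3 s4 : e v * spokec c i s0 s1 s2 s3 s4 =
  if v == spoke c i then spokec c i s0 s1 s2 s3 s4 else 0.
Proof.
rewrite /spokec /hzs /hv /hZ !mulrDr -!scalerAr !mulrA !eqC (h_idem H).
by case: eqP => [->|_] //; rewrite !(mul0r, scaler0, addr0).
Qed.

Lemma hubcP i a c0 c k l c4 c0' c' k' l' c4' :
  a *: hubc i c0 c k l c4 + hubc i c0' c' k' l' c4' =
  hubc i (a * c0 + c0') (fun d => a * c d + c' d) (fun d => a * k d + k' d)
    (fun d => a * l d + l' d) (a * c4 + c4').
Proof.
rewrite /hubc scaled_sum5 !scaled_pair [a *: (c0 *: _)]scalerA [a *: (c4 *: _)]scalerA.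
by rewrite -!scalerDl.
Qed.

Lemma hubcPP i a b c0 c k l c4 c0' c' k' l' c4' :
  a *: hubc i c0 c k l c4 + b *: hubc i c0' c' k' l' c4' =
  hubc i (a * c0 + b * c0') (fun d => a * c d + b * c' d)
    (fun d => a * k d + b * k' d) (fun d => a * l d + b * l' d) (a * c4 + b * c4').
Proof.
have -> : b *: hubc i c0' c' k' l' c4' = hubc i (b * c0') (fun d => b * c' d)
    (fun d => b * k' d) (fun d => b * l' d) (b * c4').
  by rewrite /hubc !scalerDr !scalerA.
exact: hubcP.
Qed.

Lemma spokecP c i a s0 s1 s2 s3 s4 s0' s1' s2' s3' s4' :
  a *: spokec c i s0 s1 s2 s3 s4 + spokec c i s0' s1' s2' s3' s4' =
  spokec c i (a * s0 + s0') (a * s1 + s1') (fun d => a * s2 d + s2' d)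
    (a * s3 + s3') (a * s4 + s4').
Proof.
rewrite /spokec scaled_sum5 scaled_pair [a *: (s0 *: _)]scalerA.
rewrite [a *: (s1 *: _)]scalerA [a *: (s3 *: _)]scalerA [a *: (s4 *: _)]scalerA.
by rewrite -!scalerDl.
Qed.

Lemma hubc0 i : hubc i 0 (fun=> 0) (fun=> 0) (fun=> 0) 0 = 0.
Proof. by rewrite /hubc !scale0r !addr0. Qed.

Lemma spokec0 c i : spokec c i 0 0 (fun=> 0) 0 0 = 0.
Proof. by rewrite /spokec !scale0r !addr0. Qed.

Lemma hub_e i : e (hub i) = hubc i 1 (fun=> 0) (fun=> 0) (fun=> 0) 0.
Proof. by rewrite /hubc !scale0r scale1r !addr0. Qed.

Lemma spoke_e c i : e (spoke c i) = spokec c i 1 0 (fun=> 0) 0 0.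
Proof. by rewrite /spokec !scale0r scale1r !addr0. Qed.

Lemma coordinates v x :
  match v with
  | inl i => exists c0 c k l c4, e v * x = hubc i c0 c k l c4
  | inr (c, i) => exists s0 s1 s2 s3 s4, e v * x = spokec c i s0 s1 s2 s3 s4
  end.
Proof.
move: x v; apply: (h_gen H).
- case=> [i|[c i]]; rewrite mulr1.
    by exists 1, (fun=> 0), (fun=> 0), (fun=> 0), 0; rewrite -hub_e.
  by exists 1, 0, (fun=> 0), 0, 0; rewrite -spoke_e.
- move=> x y IHx IHy [i|[c i]]; rewrite mulrDr.
    have [? [? [? [? [? ->]]]]] := IHx (inl i); have [? [? [? [? [? ->]]]]] := IHy (inl i).
    by rewrite -[X in X + _]scale1r hubcP; do 5!eexists.
  have [? [? [? [? [? ->]]]]] := IHx (inr (c, i)); have [? [? [? [? [? ->]]]]] := IHy (inr (c, i)).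
  by rewrite -[X in X + _]scale1r spokecP; do 5!eexists.
- move=> a x IHx [i|[c i]]; rewrite -scalerAr.
    have [? [? [? [? [? ->]]]]] := IHx (inl i).
    by rewrite -[_ *: _]addr0 -(hubc0 i) hubcP; do 5!eexists.
  have [? [? [? [? [? ->]]]]] := IHx (inr (c, i)).
  by rewrite -[_ *: _]addr0 -(spokec0 c i) spokecP; do 5!eexists.
- move=> w x IHx v; rewrite mulrA (h_idem H).
  case: eqP => [_|ne]; first exact: IHx.
  rewrite mul0r; case: v ne => [i|[c i]] _.
    by exists 0, (fun=> 0), (fun=> 0), (fun=> 0), 0; rewrite hubc0.
  by exists 0, 0, (fun=> 0), 0, 0; rewrite spokec0.
- move=> c i x IHx v; rewrite mulrA epC; case: eqP => [->|ne].
    have [? [? [? [? [? E]]]]] := IHx (spoke c i).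
    by rewrite -(h_tgtp H) -mulrA E p_spokec; do 5!eexists.
  rewrite mul0r; case: v ne => [j|[d j]] _.
    by exists 0, (fun=> 0), (fun=> 0), (fun=> 0), 0; rewrite hubc0.
  by exists 0, 0, (fun=> 0), 0, 0; rewrite spokec0.
- move=> c i x IHx v; rewrite mulrA eqC; case: eqP => [->|ne].
    have [? [? [? [? [? E]]]]] := IHx (hub (nx i)).
    by rewrite -(h_tgtq H) -mulrA E q_hubc; do 5!eexists.
  rewrite mul0r; case: v ne => [j|[d j]] _.
    by exists 0, (fun=> 0), (fun=> 0), (fun=> 0), 0; rewrite hubc0.
  by exists 0, 0, (fun=> 0), 0, 0; rewrite spokec0.
Qed.

Lemma hub_coordinates i x : e (hub i) * x = x ->
  exists c0 c k l c4, x = hubc i c0 c k l c4.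
Proof. by move=> <-; exact: (coordinates (hub i)). Qed.

Lemma spoke_coordinates c i x : e (spoke c i) * x = x ->
  exists s0 s1 s2 s3 s4, x = spokec c i s0 s1 s2 s3 s4.
Proof. by move=> <-; exact: (coordinates (spoke c i)). Qed.

Lemma tD x y : t (x + y) = t x + t y.
Proof. by have := h_tP H 1 x y; rewrite scale1r mul1r. Qed.

Lemma t0 : t 0 = 0.
Proof.
have := tD 0 0; rewrite addr0 => /eqP; rewrite -subr_eq0 opprD addNKr oppr_eq0.
by move/eqP.
Qed.

Lemma tZ a x : t (a *: x) = a * t x.
Proof. by have := h_tP H a x 0; rewrite t0 !addr0. Qed.

Lemma t_hubc i c0 c k l c4 : t (hubc i c0 c k l c4) = c4.
Proof.
rewrite /hubc !tD !tZ (h_te H) !(h_tp H) !(h_tZ H) !(h_tu H) (h_tz H).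
by rewrite !mulr0 !add0r mulr1.
Qed.

Lemma t_spokec c i s0 s1 s2 s3 s4 : t (spokec c i s0 s1 s2 s3 s4) = s4.
Proof.
rewrite /spokec !tD !tZ (h_te H) !(h_tq H) !(h_tqp H) !(h_tv H).
have -> : t (hzs c i) = 1 by rewrite /hzs (h_tC H) h_pv (h_tz H).
by rewrite !mulr0 !add0r mulr1.
Qed.

Lemma kron1 c x : kron c x c = x. Proof. by rewrite /kron eqxx. Qed.

(** The matrix [hgram] has determinant [mu - 1], which is nonzero. *)
Lemma gram_inj (k : bool -> K) :
  (forall c, hgram c true * k true + hgram c false * k false = 0) -> k =1 fun=> 0.
Proof.
move=> h; have := h true; have := h false; rewrite /hgram /= !mul1r => hf ht.
have : (1 - mu) * k false = 0 by rewrite mulrBl mul1r -[0]subr0 -{1}ht -hf; ring.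
move=> /eqP; rewrite mulf_eq0 subr_eq0 eq_sym (negPf (mu_neq1 H)) /= => /eqP kf.
by move: ht; rewrite kf addr0 => kt; case.
Qed.

(** * Nondegeneracy of the trace form and independence of the normal forms *)

Definition annihilated x := forall a, t (a * x) = 0.

Lemma annihilatedM a x : annihilated x -> annihilated (a * x).
Proof. by move=> h b; rewrite mulrA. Qed.

Lemma annihilated_t x : annihilated x -> t x = 0.
Proof. by move=> /(_ 1); rewrite mul1r. Qed.

(** The trace reads off the coordinate at the socle, and left multiplication by arrows moves each of
    the other coordinates there. Independence of the words and nondegeneracy of the form come out of
    one computation. *)
Lemma spokec_inj c i s0 s1 s2 s3 s4 : annihilated (spokec c i s0 s1 s2 s3 s4) ->
  [/\ s0 = 0, s1 = 0, s2 =1 fun=> 0, s3 = 0 & s4 = 0].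
Proof.
move=> h0; have := annihilated_t h0; rewrite t_spokec => E4.
have h1 := annihilatedM (p c i) h0; rewrite p_spokec in h1.
have := annihilated_t h1; rewrite t_hubc => E3.
have h2 d := annihilatedM (q d (nx i)) h1.
have {}h2 d : annihilated (spokec d (nx i) 0 0 (kron c s0)
    (hgram d true * kron c s1 true + hgram d false * kron c s1 false) (hgram c d * s2 d)).
  have := h2 d; rewrite -{2}(nxK H i) q_hubc; exact.
have E2 d : s2 d = 0.
  have := annihilated_t (h2 d); rewrite t_spokec => /eqP.
  by rewrite mulf_eq0 (negPf (hgram_neq0 _ _)) => /eqP.
have h3 d := annihilatedM (p d (nx i)) (h2 d).
have E1 : s1 = 0.
  have := h3 true; rewrite p_spokec => /annihilated_t; rewrite t_hubc.
  by rewrite /kron; case: c {h0 h1 h2 h3} => /=; rewrite /hgram /= !mul1r ?addr0 ?add0r.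
have E0 : s0 = 0.
  have h4 := annihilatedM (q c i) (h3 c); rewrite p_spokec in h4.
  rewrite q_hubc in h4.
  have := annihilated_t h4; rewrite t_spokec kron1 => /eqP.
  by rewrite mulf_eq0 (negPf (hgram_neq0 _ _)) => /eqP.
by split.
Qed.

Lemma q_hubcK c i c0 cc k l c4 :
  q c (nx i) * hubc i c0 cc k l c4 =
  spokec c (nx i) 0 c0 cc (hgram c true * k true + hgram c false * k false) (l c).
Proof. by rewrite -{2}(nxK H i) q_hubc. Qed.

Lemma hubc_inj i c0 c k l c4 : annihilated (hubc i c0 c k l c4) ->
  [/\ c0 = 0, c =1 fun=> 0, k =1 fun=> 0, l =1 fun=> 0 & c4 = 0].
Proof.
move=> h0; have := annihilated_t h0; rewrite t_hubc => E4.
have h1 d := annihilatedM (q d (nx i)) h0.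
have {}h1 d : [/\ True, c0 = 0, c =1 fun=> 0,
    hgram d true * k true + hgram d false * k false = 0 & l d = 0].
  by have := h1 d; rewrite q_hubcK => /spokec_inj[_ -> ? -> ->].
have [_ -> Ec _ _] := h1 true.
by split=> // [|d]; [apply: gram_inj => d|]; case: (h1 d).
Qed.

Lemma annihilated_eq0 x : annihilated x -> x = 0.
Proof.
move=> h; rewrite -[x]mul1r -(h_one H) mulr_suml big1 // => v _.
have hv : annihilated (e v * x) by apply: annihilatedM.
have := coordinates v x; case: v hv => [i|[c i]] hv [? [? [? [? [? E]]]]];
  rewrite E in hv *.
  have [-> c1 c2 c3 ->] := hubc_inj hv.
  by rewrite /hubc !c1 !c2 !c3 !scale0r !addr0.
have [-> -> c2 -> ->] := spokec_inj hv.
by rewrite /spokec !c2 !scale0r !addr0.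
Qed.

Lemma hubc_eq0 i c0 c k l c4 : hubc i c0 c k l c4 = 0 ->
  [/\ c0 = 0, c =1 fun=> 0, k =1 fun=> 0, l =1 fun=> 0 & c4 = 0].
Proof. by move=> E; apply: (@hubc_inj i) => a; rewrite E mulr0 t0. Qed.

Lemma spokec_eq0 c i s0 s1 s2 s3 s4 : spokec c i s0 s1 s2 s3 s4 = 0 ->
  [/\ s0 = 0, s1 = 0, s2 =1 fun=> 0, s3 = 0 & s4 = 0].
Proof. by move=> E; apply: (@spokec_inj c i) => a; rewrite E mulr0 t0. Qed.

Lemma eq_hubc i c0 c k l c4 c0' c' k' l' c4' :
  c0 = c0' -> c =1 c' -> k =1 k' -> l =1 l' -> c4 = c4' ->
  hubc i c0 c k l c4 = hubc i c0' c' k' l' c4'.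
Proof. by move=> -> ec ek el ->; rewrite /hubc !ec !ek !el. Qed.

Lemma eq_spokec c i s0 s1 s2 s3 s4 s0' s1' s2' s3' s4' :
  s0 = s0' -> s1 = s1' -> s2 =1 s2' -> s3 = s3' -> s4 = s4' ->
  spokec c i s0 s1 s2 s3 s4 = spokec c i s0' s1' s2' s3' s4'.
Proof. by move=> -> -> es -> ->; rewrite /spokec !es. Qed.

Lemma e_hubc i c0 c k l c4 : e (hub i) * hubc i c0 c k l c4 = hubc i c0 c k l c4.
Proof. by rewrite ev_hubc eqxx. Qed.

Lemma e_spokec c i s0 s1 s2 s3 s4 :
  e (spoke c i) * spokec c i s0 s1 s2 s3 s4 = spokec c i s0 s1 s2 s3 s4.
Proof. by rewrite ev_spokec eqxx. Qed.

(* The weights make [hD c] generate the kernel of [q c]: the sum over [d] of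
   [hw c d * hgram c d] is 0. *)
Definition hw (c d : bool) : K := (if c == d then 1 else -1) / hgram c d.

Definition hD c i := hw c true *: hZ true i + hw c false *: hZ false i.

(** The scalar, relative to the socle, of [hD c] times [Z_(~~ c)]; with [Z_c] in its place the
    scalar is 0. It is nonzero because the Gram matrix is invertible. *)
Definition htheta c := hw c true * hgram true (~~ c) + hw c false * hgram false (~~ c).

Lemma muV_neq1 : mu^-1 != 1.
Proof. by rewrite invr_eq1 (mu_neq1 H). Qed.

Lemma htheta_neq0 c : htheta c != 0.
Proof.
have m0 := mu_neq0 H; have m1 := mu_neq1 H.
case: c; last first.
  have -> : htheta false = mu^-1 - 1.
    by rewrite /htheta /hw /hgram /=; field; rewrite m0 oner_neq0.
  by rewrite subr_eq0 muV_neq1.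
have -> : htheta true = 1 - mu.
  by rewrite /htheta /hw /hgram /=; field; rewrite ?m0 ?oner_neq0.
by rewrite subr_eq0 eq_sym.
Qed.

Lemma hw_gram c d : hw c d * hgram c d = if c == d then 1 else -1.
Proof. by rewrite /hw divfK // hgram_neq0. Qed.

Lemma zs_spokec c i s0 s1 s2 s3 s4 :
  hzs c i * spokec c i s0 s1 s2 s3 s4 = spokec c i 0 0 (fun=> 0) 0 s0.
Proof.
rewrite /hzs /hv /hZ -!mulrA p_spokec q_hubcK p_spokec q_hubc.
by apply: eq_spokec => [||d||] //; rewrite /kron /hgram ?if_same //; case: c => /=;
  rewrite ?(mulr0, mulr1, mul1r, addr0, add0r).
Qed.

Lemma hw_sum c d :
  hw c true * hgram true d + hw c false * hgram false d = if c == d then 0 else htheta c.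
Proof.
case: eqP => [<-|ne]; last by have -> : d = ~~ c by case: c d ne => -[].
by rewrite ![hgram _ c]hgramC !hw_gram; case: c => /=; rewrite ?subrr ?addNr.
Qed.

Lemma hD_hubc c i c0 cc k l c4 :
  hD c (nx i) * hubc i c0 cc k l c4 =
  hubc (nx i) 0 (fun=> 0) (fun d => hw c d * c0)
    (fun d => (if c == d then 0 else htheta c) * cc d) (htheta c * k (~~ c)).
Proof.
rewrite /hD mulrDl -!scalerAl /hZ -!mulrA !q_hubcK !p_spokec.
rewrite hubcPP; apply: eq_hubc => [|d|d|d|].
- by rewrite !mulr0 addr0.
- by rewrite /kron !if_same !mulr0 addr0.
- by rewrite /kron; case: d; rewrite /= !mulr0 ?addr0 ?add0r.
- by rewrite -(hw_sum c d); ring.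
have := hw_sum c c; rewrite eqxx => h1.
have := hw_sum c (~~ c); case: c h1 => /= h1 h2; move: h1; rewrite -h2.
  by move=> h1; rewrite -[RHS]add0r -(mul0r (k true)) -h1; ring.
by move=> h1; rewrite -[RHS]add0r -(mul0r (k false)) -h1; ring.
Qed.

(** Left multiplications by [q], [hzs], [p] and [hD] form a complex of projectives that closes up
    after four steps. This lemma, [p_ker], [hD_ker] and [q_ker] are its exactness. *)
Lemma zs_ker c i x : e (spoke c i) * x = x -> hzs c i * x = 0 ->
  exists2 y, e (hub (nx i)) * y = y & x = q c i * y.
Proof.
move=> /spoke_coordinates[s0 [s1 [s2 [s3 [s4 ->]]]]].
rewrite zs_spokec => /spokec_eq0[_ _ _ _ ->].
(* As [hgram c true] is 1, the coefficient of [Z_true] alone produces the prescribed [s3]. *)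
exists (hubc (nx i) s1 s2 (kron true s3) (kron c s4) 0); first exact: e_hubc.
rewrite q_hubc; apply: eq_spokec => //.
  by rewrite kron1 hgramT /kron /= mulr0 addr0 mul1r.
by rewrite kron1.
Qed.

Lemma p_ker c i x : e (spoke c i) * x = x -> p c i * x = 0 ->
  exists2 y, e (spoke c i) * y = y & x = hzs c i * y.
Proof.
move=> /spoke_coordinates[s0 [s1 [s2 [s3 [s4 ->]]]]].
rewrite p_spokec => /hubc_eq0[_ E0 E1 E2 ->].
exists (spokec c i s4 0 (fun=> 0) 0 0); first exact: e_spokec.
rewrite zs_spokec; apply: eq_spokec => //.
- by have := E0 c; rewrite kron1.
- by have := E1 c; rewrite kron1.
by move=> d; apply/eqP; have /eqP := E2 d; rewrite mulf_eq0 (negPf (hgram_neq0 _ _)).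
Qed.

Lemma hD_ker c i y : e (hub i) * y = y -> hD c (nx i) * y = 0 ->
  exists2 x, e (spoke c i) * x = x & y = p c i * x.
Proof.
move=> /hub_coordinates[c0 [cc [k [l [c4 ->]]]]].
rewrite hD_hubc => /hubc_eq0[_ _ E0 E1 E2].
have th := htheta_neq0 c.
exists (spokec c i (cc c) (k c) (fun d => l d / hgram c d) c4 0); first exact: e_spokec.
rewrite p_spokec; apply: eq_hubc => // [|d|d|d].
- have /eqP := E0 c; rewrite /hw eqxx mulf_eq0 div1r invr_eq0.
  by rewrite (negPf (hgram_neq0 _ _)) => /eqP.
- rewrite /kron; case: eqP => [<-//|ne].
  have := E1 d; case: eqP => [E|_ /eqP]; first by case: ne.
  by rewrite mulf_eq0 (negPf th) => /eqP.
- rewrite /kron; case: eqP => [<-//|ne].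
  have -> : d = ~~ c by case: c d ne {E0 E1 E2 th} => -[].
  by move/eqP: E2; rewrite mulf_eq0 (negPf th) => /eqP.
by rewrite mulrC divfK // hgram_neq0.
Qed.

Lemma hgram_ker c (k : bool -> K) :
  hgram c true * k true + hgram c false * k false = 0 ->
  forall d, k d = hw c d * (k c * hgram c c).
Proof.
move=> E d; apply: (mulIf (hgram_neq0 c d)); rewrite mulrAC hw_gram.
case: eqP => [<-|ne]; first by rewrite mul1r.
rewrite mulN1r; apply/eqP; rewrite -addr_eq0 -E; apply/eqP.
by case: c d ne {E} => -[] //= _; ring.
Qed.

Lemma q_ker c i y : e (hub (nx i)) * y = y -> q c i * y = 0 ->
  exists2 x, e (hub i) * x = x & y = hD c (nx i) * x.
Proof.
move=> /hub_coordinates[c0 [cc [k [l [c4 ->]]]]].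
rewrite q_hubc => /spokec_eq0[_ -> E1 E2 E3].
have th := htheta_neq0 c.
exists (hubc i (k c * hgram c c) (fun d => l d / htheta c)
  (fun d => c4 / htheta c) (fun=> 0) 0); first exact: e_hubc.
rewrite hD_hubc; apply: eq_hubc => //.
- exact: hgram_ker.
- by move=> d; case: eqP => [<-|_]; rewrite ?mul0r // mulrC divfK.
by rewrite mulrC divfK.
Qed.

Lemma q_ker_all i y : e (hub i) * y = y -> (forall d, q d (nx i) * y = 0) ->
  exists a, y = a *: hz i.
Proof.
move=> /hub_coordinates[c0 [cc [k [l [c4 ->]]]]] E.
have {}E d : [/\ True, c0 = 0, cc =1 fun=> 0,
    hgram d true * k true + hgram d false * k false = 0 & l d = 0].
  by have := E d; rewrite q_hubcK => /spokec_eq0[_ -> ? -> ->].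
exists c4; have [_ -> Ec _ _] := E true.
transitivity (hubc i 0 (fun=> 0) (fun=> 0) (fun=> 0) c4).
  by apply: eq_hubc => // [|d]; [apply: gram_inj => d|]; case: (E d).
by rewrite /hubc !scale0r !add0r.
Qed.

Lemma gram_surj (f : bool -> K) : exists k : bool -> K,
  forall c, hgram c true * k true + hgram c false * k false = f c.
Proof.
have m1 : 1 - mu != 0 by rewrite subr_eq0 eq_sym (mu_neq1 H).
pose kf := (f true - f false) / (1 - mu).
exists (fun d => if d then f true - kf else kf); case; rewrite /hgram /= !mul1r ?subrK //.
have : (1 - mu) * kf = f true - f false by rewrite mulrC divfK.
by move=> E; rewrite -[RHS](subKr (f true)) -E; ring.
Qed.

(** The middle map of the complex at a hub. The products [hw c d * hgram c d] are 1 on the diagonal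
    and -1 off it, so they sum to 0 over either index: this makes [sigma] vanish on the pairs
    [q d (nx i) * y] and makes [tau] vanish on its image. *)
Definition sigma i (x : bool -> A) (c : bool) : A :=
  q c i * (hw c true *: (p true (nx i) * x true) + hw c false *: (p false (nx i) * x false)).

Lemma sigma_spokec i s0 s1 s2 s3 s4 c :
  sigma i (fun d => spokec d (nx i) (s0 d) (s1 d) (s2 d) (s3 d) (s4 d)) c =
  spokec c i 0 0 (fun d => hw c d * s0 d)
    (hw c true * hgram c true * s1 true + hw c false * hgram c false * s1 false)
    (hw c true * hgram true c * s2 true c + hw c false * hgram false c * s2 false c).
Proof.
rewrite /sigma !p_spokec hubcPP q_hubc.
apply: eq_spokec => [||d||]; rewrite /kron /=.
- by [].
- by rewrite !mulr0 !addr0.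
- by case: d; rewrite /= !mulr0 ?addr0 ?add0r.
- by ring.
by ring.
Qed.

Lemma sigma_rho i y c : e (hub i) * y = y -> sigma i (fun d => q d (nx i) * y) c = 0.
Proof.
move=> /hub_coordinates[c0 [cc [k [l [c4 ->]]]]].
transitivity (sigma i (fun d => spokec d (nx i) 0 c0 cc
    (hgram d true * k true + hgram d false * k false) (l d)) c).
  by rewrite /sigma !q_hubcK.
rewrite sigma_spokec -[RHS](spokec0 c i).
apply: eq_spokec => // [d||]; first by rewrite mulr0.
  by rewrite -mulrDl !hw_gram; case: c => /=; rewrite ?subrr ?addNr mul0r.
rewrite ![hgram _ c]hgramC -mulrDl !hw_gram.
by case: c => /=; rewrite ?subrr ?addNr mul0r.
Qed.

Lemma pm_sum c (a : bool -> K) :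
  hw c true * hgram c true * a true + hw c false * hgram c false * a false =
  a c - a (~~ c).
Proof. by rewrite !hw_gram; case: c => /=; rewrite !(mul1r, mulN1r) // addrC. Qed.

Lemma sigma_ker i (x : bool -> A) : (forall d, e (spoke d (nx i)) * x d = x d) ->
  (forall c, sigma i x c = 0) ->
  exists2 y, e (hub i) * y = y & forall d, x d = q d (nx i) * y.
Proof.
move=> ex E.
have [s0T [s1T [s2T [s3T [s4T xT]]]]] := spoke_coordinates (ex true).
have [s0F [s1F [s2F [s3F [s4F xF]]]]] := spoke_coordinates (ex false).
pose s0 (d : bool) := if d then s0T else s0F.
pose s1 (d : bool) := if d then s1T else s1F.
pose s2 (d : bool) := if d then s2T else s2F.
pose s3 (d : bool) := if d then s3T else s3F.
pose s4 (d : bool) := if d then s4T else s4F.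
have xE d : x d = spokec d (nx i) (s0 d) (s1 d) (s2 d) (s3 d) (s4 d) by case: d.
have {}E c : sigma i (fun d => spokec d (nx i) (s0 d) (s1 d) (s2 d) (s3 d) (s4 d)) c = 0.
  by rewrite -[RHS](E c) /sigma !xE.
have h c := spokec_eq0 (etrans (esym (sigma_spokec i s0 s1 s2 s3 s4 c)) (E c)).
have w0 c d : hw c d != 0.
  by rewrite /hw mulf_neq0 ?invr_neq0 ?hgram_neq0 //; case: ifP; rewrite ?oppr_eq0 oner_neq0.
have E0 d : s0 d = 0.
  have [_ _ /(_ d)/eqP + _ _] := h true.
  by rewrite mulf_eq0 (negPf (w0 _ _)) => /eqP.
have E1 : s1 false = s1 true.
  have [_ _ _ + _] := h false; rewrite pm_sum => /eqP.
  by rewrite subr_eq0 => /eqP.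
have E2 c : s2 true c = s2 false c.
  have [_ _ _ _ +] := h c; rewrite ![hgram _ c]hgramC (pm_sum c (s2^~ c)) => /eqP.
  by rewrite subr_eq0; case: c => /eqP.
(* The [hv] coordinates of [x] determine the [Z] coordinates of [y] through an invertible Gram
   system. *)
have [k kE] := gram_surj s3.
exists (hubc i (s1 true) (s2 true) k s4 0); first exact: e_hubc.
move=> d; rewrite xE q_hubcK; apply: eq_spokec => //.
- by case: d.
- by case: d => // c.
Qed.

Definition tau i (x : bool -> A) : A := p true i * x true + p false i * x false.

Lemma tau_spokec i s0 s1 s2 s3 s4 :
  tau i (fun d => spokec d i (s0 d) (s1 d) (s2 d) (s3 d) (s4 d)) =
  hubc i 0 s0 s1 (fun d => hgram d true * s2 true d + hgram d false * s2 false d)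
    (s3 true + s3 false).
Proof.
rewrite /tau !p_spokec -[X in X + _]scale1r hubcP.
apply: eq_hubc => [|d|d|d|]; rewrite ?mulr0 ?addr0 //.
- by rewrite mul1r; case: d; rewrite /kron /= ?addr0 ?add0r.
- by rewrite mul1r; case: d; rewrite /kron /= ?addr0 ?add0r.
- by rewrite ![hgram d _]hgramC mul1r.
by rewrite mul1r.
Qed.

Lemma tau_sigma i (x : bool -> A) : (forall d, e (spoke d (nx i)) * x d = x d) ->
  tau i (sigma i x) = 0.
Proof.
move=> ex.
have [s0T [s1T [s2T [s3T [s4T xT]]]]] := spoke_coordinates (ex true).
have [s0F [s1F [s2F [s3F [s4F xF]]]]] := spoke_coordinates (ex false).
pose s0 (d : bool) := if d then s0T else s0F.
pose s1 (d : bool) := if d then s1T else s1F.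
pose s2 (d : bool) := if d then s2T else s2F.
pose s3 (d : bool) := if d then s3T else s3F.
pose s4 (d : bool) := if d then s4T else s4F.
have xE d : x d = spokec d (nx i) (s0 d) (s1 d) (s2 d) (s3 d) (s4 d) by case: d.
have {}xE c : sigma i x c = sigma i (fun d => spokec d (nx i) (s0 d) (s1 d) (s2 d) (s3 d) (s4 d)) c.
  by rewrite /sigma !xE.
rewrite /tau !xE !sigma_spokec.
rewrite -[LHS]/(tau i (fun c => spokec c i 0 0 (fun d => hw c d * s0 d)
    (hw c true * hgram c true * s1 true + hw c false * hgram c false * s1 false)
    (hw c true * hgram true c * s2 true c + hw c false * hgram false c * s2 false c))).
rewrite tau_spokec -[RHS](hubc0 i); apply: eq_hubc => // [d|].
  rewrite /= [hgram d true]hgramC [hgram d false]hgramC.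
  rewrite (mulrA (hgram true d)) (mulrA (hgram false d)).
  rewrite ![hgram _ d * hw _ d]mulrC !hw_gram -mulrDl.
  by case: d => /=; rewrite ?subrr ?addNr mul0r.
by rewrite !pm_sum /= addrC subrKA subrr.
Qed.

Lemma tau_ker i (x : bool -> A) : (forall d, e (spoke d i) * x d = x d) ->
  tau i x = 0 ->
  exists2 y : bool -> A, (forall d, e (spoke d (nx i)) * y d = y d)
    & forall c, x c = sigma i y c.
Proof.
move=> ex E.
have [s0T [s1T [s2T [s3T [s4T xT]]]]] := spoke_coordinates (ex true).
have [s0F [s1F [s2F [s3F [s4F xF]]]]] := spoke_coordinates (ex false).
pose s0 (d : bool) := if d then s0T else s0F.
pose s1 (d : bool) := if d then s1T else s1F.
pose s2 (d : bool) := if d then s2T else s2F.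
pose s3 (d : bool) := if d then s3T else s3F.
pose s4 (d : bool) := if d then s4T else s4F.
have xE d : x d = spokec d i (s0 d) (s1 d) (s2 d) (s3 d) (s4 d) by case: d.
have : tau i (fun d => spokec d i (s0 d) (s1 d) (s2 d) (s3 d) (s4 d)) = 0.
  by rewrite -[RHS]E /tau !xE.
rewrite tau_spokec => /hubc_eq0[_ E0 E1 E2 E3].
(* By [pm_sum], [sigma] sees the coordinates at [q] and at [q p] only through differences between
   the two components. They are therefore put into the component [true] alone, with a sign where the
   result is read at [false]. *)
exists (fun d => spokec d (nx i) (s2 d d * hgram d d) (kron true (s3 true) d)
    (fun c => kron true (if c then s4 c else - s4 c) d) 0 0).
  by move=> d; exact: e_spokec.
move=> c; rewrite xE sigma_spokec; apply: eq_spokec => // [d||].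
- rewrite (hgram_ker (c := d) (k := s2^~ d)); last exact: E2.
  by rewrite /hw eq_sym hgramC.
- rewrite pm_sum /kron; case: c; rewrite /= ?subr0 // sub0r.
  by apply/eqP; rewrite -addr_eq0 addrC E3.
rewrite ![hgram _ c]hgramC pm_sum /kron.
by case: c; rewrite /= ?subr0 // sub0r opprK.
Qed.

Lemma rad_hub i y : e (hub i) * y = y -> exists (a : K) (x : bool -> A),
  (forall d, e (spoke d i) * x d = x d) /\ y = a *: e (hub i) + tau i x.
Proof.
move=> /hub_coordinates[c0 [cc [k [l [c4 ->]]]]].
exists c0, (fun d => spokec d i (cc d) (k d) (if d then l else fun=> 0) (if d then c4 else 0) 0).
split; first by move=> d; exact: e_spokec.
rewrite tau_spokec hub_e hubcP; apply: eq_hubc => [|d|d|d|] /=; rewrite ?mulr1 ?mulr0 ?addr0 ?add0r //.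
by rewrite hgramT mul1r.
Qed.

Lemma rad_spoke c i x : e (spoke c i) * x = x -> exists (a : K) y,
  e (hub (nx i)) * y = y /\ x = a *: e (spoke c i) + q c i * y.
Proof.
move=> /spoke_coordinates[s0 [s1 [s2 [s3 [s4 ->]]]]].
exists s0, (hubc (nx i) s1 s2 (kron true s3) (kron c s4) 0); split; first exact: e_hubc.
rewrite q_hubc spoke_e spokecP; apply: eq_spokec => [||d||] /=;
  rewrite ?mulr1 ?mulr0 ?addr0 ?add0r ?kron1 //.
by rewrite /kron /= ?mulr0 ?addr0 hgramT mul1r.
Qed.

End HubAlgebra.

(** * Linear forms on modules *)

Definition ract (K : fieldType) (A : algType K) (N : rmodType A) (n : N) (a : A) : N :=
  (a : A^c) *: n.

Notation "n ∙ a" := (ract n a) (at level 40, left associativity).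

Section RightAction.
Variables (K : fieldType) (A : algType K).
Implicit Types (N V W U P : rmodType A) (a b : A).

Lemma ractM N (n : N) a b : n ∙ (a * b) = n ∙ a ∙ b.
Proof. by rewrite /ract scalerA. Qed.

Lemma ract1 N (n : N) : n ∙ 1 = n.
Proof. exact: scale1r. Qed.

Lemma ractDl N (n n' : N) a : (n + n') ∙ a = n ∙ a + n' ∙ a.
Proof. exact: scalerDr. Qed.

Lemma ractDr N (n : N) a b : n ∙ (a + b) = n ∙ a + n ∙ b.
Proof. exact: scalerDl. Qed.

Lemma ract0l N a : (0 : N) ∙ a = 0.
Proof. exact: scaler0. Qed.

Lemma ractNl N (n : N) a : (- n) ∙ a = - (n ∙ a).
Proof. exact: scalerN. Qed.

Lemma ract0r N (n : N) : n ∙ 0 = 0.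
Proof. exact: scale0r. Qed.

Lemma ractZr N (n : N) c a : n ∙ (c *: a) = kscale c (n ∙ a).
Proof. exact: scale_act. Qed.

Lemma ractZl N (n : N) c a : kscale c n ∙ a = kscale c (n ∙ a).
Proof. exact: kscale_act. Qed.

Lemma ract_sumr N (n : N) (T : finType) (a : T -> A) : n ∙ (\sum_i a i) = \sum_i n ∙ a i.
Proof. by elim/big_rec2: _ => [|i x y _ <-]; rewrite ?ract0r ?ractDr. Qed.

Lemma linear_ract V W (f : {linear V -> W}) x a : f (x ∙ a) = f x ∙ a.
Proof. exact: linearZ. Qed.

Lemma linear_of_ract V W (f : V -> W) : (forall x y, f (x + y) = f x + f y) ->
  (forall x a, f (x ∙ a) = f x ∙ a) -> exists g : {linear V -> W}, g =1 f.
Proof.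
by move=> fD fa; apply: linear_of_fun => a x y; rewrite fD; congr (_ + _); apply: fa.
Qed.

Lemma ract_regular (x : regular_rmod A) a : x ∙ a = (x : A) * a.
Proof. by []. Qed.

Lemma kscale_regular c (x : regular_rmod A) : kscale c x = c *: (x : A).
Proof. by rewrite -[LHS]/((x : A) * (c%:A)) -scalerAr mulr1. Qed.

Lemma kscale_inj V c (x : V) : c != 0 -> kscale c x = 0 -> x = 0.
Proof. by move=> c0 h; rewrite -[x]kscale1 -(mulVf c0) -kscaleA h kscaler0. Qed.

Lemma fin_dim_family V (J : finType) (b : J -> V) :
  (forall x, exists c : J -> K, x = \sum_j kscale (c j) (b j)) -> fin_dim V.
Proof.
move=> h; exists #|J|, (fun i => b (enum_val i)) => x; have [c ->] := h x.
exists (fun i => c (enum_val i)).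
by rewrite (reindex (@enum_val J predT)) //; apply: onW_bij; apply: enum_val_bij.
Qed.

Lemma retract_injective V W : retract V W -> injective_module W -> injective_module V.
Proof.
move=> [c [c' cK]] Wi U P g h Pf gi.
have [k kE] := Wi _ _ g (c \o h) Pf gi.
by exists (c' \o k) => x; rewrite /= -kE /= cK.
Qed.

Lemma extend_form U P (g : {linear U -> P}) (psi : U -> K) :
  fin_dim P -> injective g -> kform psi ->
  exists phi : P -> K, kform phi /\ forall u, phi (g u) = psi u.
Proof.
move=> Pf gi psiL.
case: (pselect (forall u, psi u = 0)) => [z|/existsNP[u0 u0n]].
  by exists (fun=> 0); split=> [c x y|u]; rewrite ?mulr0 ?addr0 ?z.
have {}u0n : psi u0 != 0 by apply/eqP.
(* A form on [P] that vanishes on the image of the kernel of [psi] and is 1 at [g u0] restricts to a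
   multiple of [psi]. *)
have [|[u [pu]]|phi [phiL phi1 phiS]] :=
    @separating_form _ _ P (fun x => exists u, psi u = 0 /\ g u = x) (g u0) Pf.
- split; first by exists 0; rewrite (kform0 psiL) raddf0.
  move=> c x y [u [pu <-]] [v [pv <-]]; exists (kscale c u + v).
  by rewrite psiL pu pv mulr0 addr0 raddfD /= linear_kscale.
- by move=> /gi E; rewrite -E pu eqxx in u0n.
exists (fun x => psi u0 * phi x); split=> [c x y|u].
  by rewrite phiL mulrDr mulrCA.
have : phi (g (u + kscale (- (psi u / psi u0)) u0)) = 0.
  apply: phiS; exists (u + kscale (- (psi u / psi u0)) u0); split=> //.
  by rewrite addrC psiL mulNr divfK // addNr.
rewrite raddfD /= linear_kscale addrC phiL phi1 mulr1 => /eqP.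
by rewrite addrC subr_eq0 => /eqP ->; rewrite mulrC divfK.
Qed.

End RightAction.

Section HubForms.
Variables (K : fieldType) (A : algType K) (I : finType) (nx : I -> I) (mu : K).
Variables (e : hvertex I -> A) (p q : bool -> I -> A) (t : A -> K).
Hypothesis H : hub_algebra nx mu e p q t.
Implicit Types (N V W : rmodType A).

(** The lists at the spokes are padded with zeros so that all vertices share the index type
    ['I_8]. *)
Definition hbasis (v : hvertex I) : seq A :=
  match v with
  | inl i => [:: e (hub i); p true i; p false i; hZ p q true i; hZ p q false i;
      hu nx p q true i; hu nx p q false i; hz nx p q i]
  | inr (c, i) => [:: e (spoke c i); q c i; q c i * p true (nx i);
      q c i * p false (nx i); hv nx p q c i; hzs nx p q c i; 0; 0]
  end.

Lemma hbasis_spans v x : exists c : 'I_8 -> K, e v * x = \sum_(k < 8) c k *: (hbasis v)`_k.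
Proof.
have := coordinates H v x; case: v => [i|[c i]] [c0 [c1 [c2 [c3 [c4 ->]]]]].
  exists (fun k => [:: c0; c1 true; c1 false; c2 true; c2 false; c3 true; c3 false; c4]`_k).
  by rewrite !big_ord_recl big_ord0 /= /hubc addr0 -!addrA.
exists (fun k => [:: c0; c1; c2 true; c2 false; c3; c4; 0; 0]`_k).
by rewrite !big_ord_recl big_ord0 /= /spokec !scale0r !addr0 -!addrA.
Qed.

Lemma hub_fin_dim : fin_dim (regular_rmod A).
Proof.
pose b (j : hvertex I * 'I_8) : regular_rmod A := (hbasis j.1)`_j.2.
apply: (@fin_dim_family _ _ _ _ b) => x.
pose c v := sval (cid (hbasis_spans v x)).
have cE v : e v * (x : A) = \sum_(k < 8) c v k *: (hbasis v)`_k by rewrite /c; case: cid.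
exists (fun j => c j.1 j.2).
rewrite -(pair_bigA _ (fun v k => kscale (c v k) (b (v, k)))) /=.
rewrite -[LHS](mul1r (x : A)) -(h_one H) mulr_suml; apply: eq_bigr => v _.
by rewrite cE; apply: eq_bigr => k _; rewrite kscale_regular.
Qed.

Lemma trace_separates x : (forall a, t (x * a) = 0) -> x = 0.
Proof. by move=> h; apply: (annihilated_eq0 H) => a; rewrite (h_tC H). Qed.

(** Finite duality: the forms [t (x * _)] make up a row space, and a vector [y] orthogonal to all of
    them is 0 by nondegeneracy, so every form is among them. *)
Lemma trace_represents (psi : regular_rmod A -> K) : kform psi ->
  exists x : A, forall a : A, psi a = t (x * a).
Proof.
move=> psiL; have [n [b bs]] := hub_fin_dim.
pose row (x : A) : 'rV[K]_n := \row_i t (x * b i).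
have [||B BE] := @subspace_rowspace K n (fun r => exists x, r = row x).
- by exists 0; apply/rowP => i; rewrite !mxE mul0r (t0 H).
- move=> c r r' [x ->] [y ->]; exists (c *: x + y); apply/rowP => i.
  by rewrite !mxE mulrDl -scalerAl (h_tP H).
have : (\row_i psi (b i) <= B)%MS.
  rewrite submxE; apply/eqP/rowP => j; rewrite [RHS]mxE.
  pose C := cokermx B; pose y : regular_rmod A := \sum_i kscale (C i j) (b i).
  have y0 : y = 0.
    apply: (annihilated_eq0 H) => a.
    have /BE : exists x, row a = row x by exists a.
    rewrite submxE => /eqP/rowP/(_ j); rewrite [RHS]mxE => E.
    rewrite -[RHS]E mxE mulr_sumr.
    elim/big_rec2: _ => [|i u v _ <-]; first exact: (t0 H).
    rewrite (tD H); congr (_ + _); rewrite !mxE kscale_regular.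
    by rewrite -scalerAr (tZ H) mulrC.
  rewrite -[RHS](kform0 psiL) -y0 mxE /y.
  elim/big_rec2: _ => [|i u v _ ->]; first by rewrite (kform0 psiL).
  by rewrite psiL !mxE mulrC.
move=> /BE[x xE]; exists x => a.
have [c cE] := bs a; rewrite {1 2}cE mulr_sumr.
elim/big_rec2: _ => [|i u v _ E]; first by rewrite (kform0 psiL) (t0 H).
rewrite psiL E (tD H); congr (_ + _).
rewrite kscale_regular -scalerAr (tZ H); congr (_ * _).
by have /rowP/(_ i) := xE; rewrite !mxE.
Qed.

(* A linear form on [N] is the same as a module map to the self-injective
   algebra [A], through the symmetrizing form [t]. *)
Lemma form_map N (phi : N -> K) : kform phi ->
  exists f : {linear N -> regular_rmod A}, forall n a, t ((f n : A) * a) = phi (n ∙ a).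
Proof.
move=> phiL.
have h n : exists x : A, forall a : A, phi (n ∙ a) = t (x * a).
  apply: (@trace_represents (fun a => phi (n ∙ (a : A)))) => c x y.
  by rewrite kscale_regular ractDr ractZr phiL.
pose f n := sval (cid (h n)).
have fE n a : phi (n ∙ a) = t (f n * a) by rewrite /f; case: cid.
have eqA (x y : A) : (forall a, t (x * a) = t (y * a)) -> x = y.
  move=> E; apply/eqP; rewrite -subr_eq0; apply/eqP/trace_separates => a.
  by rewrite mulrBl -scaleN1r addrC (h_tP H) E mulN1r addNr.
have [||g gE] := @linear_of_ract _ _ N (regular_rmod A) f.
- move=> x y; apply: eqA => a.
  by rewrite mulrDl (tD H) -!fE ractDl (kformD _ _ phiL).
- move=> x b; apply: eqA => a.
  by rewrite ract_regular -mulrA -!fE ractM.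
by exists g => n a; rewrite gE fE.
Qed.

Lemma injective_regular : injective_module (regular_rmod A).
Proof.
move=> U P g h Pf gi.
have [|phi [phiL phiE]] := @extend_form _ _ U P g (fun u => t (h u)) Pf gi.
  by move=> c x y; rewrite raddfD /= linear_kscale kscale_regular (h_tP H).
have [k kE] := form_map phiL; exists k => x.
apply/eqP; rewrite -subr_eq0; apply/eqP/trace_separates => a.
rewrite mulrBl -scaleN1r addrC (h_tP H) kE -linear_ract phiE linear_ract ract_regular.
by rewrite mulN1r addNr.
Qed.

End HubForms.

(** * Projective modules over a hub algebra and their complexes *)

Section LeftIdeals.
Variables (K : fieldType) (A : algType K).

(** One construction serves for the projectives, with [c = 0], and for the kernels of left
    multiplications between them. Left multiplication by an element then gives the maps among these
    right ideals. *)
Definition annihilator_pred (b c : A) : pred (regular_rmod A) :=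
  fun x => (b * (x : A) == x) && (c * (x : A) == 0).

Fact annihilator_closed b c : GRing.submod_closed (annihilator_pred b c).
Proof.
split=> [|a x y /andP[/eqP bx /eqP cx] /andP[/eqP b_y /eqP cy]].
  by rewrite unfold_in !mulr0 !eqxx.
have E : a *: x + y = (x : A) * a + y :> A by [].
by rewrite unfold_in E !mulrDr !mulrA bx cx b_y cy mul0r addr0 !eqxx.
Qed.

Definition annihilator b c : rmodType A := submodule (annihilator_closed b c).

Definition aval b c (x : annihilator b c) : A := val x.

Lemma aval_inj b c : injective (@aval b c).
Proof. exact: val_inj. Qed.

Lemma avalP b c (x : annihilator b c) : b * aval x = aval x /\ c * aval x = 0.
Proof. by have /andP[/eqP ? /eqP ?] := valP x. Qed.

Lemma exists_aval b c (x : A) : b * x = x -> c * x = 0 -> exists y : annihilator b c, aval y = x.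
Proof.
move=> bx cx; have px : annihilator_pred b c x by rewrite /annihilator_pred bx cx !eqxx.
by exists (exist _ (x : regular_rmod A) px).
Qed.

Lemma avalD b c (x y : annihilator b c) : aval (x + y) = aval x + aval y.
Proof. by []. Qed.

Lemma aval0 b c : aval (0 : annihilator b c) = 0.
Proof. by []. Qed.

Lemma aval_act b c (x : annihilator b c) a : aval (x ∙ a) = aval x * a.
Proof. by []. Qed.

Lemma avalZ b c (x : annihilator b c) (k : K) : aval (kscale k x) = k *: aval x.
Proof.
have -> : kscale k x = x ∙ (k%:A : A) by [].
by rewrite aval_act -scalerAr mulr1.
Qed.

Lemma aval_linear b c : exists g : {linear annihilator b c -> regular_rmod A},
  forall x, g x = aval x.
Proof. by exists (val : {linear annihilator b c -> regular_rmod A}). Qed.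

Lemma linear_act (N : rmodType A) b c (n : N) :
  exists f : {linear annihilator b c -> N}, forall x, f x = n ∙ aval x.
Proof.
apply: linear_of_ract => [x y|x a]; first by rewrite avalD ractDr.
by rewrite aval_act ractM.
Qed.

Lemma linear_to_annihilator (N : rmodType A) b c (f : {linear N -> regular_rmod A}) :
  (forall n, b * (f n : A) = f n) -> (forall n, c * (f n : A) = 0) ->
  exists g : {linear N -> annihilator b c}, forall n, aval (g n) = f n.
Proof.
move=> fb fc; apply: (@linear_factor_inj _ (annihilator b c) N (regular_rmod A) val f).
  exact: val_inj.
move=> n; have [y yE] := exists_aval (fb n) (fc n).
by exists y.
Qed.

Lemma linear_lmul b c b' c' a :
  (forall x : annihilator b c, b' * (a * aval x) = a * aval x) ->
  (forall x : annihilator b c, c' * (a * aval x) = 0) ->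
  exists f : {linear annihilator b c -> annihilator b' c'},
    forall x, aval (f x) = a * aval x.
Proof.
move=> hb hc; have [f fE] := linear_act b c (a : regular_rmod A).
by have [||g gE] := @linear_to_annihilator _ b' c' f; [move=> n; rewrite fE; apply: hb
  |move=> n; rewrite fE; apply: hc|exists g => x; rewrite gE fE].
Qed.

End LeftIdeals.

Section HubModules.
Variables (K : fieldType) (A : algType K) (I : finType) (nx : I -> I) (mu : K).
Variables (e : hvertex I -> A) (p q : bool -> I -> A) (t : A -> K).
Hypothesis H : hub_algebra nx mu e p q t.
Implicit Types (N V W : rmodType A).

Local Notation D := (hD mu p q).
Local Notation zs := (hzs nx p q).
Local Notation z := (hz nx p q).

Definition Pm v : rmodType A := annihilator (e v) 0.
(* The second syzygy of the simple module at [spoke c i]. *)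
Definition Um c i : rmodType A := annihilator (e (hub (nx i))) (q c i).
Definition Jm i : rmodType A := (Pm (spoke true i) * Pm (spoke false i))%type.

Lemma Pm_e v : exists x : Pm v, aval x = e v.
Proof. by apply: exists_aval; rewrite ?mul0r // (h_idem H) eqxx. Qed.

Lemma PmP v (x : Pm v) : e v * aval x = aval x.
Proof. by have [] := avalP x. Qed.

Lemma exists_Pm v a : e v * a = a -> exists x : Pm v, aval x = a.
Proof. by move=> ea; apply: exists_aval => //; rewrite mul0r. Qed.

Lemma Pm_mapE N v (f : {linear Pm v -> N}) :
  exists n, n ∙ e v = n /\ forall x, f x = n ∙ aval x.
Proof.
have [x0 x0E] := Pm_e v; have fE x : f x = f x0 ∙ aval x.
  rewrite -linear_ract; congr (f _); apply: aval_inj.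
  by rewrite aval_act x0E PmP.
exists (f x0); split=> //; rewrite -linear_ract; congr (f _).
by apply: aval_inj; rewrite aval_act x0E (h_idem H) eqxx.
Qed.

Lemma Pm_retract v : retract (Pm v) (regular_rmod A).
Proof.
have [g gE] := aval_linear (e v) 0.
have [|x a|f fE] := @linear_of_ract _ _ (regular_rmod A) (regular_rmod A) (fun x => e v * (x : A)).
- by move=> x y; exact: (@mulrDr A).
- by rewrite !ract_regular mulrA.
have [||h hE] := @linear_to_annihilator _ _ _ (e v) 0 f.
- by move=> n; rewrite fE mulrA (h_idem H) eqxx.
- by move=> n; rewrite mul0r.
exists g, h => x; apply: aval_inj.
by rewrite hE fE gE PmP.
Qed.

Lemma Pm_projective v : projective (Pm v).
Proof. apply: (retract_projective (Pm_retract v)); exact: projective_regular. Qed.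

Lemma Pm_injective v : injective_module (Pm v).
Proof. apply: (retract_injective (Pm_retract v)); exact: injective_regular H. Qed.

Lemma Jm_projective i : projective (Jm i).
Proof. by apply: projective_prod; apply: Pm_projective. Qed.

Lemma annihilator_fin_dim (b c : A) : fin_dim (annihilator b c).
Proof.
have [g gE] := aval_linear b c; apply: (fin_dim_inj (g := g)).
  by move=> x y; rewrite !gE => /aval_inj.
exact: hub_fin_dim H.
Qed.

Lemma Pm_lmul v w a : e w * a = a ->
  exists f : {linear Pm v -> Pm w}, forall x, aval (f x) = a * aval x.
Proof.
by move=> ea; apply: linear_lmul => x; rewrite ?mul0r // mulrA ea.
Qed.

Lemma Jm_map N i (nt nf : N) : exists f : {linear Jm i -> N},
  forall x, f x = nt ∙ aval x.1 + nf ∙ aval x.2.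
Proof.
have [f1 f1E] := linear_act (e (spoke true i)) 0 nt.
have [f2 f2E] := linear_act (e (spoke false i)) 0 nf.
have [f fE] := linear_copair f1 f2.
by exists f => x; rewrite fE f1E f2E.
Qed.

Lemma Jm_mapE N i (f : {linear Jm i -> N}) : exists nt nf : N,
  [/\ nt ∙ e (spoke true i) = nt, nf ∙ e (spoke false i) = nf &
    forall x, f x = nt ∙ aval x.1 + nf ∙ aval x.2].
Proof.
have [f1 [f2 fE]] := linear_prodE f.
have [nt [ntE f1E]] := Pm_mapE f1; have [nf [nfE f2E]] := Pm_mapE f2.
by exists nt, nf; split=> // x; rewrite fE f1E f2E.
Qed.

Definition jval i (x : Jm i) (c : bool) : A := if c then aval x.1 else aval x.2.

Lemma jvalP i (x : Jm i) c : e (spoke c i) * jval x c = jval x c.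
Proof. by case: c; apply: PmP. Qed.

Lemma jval_act i (x : Jm i) c a : jval (x ∙ a) c = jval x c * a.
Proof.
have [x1 x2] := (linear_ract (fst : {linear Jm i -> _}) x a, linear_ract (snd : {linear Jm i -> _}) x a).
by case: c; rewrite /jval ?x1 ?x2 aval_act.
Qed.

Lemma jval0 i c : jval (0 : Jm i) c = 0.
Proof. by case: c. Qed.

Lemma jval_inj i (x y : Jm i) : (forall c, jval x c = jval y c) -> x = y.
Proof.
case: x y => [x1 x2] [y1 y2] h.
by congr (_, _); apply: aval_inj; [apply: (h true)|apply: (h false)].
Qed.

Lemma exists_jval i (x : bool -> A) : (forall c, e (spoke c i) * x c = x c) ->
  exists y : Jm i, forall c, jval y c = x c.
Proof.
move=> h; have [y1 E1] := exists_Pm (h true); have [y2 E2] := exists_Pm (h false).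
by exists (y1, y2); case.
Qed.

Lemma Jm_lift N i (f : bool -> {linear N -> regular_rmod A}) :
  (forall c n, e (spoke c i) * (f c n : A) = f c n) ->
  exists g : {linear N -> Jm i}, forall n c, jval (g n) c = f c n.
Proof.
move=> h.
have [||g1 g1E] := @linear_to_annihilator _ _ N (e (spoke true i)) 0 (f true).
- by move=> n; rewrite h.
- by move=> n; rewrite mul0r.
have [||g2 g2E] := @linear_to_annihilator _ _ N (e (spoke false i)) 0 (f false).
- by move=> n; rewrite h.
- by move=> n; rewrite mul0r.
have [g gE] := linear_pair g1 g2.
by exists g => n; case; rewrite gE /jval /= ?g1E ?g2E.
Qed.

(** With the hub simple as cokernel of [T] and kernel of [R], this becomes an exact sequence
    returning to the simple it starts from. It is used both as a projective resolution and as an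
    injective coresolution. *)
Lemma hub_complex i : exists (R : {linear Pm (hub i) -> Jm (nx i)})
    (G : {linear Jm (nx i) -> Jm i}) (T : {linear Jm i -> Pm (hub i)}),
  [/\ forall y c, jval (R y) c = q c (nx i) * aval y,
      forall x c, jval (G x) c = sigma nx mu p q i (jval x) c,
      forall x, aval (T x) = tau p i (jval x),
      exact_at R G & exact_at G T].
Proof.
pose f c := sval (cid (linear_act (e (hub i)) 0 (q c (nx i) : regular_rmod A))).
have fE c x : f c x = q c (nx i) * aval x by rewrite /f; case: cid => g gE /=.
have [|R RE] := @Jm_lift (Pm (hub i)) (nx i) f.
  by move=> c n; rewrite fE mulrA (h_srcq H).
have ex_g c : exists g : {linear Jm (nx i) -> regular_rmod A},
    forall x, g x = sigma nx mu p q i (jval x) c.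
  have [g gE] := Jm_map (nx i) (q c i * (hw mu c true *: p true (nx i)) : regular_rmod A)
    (q c i * (hw mu c false *: p false (nx i)) : regular_rmod A).
  exists g => x; rewrite gE /sigma mulrDr -!scalerAr.
  by congr (_ + _); rewrite ract_regular -scalerAl mulrA.
pose g c := sval (cid (ex_g c)).
have gE c x : g c x = sigma nx mu p q i (jval x) c by rewrite /g; case: cid.
have [|G GE] := @Jm_lift (Jm (nx i)) i g.
  by move=> c n; rewrite gE /sigma mulrA (h_srcq H).
have [T0 T0E] := Jm_map i (p true i : regular_rmod A) (p false i : regular_rmod A).
have [||T TE] := @linear_to_annihilator _ _ _ (e (hub i)) 0 T0.
- by move=> n; rewrite T0E mulrDr; congr (_ + _); rewrite mulrA (h_srcp H).
- by move=> n; rewrite mul0r.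
have {}TE x : aval (T x) = tau p i (jval x) by rewrite TE T0E.
have {}RE y c : jval (R y) c = q c (nx i) * aval y by rewrite RE fE.
have {}GE x c : jval (G x) c = sigma nx mu p q i (jval x) c by rewrite GE gE.
exists R, G, T; split=> // x; split=> [x0|[y <-]].
- have [|c|y ye yE] := sigma_ker H (i := i) (x := jval x); first exact: jvalP.
    by rewrite -GE x0; case: c.
  have [y' y'E] := exists_Pm ye; exists y'; apply: jval_inj => c.
  by rewrite RE y'E yE.
- apply: jval_inj => c; rewrite GE.
  have -> : sigma nx mu p q i (jval (R y)) c = sigma nx mu p q i (fun d => q d (nx i) * aval y) c.
    by rewrite /sigma !RE.
  by rewrite (sigma_rho H) ?PmP //; case: c.
- have [||y ye yE] := tau_ker H (i := i) (x := jval x); first exact: jvalP.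
    by rewrite -TE x0.
  have [y' y'E] := exists_jval ye; exists y'; apply: jval_inj => c.
  by rewrite GE yE /sigma !y'E.
apply: aval_inj; rewrite TE aval0.
have -> : tau p i (jval (G y)) = tau p i (sigma nx mu p q i (jval y)) by rewrite /tau !GE.
by apply: (tau_sigma H) => d; apply: jvalP.
Qed.

Lemma hD_p c i : D c (nx i) * p c i = 0.
Proof.
rewrite /hD mulrDl -!scalerAl.
have h d : hZ p q d (nx i) * p c i = hgram mu d c *: hu nx p q c (nx i).
  by rewrite -{2}(nxK H i) (h_Zp H).
by rewrite !h !scalerA -scalerDl (hw_sum H) eqxx scale0r.
Qed.

Lemma q_hD c i : q c i * D c (nx i) = 0.
Proof.
rewrite /hD mulrDr -!scalerAr !(h_qZ H) !scalerA -scalerDl !(hw_gram H).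
by case: c; rewrite /= ?subrr ?addNr scale0r.
Qed.

Lemma e_hD c i : e (hub i) * D c i = D c i.
Proof. by rewrite /hD mulrDr -!scalerAr /hZ !mulrA !(h_srcp H). Qed.

Lemma hD_e c i : D c i * e (hub (nx i)) = D c i.
Proof. by rewrite /hD mulrDl -!scalerAl /hZ -!mulrA !(h_tgtq H). Qed.

Lemma e_zs c i : e (spoke c i) * zs c i = zs c i.
Proof. by rewrite /hzs /hv !mulrA (h_srcq H). Qed.

Lemma zs_e c i : zs c i * e (spoke c i) = zs c i.
Proof. by rewrite /hzs -mulrA (h_tgtp H). Qed.

Lemma e_z i : e (hub i) * z i = z i.
Proof. by rewrite /hz /hZ !mulrA (h_srcp H). Qed.

Lemma q_eK c i : q c (nx i) * e (hub i) = q c (nx i).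
Proof. by rewrite -{2}(nxK H i) (h_tgtq H). Qed.

Lemma z_e i : z i * e (hub i) = z i.
Proof. by rewrite /hz {2 4}/hZ -!mulrA q_eK. Qed.

(** The periodic complex cut at [U]: [E] and [j] factor left multiplication by [hD], so that [U] is
    a cokernel when it is the source of Ext and a kernel when it is the target. *)
Lemma spoke_complex c i : exists (F : {linear Pm (spoke c i) -> Pm (spoke c i)})
    (B : {linear Pm (spoke c i) -> Pm (hub i)})
    (E : {linear Pm (hub i) -> Um c i}) (j : {linear Um c i -> Pm (hub (nx i))})
    (Q : {linear Pm (hub (nx i)) -> Pm (spoke c i)}),
  [/\ forall x, aval (F x) = zs c i * aval x,
      forall x, aval (B x) = p c i * aval x,
      forall x, aval (E x) = D c (nx i) * aval x,
      forall x, aval (j x) = aval x &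
      forall x, aval (Q x) = q c i * aval x] /\
  [/\ exact_at Q F, exact_at F B, exact_at B E, surjective_fun E &
    exact_at j Q].
Proof.
have [F FE] := Pm_lmul (spoke c i) (e_zs c i).
have [B BE] := Pm_lmul (spoke c i) (h_srcp H c i).
have [Q QE] := Pm_lmul (hub (nx i)) (h_srcq H c i).
have [||E EE] := @linear_lmul _ _ (e (hub i)) 0 (e (hub (nx i))) (q c i) (D c (nx i)).
- by move=> x; rewrite mulrA e_hD.
- by move=> x; rewrite mulrA q_hD mul0r.
have [||j jE] := @linear_lmul _ _ (e (hub (nx i))) (q c i) (e (hub (nx i))) 0 1.
- by move=> x; rewrite mul1r; have [] := avalP x.
- by move=> x; rewrite mul0r.
have {}jE x : aval (j x) = aval x by rewrite jE mul1r.
exists F, B, E, j, Q; split=> //; split=> [x|x|x|x|x].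
- split=> [x0|[y <-]]; last first.
    by apply: aval_inj; rewrite FE QE mulrA (h_zsq H) mul0r.
  have [|y ye yE] := zs_ker H (PmP x); first by rewrite -FE x0.
  have [y' y'E] := exists_Pm ye; exists y'; apply: aval_inj.
  by rewrite QE y'E yE.
- split=> [x0|[y <-]]; last first.
    by apply: aval_inj; rewrite BE FE mulrA (h_pzs H) mul0r.
  have [|y ye yE] := p_ker H (PmP x); first by rewrite -BE x0.
  have [y' y'E] := exists_Pm ye; exists y'; apply: aval_inj.
  by rewrite FE y'E yE.
- split=> [x0|[y <-]]; last first.
    by apply: aval_inj; rewrite EE BE mulrA hD_p mul0r.
  have [|y ye yE] := hD_ker H (c := c) (PmP x); first by rewrite -EE x0.
  have [y' y'E] := exists_Pm ye; exists y'; apply: aval_inj.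
  by rewrite BE y'E yE.
- have [xe xq] := avalP x; have [y ye yE] := q_ker H xe xq.
  have [y' y'E] := exists_Pm ye; exists y'; apply: aval_inj.
  by rewrite EE y'E yE.
split=> [x0|[y <-]]; last first.
  by apply: aval_inj; rewrite QE jE; have [_ ->] := avalP y.
have [||y yE] := @exists_aval _ _ (e (hub (nx i))) (q c i) (aval x).
- exact: PmP.
- by rewrite -QE x0.
by exists y; apply: aval_inj; rewrite jE yE.
Qed.

Definition simple_module_at (v : hvertex I) (S : rmodType A) (s : S) :=
  [/\ s != 0, forall x, exists a : K, x = kscale a s, s ∙ e v = s
    & forall c i, s ∙ p c i = 0 /\ s ∙ q c i = 0].

Lemma simple_hub i S s : @simple_module_at (hub i) S s ->
  exists (Y : {linear Pm (hub i) -> S}) (k : {linear S -> Pm (hub i)}),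
  [/\ forall x, Y x = s ∙ aval x, surjective_fun Y,
      forall x, Y x = 0 -> exists y : Jm i, aval x = tau p i (jval y),
      forall (y : Jm i), s ∙ tau p i (jval y) = 0 &
      [/\ injective k & forall x, (forall d, q d (nx i) * aval x = 0) <->
           exists y, k y = x]].
Proof.
move=> [s0 sspan se sarr].
have [Y YE] := linear_act (e (hub i)) 0 s.
have Ys : surjective_fun Y.
  move=> x; have [a ->] := sspan x; have [y yE] := Pm_e (hub i).
  by exists (kscale a y); rewrite linear_kscale YE yE se.
have stau (y : Jm i) : s ∙ tau p i (jval y) = 0.
  by rewrite /tau ractDr !ractM !(proj1 (sarr _ _)) !ract0l addr0.
have Yker x : Y x = 0 -> exists y : Jm i, aval x = tau p i (jval y).
  move=> x0; have [a [y [ye yE]]] := rad_hub H (PmP x).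
  have [y' y'E] := exists_jval ye; exists y'.
  have tE : tau p i (jval y') = tau p i y by rewrite /tau !y'E.
  rewrite tE yE; suff -> : a = 0 by rewrite scale0r add0r.
  apply/eqP; apply/negP => /negP a0; case/eqP: s0.
  apply: (kscale_inj a0); rewrite -x0 YE yE ractDr ractZr se.
  by rewrite -tE stau addr0.
have [k0 k0E] := linear_act (e (hub i)) 0 (z i : regular_rmod A).
have [||k1 k1E] := @linear_to_annihilator _ _ _ (e (hub i)) 0 k0.
- by move=> n; rewrite k0E ract_regular mulrA e_z.
- by move=> n; rewrite mul0r.
have zx x : aval (k1 x) = z i * aval x by rewrite k1E k0E.
have z_rad c : z i * p c i = 0 by apply: (h_zp H).
(* Multiplication by the socle element [z i] kills the radical, so it factors through the simple
   quotient and embeds it as the socle. *)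
have [|k kE] := linear_factor_surj (f := k1) Ys.
  move=> x /Yker[y yE]; apply: aval_inj.
  by rewrite zx yE /tau mulrDr !mulrA !z_rad !mul0r addr0.
have ks a : aval (k (kscale a s)) = a *: z i.
  have [y yE] := Pm_e (hub i).
  have -> : kscale a s = Y (kscale a y) by rewrite linear_kscale YE yE se.
  rewrite kE linear_kscale avalZ; congr (_ *: _).
  by rewrite zx yE z_e.
exists Y, k; split=> //; split.
  move=> x y; have [a ->] := sspan x; have [b ->] := sspan y.
  move/(congr1 (@aval _ _ _ _)); rewrite !ks => /eqP.
  rewrite -subr_eq0 -scalerBl => /eqP/(congr1 t); rewrite (tZ H) (h_tz H) (t0 H) mulr1.
  by move=> /eqP; rewrite subr_eq0 => /eqP ->.
move=> x; split=> [x0|[y <-] d].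
  have [a aE] := q_ker_all H (PmP x) x0.
  by exists (kscale a s); apply: aval_inj; rewrite ks aE.
have [a ->] := sspan y; rewrite ks -scalerAr.
by rewrite -{2}(nxK H i) (h_qz H) scaler0.
Qed.

Lemma simple_spoke c i S s : @simple_module_at (spoke c i) S s ->
  exists (Y : {linear Pm (spoke c i) -> S}),
  [/\ forall x, Y x = s ∙ aval x, surjective_fun Y &
      forall x, Y x = 0 <-> zs c i * aval x = 0].
Proof.
move=> [s0 sspan se sarr].
have [Y YE] := linear_act (e (spoke c i)) 0 s.
exists Y; split=> //.
  move=> x; have [a ->] := sspan x; have [y yE] := Pm_e (spoke c i).
  by exists (kscale a y); rewrite linear_kscale YE yE se.
move=> x; have [a [y [ye yE]]] := rad_spoke H (PmP x).
have -> : Y x = kscale a s.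
  by rewrite YE yE ractDr ractM (proj2 (sarr _ _)) ract0l addr0 ractZr se.
have -> : zs c i * aval x = a *: zs c i.
  by rewrite yE mulrDr mulrA (h_zsq H) mul0r addr0 -scalerAr zs_e.
split=> [a0|/(congr1 t)].
  have [->|n0] := eqVneq a 0; first by rewrite scale0r.
  by case/eqP: s0; apply: kscale_inj a0.
rewrite (tZ H) (t0 H) /hzs (h_tC H) (h_pv H) (h_tz H) mulr1 => ->.
exact: kscale0.
Qed.

End HubModules.

Arguments Pm_projective {K A I nx mu e p q t} H v.
Arguments Pm_injective {K A I nx mu e p q t} H v.
Arguments Jm_projective {K A I nx mu e p q t} H i.

(** * Consequences of the vanishing of Ext *)

Section HubExt.
Variables (K : fieldType) (A : algType K) (I : finType) (nx : I -> I) (mu : K).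
Variables (e : hvertex I -> A) (p q : bool -> I -> A) (t : A -> K).
Hypothesis H : hub_algebra nx mu e p q t.
Implicit Types (N V W : rmodType A).

Local Notation zs := (hzs nx p q).
Local Notation Pm := (Pm e).
Local Notation Um := (Um nx e q).
Local Notation Jm := (Jm e).
Local Notation sg := (sigma nx mu p q).

Variables (S : I -> rmodType A) (s : forall i, S i).
Hypothesis hS : forall i, simple_module_at e p q (hub i) (s i).

Definition noqp N := forall (n : N) c d i, n ∙ q c i ∙ p d (nx i) = 0.

(* For [N] without projective summands, these are the elementwise form of the
   vanishing of [Ext^1] and [Ext^2] between [N] and the modules [S i], [Um c i];
   they come out the same whichever side [N] is on. *)
Definition good N :=
  [/\ noqp N -> forall i (nt nf : N),
        nt ∙ e (spoke true i) = nt -> nf ∙ e (spoke false i) = nf ->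
        exists m, m ∙ p true i = nt /\ m ∙ p false i = nf,
      noqp N -> forall i (nt nf : N),
        nt ∙ e (spoke true i) = nt -> nf ∙ e (spoke false i) = nf ->
        nt ∙ q true i = nf ∙ q false i -> nt = 0 /\ nf = 0,
      forall c i (n : N), n ∙ e (spoke c i) = n -> n ∙ zs c i = 0 ->
        exists m, n = m ∙ p c i
    & forall c i (n : N), n ∙ e (spoke c i) = n -> n ∙ q c i = 0 ->
        exists m, n = m ∙ zs c i].

Lemma noqp_sigma N (n : N) i x c : noqp N -> n ∙ sg i x c = 0.
Proof.
move=> h; rewrite /sigma mulrDr ractDr -!scalerAr !ractZr !mulrA !ractM !h.
by rewrite !ract0l !kscaler0 addr0.
Qed.

Lemma simple_presentation i : exists (Y : {linear Pm (hub i) -> S i})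
    (T : {linear Jm i -> Pm (hub i)}),
  [/\ surjective_fun Y, exact_at T Y & forall x, aval (T x) = tau p i (jval x)].
Proof.
have [Y [k [YE Ys Yker stau _]]] := simple_hub H (hS i).
have [R [G [T [_ _ TE _ _]]]] := hub_complex H i.
exists Y, T; split=> // x; split=> [/Yker[y yE]|[y <-]].
  by exists y; apply: aval_inj; rewrite TE yE.
by rewrite YE TE stau.
Qed.

(** Maps from the projective at a vertex are elements of [N] at that vertex, so extension along the
    complexes becomes divisibility of elements. Under [noqp] the values of [sigma] act as zero on
    [N]: in the hub complex every map is a cocycle in degree 1, and every coboundary in degree 2 is
    zero. *)
Lemma good_left N : (forall i, ext12_zero (S i) N) ->
  (forall c i, ext12_zero (Um c i) N) -> good N.
Proof.
move=> eS eU; split.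
- move=> h i nt nf ntE nfE.
  have [Y [T [Ys exT TE]]] := simple_presentation i.
  have [R [G [T' [_ GE T'E _ exG]]]] := hub_complex H i.
  have TT x : T x = T' x by apply: aval_inj; rewrite TE T'E.
  have [f fE] := Jm_map e i nt nf.
  have [|k kf] := ext1_zero_extend (f := f) (proj1 (eS i)) (Pm_projective H _) Ys exT.
    move=> x; rewrite TT => /exG[y <-].
    rewrite fE -[aval _]/(jval (G y) true) -[aval _.2]/(jval (G y) false) !GE.
    by rewrite !noqp_sigma // addr0.
  have [m [mE kE]] := Pm_mapE H k; exists m.
  have [x1 x1E] := Pm_e H (spoke true i); have [x2 x2E] := Pm_e H (spoke false i).
  have := kf (x1, 0); have := kf (0, x2).
  rewrite !fE !kE !TE /tau /= x1E x2E !aval0 !mulr0 !ract0r !addr0 !add0r.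
  by rewrite !(h_tgtp H) ntE nfE => -> ->.
- move=> h i nt nf ntE nfE nq.
  have [Y [T [Ys exT TE]]] := simple_presentation (nx i).
  have [R [G [T' [RE GE T'E exR exG]]]] := hub_complex H (nx i).
  have TT x : T x = T' x by apply: aval_inj; rewrite TE T'E.
  (* The sign turns the equality of [nt ∙ q true i] and [nf ∙ q false i] into the vanishing of [f]
     on the image of [R]. *)
  have [f fE] := Jm_map e (nx (nx i)) nt (- nf).
  have [|x|k kf] := ext2_zero_extend (d1 := G) (f := f) (proj2 (eS (nx i)))
    (Pm_projective H _) Ys exT (Jm_projective H _).
  + by move=> x; rewrite TT; apply: exG.
  + move=> /exR[y <-].
    rewrite fE -[aval _]/(jval (R y) true) -[aval _.2]/(jval (R y) false) !RE.
    by rewrite !(nxK H) !ractM !ractNl nq subrr.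
  have k0 x : k (G x) = 0.
    have [mt [mf [_ _ kE]]] := Jm_mapE H k.
    rewrite kE -[aval _]/(jval (G x) true) -[aval _.2]/(jval (G x) false) !GE.
    by rewrite !noqp_sigma // addr0.
  have [x1 x1E] := Pm_e H (spoke true (nx (nx i))).
  have [x2 x2E] := Pm_e H (spoke false (nx (nx i))).
  have := kf (x1, 0); have := kf (0, x2).
  rewrite !k0 !fE /= x1E x2E !aval0 !ract0r addr0 add0r !(nxK H) ntE ractNl nfE.
  by move=> /eqP; rewrite oppr_eq0 => /eqP -> ->.
- move=> c i n nE nz.
  have [F [B [E [j [Q [[FE BE EE jE QE] [exQ exF exB Es exj]]]]]]] := spoke_complex H c i.
  have [f fE] := linear_act (e (spoke c i)) 0 n.
  have [|k kf] := ext1_zero_extend (f := f) (proj1 (eU c i)) (Pm_projective H _) Es exB.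
    by move=> x /exF[y <-]; rewrite fE FE ractM nz ract0l.
  have [m [mE kE]] := Pm_mapE H k; exists m.
  have [x xE] := Pm_e H (spoke c i).
  by have := kf x; rewrite fE kE BE xE nE (h_tgtp H).
move=> c i n nE nq.
have [F [B [E [j [Q [[FE BE EE jE QE] [exQ exF exB Es exj]]]]]]] := spoke_complex H c i.
have [f fE] := linear_act (e (spoke c i)) 0 n.
have [|k kf] := ext2_zero_extend (d1 := F) (f := f) (proj2 (eU c i))
    (Pm_projective H _) Es exB (Pm_projective H _) exF.
  by move=> x /exQ[y <-]; rewrite fE QE ractM nq ract0l.
have [m [mE kE]] := Pm_mapE H k; exists m.
have [x xE] := Pm_e H (spoke c i).
by have := kf x; rewrite fE kE FE xE nE (zs_e H).
Qed.

End HubExt.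

Section HubExt.
Variables (K : fieldType) (A : algType K) (I : finType) (nx : I -> I) (mu : K).
Variables (e : hvertex I -> A) (p q : bool -> I -> A) (t : A -> K).
Hypothesis H : hub_algebra nx mu e p q t.
Implicit Types (N V W : rmodType A).

Local Notation zs := (hzs nx p q).
Local Notation Pm := (Pm e).
Local Notation Um := (Um nx e q).
Local Notation good := (good nx e p q).

Variables (S : I -> rmodType A) (s : forall i, S i).
Hypothesis hS : forall i, simple_module_at e p q (hub i) (s i).

Lemma form_map_at N v (phi : N -> K) : kform phi -> (forall n, phi (n ∙ e v) = phi n) ->
  exists h : {linear N -> Pm v}, forall n a, t (aval (h n) * a) = phi (n ∙ a).
Proof.
move=> phiL phie; have [f fE] := form_map H phiL.
have [||h hE] := @linear_to_annihilator _ _ N (e v) 0 f.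
- move=> n; apply/eqP; rewrite -subr_eq0; apply/eqP/(trace_separates H) => a.
  rewrite mulrBl -scaleN1r addrC (h_tP H) -mulrA [t (e v * _)](h_tC H) -mulrA !fE ractM phie.
  by rewrite mulN1r addNr.
- by move=> n; rewrite mul0r.
by exists h => n a; rewrite hE fE.
Qed.

Lemma kform_aval N v (k : {linear N -> Pm v}) : kform (fun n => t (aval (k n))).
Proof. by move=> c x y; rewrite raddfD /= linear_kscale avalD avalZ (h_tP H). Qed.

Lemma kform_ract N (phi : N -> K) a : kform phi -> kform (fun n => phi (n ∙ a)).
Proof. by move=> h c x y; rewrite ractDl ractZl h. Qed.

Lemma separating_form_at N v (X : N -> Prop) n : fin_dim N -> ksubspace X ->
  (forall x, X x -> X (x ∙ e v)) -> n ∙ e v = n -> ~ X n ->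
  exists phi : N -> K, [/\ kform phi, phi n = 1, forall x, X x -> phi x = 0
    & forall x, phi (x ∙ e v) = phi x].
Proof.
move=> Nf Xs Xe ne nX; have [phi [phiL phi1 phiX]] := separating_form Nf Xs nX.
exists (fun x => phi (x ∙ e v)); split=> [|||x].
- exact: kform_ract.
- by rewrite ne.
- by move=> x /Xe /phiX.
by rewrite -ractM (h_idem H) eqxx.
Qed.

(** Maps from [N] to a projective are linear forms on [N], so lifting along left multiplication by
    [b] becomes writing [phi] as a form composed with the action of [b]. *)
Lemma ext_form_lift N v w (b b' : A) (r : {linear Pm v -> Pm w}) (phi : N -> K) :
  e w * b = b ->
  (forall x, aval (r x) = b * aval x) ->
  (forall x : Pm w, b' * aval x = 0 -> exists y, r y = x) ->
  (forall h : {linear N -> Pm w}, (forall n, exists x, r x = h n) ->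
     exists k : {linear N -> Pm v}, forall n, r (k n) = h n) ->
  kform phi -> (forall n, phi (n ∙ e w) = phi n) -> (forall n, phi (n ∙ b') = 0) ->
  exists psi : N -> K, kform psi /\ forall n, phi n = psi (n ∙ b).
Proof.
move=> eb rE rim lift phiL phie phib.
have [h hE] := form_map_at phiL phie.
have [|k kE] := lift h.
  move=> n; apply: rim; apply: (trace_separates H) => a.
  by rewrite -mulrA (h_tC H) -mulrA hE ractM phib.
exists (fun n => t (aval (k n))); split; first exact: kform_aval.
move=> n; rewrite linear_ract aval_act (h_tC H) -rE kE -[aval _]mulr1 hE.
by rewrite ract1.
Qed.

(** The complexes now serve as injective coresolutions and the degrees are exchanged: the first and
    third conditions come from Ext^2, the other two from Ext^1. Each is proved by contradiction,
    with a linear form on [N] that detects a counterexample. *)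
Lemma good_right N : fin_dim N -> (forall i, ext12_zero N (S i)) ->
  (forall c i, ext12_zero N (Um c i)) -> good N.
Proof.
have Af := hub_fin_dim H.
move=> Nf eS eU; split.
- move=> h i nt nf ntE nfE.
  have [Y [k0 [_ _ _ _ [k0i k0ex]]]] := simple_hub H (hS i).
  have [R [G [T [RE GE TE exR exG]]]] := hub_complex H i.
  have exk : exact_at k0 R.
    move=> x; rewrite -k0ex; split=> [x0 d|x0].
      by rewrite -RE x0; case: d.
    by apply: jval_inj => d; rewrite RE x0; case: d.
  apply: contrapT => nex.
  (* The pair is encoded by the sum [nt + nf], which determines both because the spoke idempotents
     are orthogonal. *)
  pose X (x : N) := exists m, x = m ∙ p true i + m ∙ p false i.
  have [||phi [phiL phi1 phiX]] := @separating_form _ _ N X (nt + nf) Nf.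
  + split; first by exists 0; rewrite !ract0l addr0.
    move=> c x y [m ->] [m' ->]; exists (kscale c m + m').
    by rewrite !ractDl !ractZl kscaleDr addrACA.
  + move=> [m mE]; apply: nex; exists m; split.
      have := congr1 (fun x => x ∙ e (spoke true i)) mE.
      rewrite !ractDl -!ractM !(pe H) !eqxx /= ntE -[nf]nfE -ractM (h_idem H) /=.
      by rewrite !ract0r !addr0.
    have := congr1 (fun x => x ∙ e (spoke false i)) mE.
    rewrite !ractDl -!ractM !(pe H) !eqxx /= nfE -[nt]ntE -ractM (h_idem H) /=.
    by rewrite !ract0r !add0r.
  pose ph c (n : N) := phi (n ∙ e (spoke c i)).
  have phL c : kform (ph c) by apply: kform_ract.
  have phe c n : ph c (n ∙ e (spoke c i)) = ph c n.
    by rewrite /ph -ractM (h_idem H) eqxx.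
  pose f c := sval (cid (form_map H (phL c))).
  have fE c n a : t ((f c n : A) * a) = ph c (n ∙ a) by rewrite /f; case: cid.
  have fe c n : e (spoke c i) * (f c n : A) = f c n.
    apply/eqP; rewrite -subr_eq0; apply/eqP/(trace_separates H) => a.
    rewrite mulrBl -scaleN1r addrC (h_tP H) -mulrA [t (e _ * _)](h_tC H) -mulrA !fE ractM phe.
    by rewrite mulN1r addNr.
  have [h0 h0E] := Jm_lift fe.
  have [|k kE] := ext2_zero_lift (h := h0) Af Nf (proj2 (eS i)) (Pm_injective H _) k0i exk exR.
    move=> n; apply/exG; apply: aval_inj; rewrite TE aval0 /tau !h0E.
    apply: (trace_separates H) => a.
    rewrite mulrDl (tD H) -!mulrA ![t (p _ _ * _)](h_tC H) -!mulrA !fE !ractM /ph.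
    rewrite -!ractM !(h_tgtp H) -(kformD _ _ phiL).
    by apply: phiX; exists (n ∙ a); rewrite -!ractM.
  (* By cyclicity of the trace, [sigma] applied to the values of [k] brings in products [q p] acting
     on [N], and these are zero. *)
  have ph0 c n : ph c n = 0.
    rewrite -[n]ract1 -fE mulr1 -h0E -kE GE /sigma mulrDr -!scalerAr (tD H) !(tZ H).
    rewrite !mulrA ![t (_ * jval _ _)](h_tC H).
    have z0 d : jval (k n) d * (q c i * p d (nx i)) = 0.
      by rewrite -jval_act -(linear_ract k) ractM h raddf0 jval0.
    by rewrite !z0 (t0 H) !mulr0 addr0.
  have : phi (nt + nf) = ph true nt + ph false nf by rewrite (kformD _ _ phiL) /ph ntE nfE.
  by rewrite !ph0 addr0 phi1 => /eqP; rewrite oner_eq0.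
- move=> h i0 nt nf ntE nfE nq.
  pose i := nx i0; have iE : nx i = i0 by rewrite (nxK H).
  have [Y [k0 [_ _ _ _ [k0i k0ex]]]] := simple_hub H (hS i).
  have [R [G [T [RE GE TE exR exG]]]] := hub_complex H i.
  have exk : exact_at k0 R.
    move=> x; rewrite -k0ex; split=> [x0 d|x0].
      by rewrite -RE x0; case: d.
    by apply: jval_inj => d; rewrite RE x0; case: d.
  pose n_ (c : bool) := if c then nt else nf.
  have n_E c : n_ c ∙ e (spoke c (nx i)) = n_ c by rewrite iE; case: c.
  have key c : n_ c = 0.
    apply: contrapT => nc0.
    have [||||phi [phiL phi1 _ phie]] := @separating_form_at N (spoke c (nx i)) (fun x => x = 0) (n_ c) Nf.
    + by split=> // a x y -> ->; rewrite kscaler0 addr0.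
    + by move=> x ->; rewrite ract0l.
    + exact: n_E.
    + by [].
    have [f0 f0E] := form_map_at phiL phie.
    have [f1 f1E] := aval_linear (e (spoke c (nx i))) 0.
    (* The form is put into the component [c] alone. Since [n_q] identifies the contributions of the
       two components, its value 1 at [n_ c] is also the value 0 of the other component. *)
    pose f (d : bool) : {linear N -> regular_rmod A} :=
      if c == d then (f1 \o f0 : {linear N -> regular_rmod A}) else (\0 : {linear N -> regular_rmod A}).
    have fe d n : e (spoke d (nx i)) * (f d n : A) = f d n.
      rewrite /f; case: eqP => [<-|_] /=; last exact: mulr0.
      by rewrite f1E (PmP (f0 n)).
    have [h0 h0E] := Jm_lift fe.
    have [|k kE] := ext1_zero_lift (h := h0) Af Nf (proj1 (eS i)) k0i exk.
      move=> n; apply/exR; apply: jval_inj => d; rewrite GE.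
      transitivity (0 : A); last by case: d.
      apply: (trace_separates H) => a.
      rewrite /sigma mulrDr -!scalerAr mulrDl -!scalerAl (tD H) !(tZ H).
      have z0 d' : t (q d i * (p d' (nx i) * jval (h0 n) d') * a) = 0.
        rewrite h0E /f; case: eqP => [<-|_] /=; last by rewrite !mulr0 mul0r (t0 H).
        rewrite f1E mulrA -mulrA (h_tC H) -mulrA f0E mulrA !ractM -ractM -ractM.
        by rewrite mulrA !ractM h (kform0 phiL).
      by rewrite !z0 !mulr0 addr0.
    have psiE d n : t (f d n : A) = t (aval (k (n ∙ q d (nx i)))).
      by rewrite linear_ract aval_act (h_tC H) -RE kE h0E.
    have n_q : n_ c ∙ q c (nx i) = n_ (~~ c) ∙ q (~~ c) (nx i).
      by rewrite iE /n_; case: (c) => /=; rewrite nq.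
    have := psiE c (n_ c); rewrite n_q -psiE /f eqxx.
    have -> : (c == ~~ c) = false by case: (c).
    by rewrite /= (t0 H) f1E -[aval _]mulr1 f0E ract1 phi1 => /eqP; rewrite oner_eq0.
  by split; [apply: (key true)|apply: (key false)].
- move=> c i n nE nz.
  have [F [B [E [j [Q [[FE BE EE jE QE] [exQ exF exB Es exj]]]]]]] := spoke_complex H c i.
  have ji : injective j by move=> x y E'; apply: aval_inj; rewrite -!jE E'.
  apply: contrapT => nex.
  have [|||phi [phiL phi1 phiX phie]] :=
      @separating_form_at N (spoke c i) (fun x => exists m, x = m ∙ p c i) n Nf _ _ nE.
  + split; first by exists 0; rewrite ract0l.
    by move=> a x y [m ->] [m' ->]; exists (kscale a m + m'); rewrite ractDl ractZl.
  + by move=> x [m ->]; exists m; rewrite -ractM (h_tgtp H).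
  + by [].
  have [|x x0|h0 hr|m|psi [psiL psiE]] := @ext_form_lift N _ _ (zs c i) (p c i) F phi _ FE _ _ phiL phie.
  + exact: (e_zs H).
  + by apply: (proj1 (exF x)); apply: aval_inj; rewrite BE x0.
  + have := ext2_zero_lift Af Nf (proj2 (eU c i)) (Pm_injective H _) ji exj exQ hr; exact.
  + by apply: phiX; exists m.
  by have := psiE n; rewrite nz phi1 (kform0 psiL) => /eqP; rewrite oner_eq0.
move=> c i n nE nq.
have [F [B [E [j [Q [[FE BE EE jE QE] [exQ exF exB Es exj]]]]]]] := spoke_complex H c i.
have ji : injective j by move=> x y E'; apply: aval_inj; rewrite -!jE E'.
apply: contrapT => nex.
have [|||phi [phiL phi1 phiX phie]] :=
    @separating_form_at N (spoke c i) (fun x => exists m, x = m ∙ zs c i) n Nf _ _ nE.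
+ split; first by exists 0; rewrite ract0l.
  by move=> a x y [m ->] [m' ->]; exists (kscale a m + m'); rewrite ractDl ractZl.
+ by move=> x [m ->]; exists m; rewrite -ractM (zs_e H).
+ by [].
have [|x x0|h0 hr|m|psi [psiL psiE]] := @ext_form_lift N _ _ (q c i) (zs c i) Q phi _ QE _ _ phiL phie.
+ exact: (h_srcq H).
+ by apply: (proj1 (exQ x)); apply: aval_inj; rewrite FE x0.
+ have := ext1_zero_lift Af Nf (proj1 (eU c i)) ji exj hr; exact.
+ by apply: phiX; exists m.
by have := psiE n; rewrite nq phi1 (kform0 psiL) => /eqP; rewrite oner_eq0.
Qed.

End HubExt.

(** * Modules satisfying the conditions *)

Section HubStructure.
Variables (K : fieldType) (A : algType K) (I : finType) (nx : I -> I) (mu : K).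
Variables (e : hvertex I -> A) (p q : bool -> I -> A) (t : A -> K).
Hypothesis H : hub_algebra nx mu e p q t.
Implicit Types (M N V W : rmodType A).

Local Notation Z := (hZ p q).
Local Notation zs := (hzs nx p q).
Local Notation z := (hz nx p q).
Local Notation u := (hu nx p q).
Local Notation Pm := (Pm e).

(** The vector with nonzero image is what makes the complement of [W] smaller in the induction. *)
Definition nonzero_retract W N := exists (c : {linear W -> N}) (c' : {linear N -> W}),
  (forall w, c' (c w) = w) /\ exists n, c' n != 0.

Lemma kform_hubc N (phi : N -> K) n i c0 c k l c4 : kform phi ->
  phi (n ∙ hubc nx e p q i c0 c k l c4) =
  c0 * phi (n ∙ e (hub i)) + (c true * phi (n ∙ p true i) + c false * phi (n ∙ p false i))
  + (k true * phi (n ∙ Z true i) + k false * phi (n ∙ Z false i))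
  + (l true * phi (n ∙ u true i) + l false * phi (n ∙ u false i)) + c4 * phi (n ∙ z i).
Proof.
by move=> phiL; rewrite /hubc !ractDr !ractZr !(kformD _ _ phiL) !(kformZ _ _ phiL).
Qed.

Lemma kform_spokec N (phi : N -> K) n c i s0 s1 s2 s3 s4 : kform phi ->
  phi (n ∙ spokec nx e p q c i s0 s1 s2 s3 s4) =
  s0 * phi (n ∙ e (spoke c i)) + s1 * phi (n ∙ q c i)
  + (s2 true * phi (n ∙ (q c i * p true (nx i))) + s2 false * phi (n ∙ (q c i * p false (nx i))))
  + s3 * phi (n ∙ hv nx p q c i) + s4 * phi (n ∙ zs c i).
Proof.
by move=> phiL; rewrite /spokec !ractDr !ractZr !(kformD _ _ phiL) !(kformZ _ _ phiL).
Qed.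

Lemma q_z c j i : q c j * z i = 0.
Proof.
have [<-|ne] := eqVneq (nx j) i; first exact: (h_qz H).
rewrite -(h_tgtq H) -(e_z H) -mulrA [e _ * _]mulrA (h_idem H).
by case: eqP => [[E]|_]; [rewrite E eqxx in ne|rewrite mul0r mulr0].
Qed.

Lemma z_p c i : z i * p c i = 0. Proof. exact: (h_zp H). Qed.

(** The form agrees with the trace on the multiples of [n], so the map it defines sends [n] to
    [e v], while [e v] is sent back to [n]. *)
Lemma split_projective N v (n : N) (phi : N -> K) : kform phi -> n ∙ e v = n ->
  (forall x, phi (x ∙ e v) = phi x) -> (forall a, phi (n ∙ (e v * a)) = t (e v * a)) ->
  (exists a, t (e v * a) != 0) -> nonzero_retract (Pm v) N.
Proof.
move=> phiL ne phie phin [a0 a0n].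
have [f fE] := form_map_at H phiL phie.
have [g gE] := linear_act (e v) 0 n.
have fn : aval (f n) = e v.
  apply/eqP; rewrite -subr_eq0; apply/eqP/(trace_separates H) => a.
  by rewrite mulrBl -scaleN1r addrC (h_tP H) fE -{1}ne -ractM phin mulN1r addNr.
exists g, f; split=> [w|]; first by apply: aval_inj; rewrite gE linear_ract aval_act fn PmP.
exists n; apply/eqP => f0; move: a0n; rewrite -fn f0 aval0 mul0r (t0 H).
by rewrite eqxx.
Qed.

Lemma split_hub N (n : N) i : fin_dim N -> n ∙ z i != 0 -> nonzero_retract (Pm (hub i)) N.
Proof.
move=> Nf nz0.
wlog ne : n nz0 / n ∙ e (hub i) = n.
  move=> h; apply: (h (n ∙ e (hub i))); first by rewrite -ractM (e_z H).
  by rewrite -ractM (h_idem H) eqxx.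
(* [X] is spanned by the values at [n] of the normal-form words from the hub [i] to itself other
   than [z i]; on words ending elsewhere [phi] vanishes by [phie]. The final idempotent discards the
   [Z] words when [nx i] differs from [i]. *)
pose X x := exists a (b : bool -> K), x =
  (kscale a n + (kscale (b true) (n ∙ Z true i) + kscale (b false) (n ∙ Z false i))) ∙ e (hub i).
have [||||phi [phiL phi1 phiX phie]] := @separating_form_at _ _ _ _ _ _ _ _ _ H N (hub i) X (n ∙ z i) Nf.
- split.
    by exists 0, (fun=> 0); rewrite !kscale0 !addr0 ract0l.
  move=> c x y [a [b ->]] [a' [b' ->]]; exists (c * a + a'), (fun d => c * b d + b' d).
  rewrite -ractZl -ractDl; congr (_ ∙ _).
  by rewrite !kscaleDr !kscaleDl !kscaleA addrACA; congr (_ + _); rewrite addrACA.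
- move=> x [a [b ->]]; exists a, b.
  by rewrite -[in LHS]ractM (h_idem H) eqxx.
- by rewrite -ractM (z_e H).
(* Acting by [z i] on the relation gives [a = 0]; if [nx i] is [i], acting by the [Z] words then
   gives a Gram system for [b]. *)
- move=> [a [b E]].
  have Zz c : Z c i * z i = 0 by rewrite /hZ -mulrA q_z mulr0.
  have Ea : a = 0.
    apply/eqP; apply/negP => /negP a0; case/eqP: nz0; apply: (kscale_inj a0).
    have := congr1 (fun x => x ∙ z i) E; rewrite -!ractM (e_z H) !ractDl !ractZl -!ractM !Zz.
    rewrite !ract0r !kscaler0 !addr0 => <-.
    by rewrite {1}/hz /hZ -!mulrA q_z !mulr0 ract0r.
  move: E; rewrite Ea kscale0 add0r ractDl !ractZl -!ractM => E.
  have [ii|ne_i] := eqVneq (nx i) i; last first.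
    case/eqP: nz0; rewrite E /hZ -!mulrA !(qe H).
    have -> : (hub i == hub (nx i)) = false by apply/eqP => -[E']; rewrite -E' eqxx in ne_i.
    by rewrite !mulr0 ract0r !kscaler0 addr0.
  have b0 : b =1 fun=> 0.
    apply: (gram_inj H) => d; apply/eqP; apply/negP => /negP g0.
    case/eqP: nz0; apply: (kscale_inj g0).
    have := congr1 (fun x => x ∙ Z d (nx i)) E.
    have -> : n ∙ z i ∙ Z d (nx i) = 0.
      by rewrite -ractM /hZ mulrA ii z_p mul0r ract0r.
    rewrite ractDl !ractZl -!ractM.
    have Ze c : Z c i * e (hub i) = Z c i by rewrite /hZ -mulrA -(h_tgtq H) -mulrA ii (h_idem H) eqxx.
    rewrite !Ze !(hZ_Z H) !ractZr !kscaleA -kscaleDl => ->.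
    by rewrite ![hgram mu d _]hgramC ![_ * b _]mulrC.
  by case/eqP: nz0; rewrite E !b0 !kscale0 addr0.
have phi0 v a : v != hub i -> phi (n ∙ (a * e v)) = 0.
  move=> ve; rewrite -phie -ractM -mulrA (h_idem H) (negPf ve) mulr0 ract0r.
  exact: kform0 phiL.
apply: (split_projective phiL ne phie) => [a|].
  have := coordinates H (hub i) a => -[c0 [c [k [l [c4 ->]]]]].
  rewrite (kform_hubc _ _ _ _ _ _ _ phiL) (t_hubc H) ne phi1 mulr1.
  have -> : phi n = 0.
    apply: phiX; exists 1, (fun=> 0).
    by rewrite !kscale0 !addr0 kscale1 ne.
  have pp d : phi (n ∙ p d i) = 0 by rewrite -(h_tgtp H) phi0.
  have pu d : phi (n ∙ u d i) = 0 by rewrite /hu -(h_tgtp H) mulrA phi0.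
  have pZ d : phi (n ∙ Z d i) = 0.
    rewrite -phie; apply: phiX; exists 0, (kron d 1).
    by rewrite /kron kscale0 add0r; case: d; rewrite /= kscale1 kscale0 ?addr0 ?add0r.
  by rewrite !pp !pu !pZ !mulr0 !addr0 add0r.
exists (z i); rewrite (e_z H) (h_tz H); exact: oner_neq0.
Qed.

Lemma split_spoke N (n : N) c i : fin_dim N -> n ∙ zs c i != 0 ->
  nonzero_retract (Pm (spoke c i)) N.
Proof.
move=> Nf nz0.
wlog ne : n nz0 / n ∙ e (spoke c i) = n.
  move=> h; apply: (h (n ∙ e (spoke c i))); first by rewrite -ractM (e_zs H).
  by rewrite -ractM (h_idem H) eqxx.
(* Besides the socle, the words from the spoke to itself are the idempotent and, when [nx i] is [i],
   the cycle [q c i * p c i]. *)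
pose X x := exists a b, x =
  (kscale a n + kscale b (n ∙ q c i ∙ p c (nx i))) ∙ e (spoke c i).
have [||||phi [phiL phi1 phiX phie]] :=
    @separating_form_at _ _ _ _ _ _ _ _ _ H N (spoke c i) X (n ∙ zs c i) Nf.
- split.
    by exists 0, 0; rewrite !kscale0 !addr0 ract0l.
  move=> k x y [a [b ->]] [a' [b' ->]]; exists (k * a + a'), (k * b + b').
  rewrite -ractZl -ractDl; congr (_ ∙ _).
  by rewrite !kscaleDr !kscaleDl !kscaleA addrACA.
- move=> x [a [b ->]]; exists a, b.
  by rewrite -[in LHS]ractM (h_idem H) eqxx.
- by rewrite -ractM (zs_e H).
- move=> [a [b E]].
  have [ii|ne_i] := eqVneq (nx i) i; last first.
    have {}E : n ∙ zs c i = kscale a n.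
      rewrite E ractDl !ractZl ne -!ractM -?mulrA (pe H).
      have -> : (spoke c i == spoke c (nx i)) = false.
        by apply/eqP => -[E']; rewrite -E' eqxx in ne_i.
      by rewrite !mulr0 ract0r kscaler0 addr0.
    have [a0|a0] := eqVneq a 0; first by rewrite E a0 kscale0 eqxx in nz0.
    case/eqP: nz0; apply: (kscale_inj a0); rewrite -ractZl -E -ractM.
    by rewrite {2}/hzs /hv !mulrA (h_zsq H) !mul0r ract0r.
  have pe0 : p c (nx i) * e (spoke c i) = p c (nx i) by rewrite ii (h_tgtp H).
  have {}E : n ∙ zs c i = kscale a n + kscale b (n ∙ q c i ∙ p c (nx i)).
    by rewrite E ractDl !ractZl ne -!ractM -?mulrA pe0.
  have zsq : zs c i * q c i = 0 by exact: (h_zsq H).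
  have pzs : p c (nx i) * zs c i = 0 by rewrite ii (h_pzs H).
  have zszs : zs c i * zs c i = 0 by rewrite {2}/hzs /hv !mulrA zsq !mul0r.
  have [a0|a0] := eqVneq a 0; last first.
    case/eqP: nz0; apply: (kscale_inj a0).
    have := congr1 (fun x => x ∙ zs c i) E; rewrite ractDl !ractZl -!ractM pzs zszs.
    by rewrite mulr0 !ract0r kscaler0 addr0 => <-.
  move: E; rewrite a0 kscale0 add0r => E.
  have [b0|b0] := eqVneq b 0; first by rewrite E b0 kscale0 eqxx in nz0.
  have g0 : b * hgram mu c c != 0 by rewrite mulf_neq0 // (hgram_neq0 H).
  case/eqP: nz0; apply: (kscale_inj g0).
  have := congr1 (fun x => x ∙ (q c i * p c i)) E.
  rewrite ractZl -!ractM [zs c i * _]mulrA zsq mul0r ract0r.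
  have -> : q c i * (p c (nx i) * (q c i * p c i)) = hgram mu c c *: zs c i.
    have -> : p c (nx i) * (q c i * p c i) = Z c (nx i) * p c i by rewrite /hZ -mulrA ii.
    by rewrite mulrA (h_qZ H) -scalerAl.
  by rewrite ractZr kscaleA.
have phi0 v a : v != spoke c i -> phi (n ∙ (a * e v)) = 0.
  move=> ve; rewrite -phie -ractM -mulrA (h_idem H) (negPf ve) mulr0 ract0r.
  exact: kform0 phiL.
apply: (split_projective phiL ne phie) => [a|].
  have := coordinates H (spoke c i) a => -[s0 [s1 [s2 [s3 [s4 ->]]]]].
  rewrite (kform_spokec _ _ _ _ _ _ _ _ phiL) (t_spokec H) ne phi1 mulr1.
  have -> : phi n = 0.
    apply: phiX; exists 1, 0.
    by rewrite !kscale0 !addr0 kscale1 ne.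
  have -> : phi (n ∙ q c i) = 0 by rewrite -(h_tgtq H) phi0.
  have -> : phi (n ∙ hv nx p q c i) = 0.
    by rewrite /hv /hZ -(h_tgtq H true (nx i)) !mulrA phi0.
  have qp d : phi (n ∙ (q c i * p d (nx i))) = 0.
    have [->|dc] := eqVneq d c.
      by rewrite -phie; apply: phiX; exists 0, 1; rewrite kscale0 add0r kscale1 ractM.
    rewrite -(h_tgtp H d) mulrA phi0 //.
    by apply/eqP => -[E _]; rewrite E eqxx in dc.
  by rewrite !qp !mulr0 !addr0 add0r.
exists (zs c i); rewrite (e_zs H).
have -> : t (zs c i) = 1 by rewrite /hzs (h_tC H) (h_pv H) (h_tz H).
exact: oner_neq0.
Qed.

End HubStructure.

Lemma neq_negb (b c : bool) : b != c -> b = ~~ c.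
Proof. by case: b; case: c. Qed.

Section HubStructure.
Variables (K : fieldType) (A : algType K) (I : finType) (nx : I -> I) (mu : K).
Variables (e : hvertex I -> A) (p q : bool -> I -> A) (t : A -> K).
Hypothesis H : hub_algebra nx mu e p q t.
Implicit Types (M N V W : rmodType A).

Local Notation D := (hD mu p q).
Local Notation Z := (hZ p q).
Local Notation zs := (hzs nx p q).
Local Notation z := (hz nx p q).
Local Notation u := (hu nx p q).
Local Notation Pm := (Pm e).
Local Notation Um := (Um nx e q).
Local Notation noqp := (noqp nx p q).
Local Notation good := (good nx e p q).

Variables (S : I -> rmodType A) (s : forall i, S i).
Hypothesis hS : forall i, simple_module_at e p q (hub i) (s i).

Local Notation theta := (htheta mu).

(** The first condition supplies [m] with [m ∙ p c i = n], killed by [p (~~ c) i], so that [U] maps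
    to [N] by sending its generator [hD (~~ c) (nx i)] to [m]. The second condition supplies a
    linear form on [N] that gives the map back. *)
Lemma split_U N (n : N) c i : fin_dim N -> noqp N -> good N -> n != 0 ->
  n ∙ e (spoke c i) = n -> nonzero_retract (Um (~~ c) i) N.
Proof.
move=> Nf h [g1 g2 _ _] n0 ne.
have [m0 [m0c m0c']] : exists m, m ∙ p c i = n /\ m ∙ p (~~ c) i = 0.
  have z0 d : (0 : N) ∙ e (spoke d i) = 0 by rewrite ract0l.
  case: c ne => ne; first by apply: (g1 h).
  by have [m [m1 m2]] := g1 h i 0 n (z0 true) ne; exists m.
pose m := m0 ∙ e (hub i).
have me : m ∙ e (hub i) = m by rewrite /m -ractM (h_idem H) eqxx.
have mc : m ∙ p c i = n by rewrite /m -ractM (h_srcp H).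
have mc' : m ∙ p (~~ c) i = 0 by rewrite /m -ractM (h_srcp H).
have mZ : m ∙ Z c i = n ∙ q c i by rewrite /hZ ractM mc.
have mZ' : m ∙ Z (~~ c) i = 0 by rewrite /hZ ractM mc' ract0l.
have mu0 d : m ∙ u d i = 0 by rewrite /hu /hZ !ractM h.
have mz0 : m ∙ z i = 0 by rewrite /hz /hZ !mulrA ractM !ractM h ract0l.
(* [phi] has to vanish on [m] because the generator of [U] has trace 0, and on the multiples by
   [q (~~ c) i] so that the map it defines lands in [U]. *)
pose X x := exists a n', x = (kscale a m + n' ∙ q (~~ c) i) ∙ e (hub (nx i)).
have [||||phi [phiL phi1 phiX phie]] :=
    @separating_form_at _ _ _ _ _ _ _ _ _ H N (hub (nx i)) X (n ∙ q c i) Nf.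
- split.
    by exists 0, 0; rewrite !kscale0 ract0l addr0 ract0l.
  move=> k x y [a [b ->]] [a' [b' ->]]; exists (k * a + a'), (kscale k b + b').
  rewrite -ractZl -ractDl; congr (_ ∙ _).
  by rewrite !kscaleDr !kscaleDl !kscaleA ractDl ractZl addrACA.
- move=> x [a [b ->]]; exists a, b.
  by rewrite -[in LHS]ractM (h_idem H) eqxx.
- by rewrite -ractM (h_tgtq H).
- move=> [a [n' E]].
  have nq0 : n ∙ q c i <> n' ∙ q (~~ c) i.
    rewrite -(h_srcq H (~~ c)) ractM.
    have n'e : n' ∙ e (spoke (~~ c) i) ∙ e (spoke (~~ c) i) = n' ∙ e (spoke (~~ c) i).
      by rewrite -ractM (h_idem H) eqxx.
    case: c ne n'e {mc mc' mZ mZ' X E m0c m0c'} => ne n'e E; case/eqP: n0.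
      by have [] := g2 h i _ _ ne n'e E.
    by have [] := g2 h i _ _ n'e ne (esym E).
  have E1 : n ∙ q c i = kscale a (m ∙ e (hub (nx i))) + n' ∙ q (~~ c) i.
    by rewrite E ractDl ractZl -[n' ∙ _ ∙ _]ractM (h_tgtq H).
  have [ii|ne_i] := eqVneq (nx i) i; last first.
    apply: nq0; rewrite E1 /m -ractM (h_idem H).
    have -> : (hub i == hub (nx i)) = false by apply/eqP => -[E']; rewrite -E' eqxx in ne_i.
    by rewrite ract0r kscaler0 add0r.
  have [a0|a0] := eqVneq a 0; first by apply: nq0; rewrite E1 a0 kscale0 add0r.
  case/eqP: n0; apply: (kscale_inj a0).
  have := congr1 (fun x => x ∙ p c (nx i)) E1.
  by rewrite h ractDl h addr0 ractZl ii me mc => <-.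
have phim : phi m = 0.
  by rewrite -phie; apply: phiX; exists 1, 0; rewrite ract0l addr0 kscale1.
have phiq n' : phi (n' ∙ q (~~ c) i) = 0.
  apply: phiX; exists 0, n'.
  by rewrite kscale0 add0r -ractM (h_tgtq H).
have phin : phi n = 0.
  rewrite -phie -ne -ractM (h_idem H) /= ract0r; exact: kform0.
(* The factor is the trace of [hD (~~ c)] times [Z_c]; it makes the map send [m] to the generator of
   [U] itself. *)
pose psi x := theta (~~ c) * phi x.
have psiL : kform psi by move=> k x y; rewrite /psi phiL mulrDr mulrCA.
have psie x : psi (x ∙ e (hub (nx i))) = psi x by rewrite /psi phie.
have [f0 f0E] := form_map_at H psiL psie.
have [f1 f1E] := aval_linear (e (hub (nx i))) 0.
have [||f fE] := @linear_to_annihilator _ _ N (e (hub (nx i))) (q (~~ c) i) (f1 \o f0).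
- by move=> x; rewrite /= f1E (PmP (f0 x)).
- move=> x; rewrite /= f1E; apply: (trace_separates H) => a.
  by rewrite -mulrA (h_tC H) -mulrA f0E ractM /psi phiq mulr0.
have {}fE x : aval (f x) = aval (f0 x) by rewrite fE /= f1E.
have fm : aval (f m) = D (~~ c) (nx i).
  apply/eqP; rewrite -subr_eq0; apply/eqP/(trace_separates H) => a.
  rewrite mulrBl -scaleN1r addrC (h_tP H) fE f0E -me -ractM.
  have De : D (~~ c) (nx i) * e (hub i) = D (~~ c) (nx i).
    by have := hD_e H (~~ c) (nx i); rewrite (nxK H).
  rewrite -De -mulrA.
  have := coordinates H (hub i) a => -[c0 [cc [k [l [c4 ->]]]]].
  rewrite (hD_hubc H) (t_hubc H) (kform_hubc _ _ _ _ _ _ _ _ _ _ _ psiL) me.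
  have pn : psi n = 0 by rewrite /psi phin mulr0.
  have p0 : psi 0 = 0 by apply: kform0.
  have pc d : psi (m ∙ p d i) = 0.
    have [->|dc] := eqVneq d c; first by rewrite mc.
    by rewrite (neq_negb dc) mc'.
  have pZ : psi (m ∙ Z c i) = theta (~~ c) by rewrite mZ /psi phi1 mulr1.
  have pZ' : psi (m ∙ Z (~~ c) i) = 0 by rewrite mZ' p0.
  rewrite !pc !mu0 mz0 p0 {1}/psi phim !mulr0 !addr0 add0r negbK mulN1r.
  case: (c) pZ pZ' => /= -> ->; rewrite mulr0 ?addr0 ?add0r mulrC; exact: addNr.
have [F [B [E [j [Q [[FE BE EE jE QE] [exQ exF exB Es exj]]]]]]] := spoke_complex H (~~ c) i.
have [g0 g0E] := linear_act (e (hub i)) 0 m.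
have [|g gE] := linear_factor_surj (f := g0) Es.
  by move=> x /exB[y <-]; rewrite g0E BE ractM mc' ract0l.
exists g, f; split.
  move=> w; have [x <-] := Es w; apply: aval_inj.
  by rewrite gE g0E EE linear_ract aval_act fm.
exists n; apply/eqP => fn.
have : psi (n ∙ q c i) = 0 by rewrite -f0E -fE fn aval0 mul0r (t0 H).
rewrite /psi phi1 mulr1 => /eqP; apply/negP; exact: (htheta_neq0 H).
Qed.

Lemma split_S N (n : N) i : fin_dim N ->
  (forall c j (x : N), x ∙ e (spoke c j) = 0) -> n ∙ e (hub i) != 0 ->
  nonzero_retract (S i) N.
Proof.
move=> Nf spoke0 n0'.
wlog ne : n n0' / n ∙ e (hub i) = n.
  move=> h; have nee : n ∙ e (hub i) ∙ e (hub i) = n ∙ e (hub i).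
    by rewrite -ractM (h_idem H) eqxx.
  by apply: (h _ _ nee); rewrite nee.
have n0 : n != 0 by rewrite -ne.
have xp c j (x : N) : x ∙ p c j = 0 by rewrite -(h_tgtp H) ractM spoke0.
have xq c j (x : N) : x ∙ q c j = 0 by rewrite -(h_srcq H) ractM spoke0 ract0l.
have [||||phi [phiL phi1 _ phie]] :=
    @separating_form_at _ _ _ _ _ _ _ _ _ H N (hub i) (fun x => x = 0) n Nf.
- by split=> // k x y -> ->; rewrite kscaler0 addr0.
- by move=> x ->; rewrite ract0l.
- exact: ne.
- by apply/eqP.
have [s0 sspan se sarr] := hS i.
have [||f fE] := @linear_of_ract _ _ N (S i) (fun x => kscale (phi x) (s i)).
- by move=> x y; rewrite (kformD _ _ phiL) kscaleDl.
- move=> x a; rewrite ractZl; move: a x; apply: (h_gen H).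
  + by move=> x; rewrite !ract1.
  + move=> a b IHa IHb x; rewrite !ractDr (kformD _ _ phiL) kscaleDl IHa IHb.
    by rewrite kscaleDr.
  + move=> k a IHa x; rewrite !ractZr (kformZ _ _ phiL) -kscaleA IHa.
    by rewrite !kscaleA mulrC.
  + move=> v a IHa x; rewrite ractM IHa ractM -phie -ractM (h_idem H).
    case: eqP => [->|/eqP ve]; first by rewrite phie se.
    rewrite ract0r (kform0 phiL) kscale0 -{1}se -[s i ∙ _ ∙ e v]ractM (h_idem H) eq_sym.
    by rewrite (negPf ve) ract0r ract0l kscaler0.
  + move=> c j a _ x; rewrite !ractM xp (proj1 (sarr _ _)) !ract0l.
    by rewrite (kform0 phiL) kscale0 kscaler0.
  + move=> c j a _ x; rewrite !ractM xq (proj2 (sarr _ _)) !ract0l.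
    by rewrite (kform0 phiL) kscale0 kscaler0.
have [Y [k [YE Ys Yker _ _]]] := simple_hub H (hS i).
have [g0 g0E] := linear_act (e (hub i)) 0 n.
have [|g gE] := linear_factor_surj (f := g0) Ys.
  by move=> x /Yker[y yE]; rewrite g0E yE /tau ractDr !ractM !xp !ract0l addr0.
exists g, f; split.
  move=> w; have [a ->] := sspan w; have [y yE] := Pm_e H (hub i).
  have -> : s i = Y y by rewrite YE yE se.
  rewrite !linear_kscale gE g0E yE ne fE phi1 kscale1 YE yE se //.
by exists n; rewrite fE phi1 kscale1.
Qed.

(** By the third condition a vector at a spoke is [m ∙ p c i], so [q p] applied to it is a path of
    length 3 applied to [m]. One more [q] reaches the socle, which acts as zero, so the fourth
    condition writes the result as a multiple of [hzs], which acts as zero too. *)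
Lemma noqp_of_good N : good N -> (forall i (n : N), n ∙ z i = 0) ->
  (forall c i (n : N), n ∙ zs c i = 0) -> noqp N.
Proof.
move=> [_ _ g3 g4] z0 zs0 n c d i.
pose x := n ∙ e (spoke c i).
have xe : x ∙ e (spoke c i) = x by rewrite /x -ractM (h_idem H) eqxx.
have [m mE] := g3 c i x xe (zs0 _ _ _).
have -> : n ∙ q c i = m ∙ Z c i by rewrite /hZ ractM -mE /x -ractM (h_srcq H).
pose y := m ∙ Z c i ∙ p d (nx i).
have ye : y ∙ e (spoke d (nx i)) = y by rewrite /y -ractM (h_tgtp H).
have yq : y ∙ q d (nx i) = 0.
  by rewrite /y -(ractM m) (h_Zp H) ractZr ractZl -ractM (h_uq H) z0 kscaler0.
have [m' yE] := g4 d (nx i) y ye yq.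
by rewrite -[LHS]/y yE zs0.
Qed.

(** [good] is not visibly inherited by summands, since two of its clauses assume [noqp]. The
    induction therefore carries a property [T] that is inherited and implies it; in the application
    [T] includes the vanishing of Ext on one side. *)
Lemma add_closure_of_good M (T : rmodType A -> Prop) :
  (forall N N', retract N' N -> T N -> T N') ->
  (forall N, T N -> fin_dim N) -> (forall N, T N -> good N) ->
  (forall v, add_closure M (Pm v)) -> (forall c i, add_closure M (Um c i)) ->
  (forall i, add_closure M (S i)) -> forall N, T N -> add_closure M N.
Proof.
move=> Tr Tf Tg MP MU MS N TN.
have [k [b bs]] := Tf _ TN.
have [k' ltk] := ubnP k; elim: k' N k b bs ltk TN => // k' IH N k b bs ltk TN.
have Nf : fin_dim N by exists k, b.
have step W : add_closure M W -> nonzero_retract W N -> add_closure M N.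
  move=> MW [c [c' [cK [n n0]]]].
  have [N' [g [g' [cg gK gc cgE]]]] := retract_complement cK.
  have w0 : c (c' n) != 0.
    by apply/eqP => /(congr1 c'); rewrite cK raddf0; apply/eqP.
  have [|m [d [ltm ds]]] := spans_quotient bs (p := g') _ w0 (gc _).
    by move=> x; exists (g x).
  have MN' : add_closure M N'.
    apply: (IH N' m d ds); first exact: leq_trans ltm ltk.
    by apply: Tr TN; exists g, g'.
  apply: (add_closure_retract (N' := (W * N')%type)); last exact: add_closure_prod.
  have [f fE] := linear_pair c' g'; have [h hE] := linear_copair c g.
  by exists f, h => x; rewrite hE fE /= cgE.
have [[i [n n0]]|nz] := pselect (exists i (n : N), n ∙ z i != 0).
  exact: (step _ (MP _) (split_hub H Nf n0)).
have [[c [i [n n0]]]|nzs] := pselect (exists c i (n : N), n ∙ zs c i != 0).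
  exact: (step _ (MP _) (split_spoke H Nf n0)).
have h : noqp N.
  apply: noqp_of_good (Tg _ TN) _ _ => [i n|c i n]; apply/eqP; apply/negP => /negP n0.
    by apply: nz; exists i, n.
  by apply: nzs; exists c, i, n.
have [[c [i [n n0]]]|ns] := pselect (exists c i (n : N), n ∙ e (spoke c i) != 0).
  apply: (step _ (MU (~~ c) i) (split_U Nf h (Tg _ TN) n0 _)).
  by rewrite -ractM (h_idem H) eqxx.
have spoke0 c i (n : N) : n ∙ e (spoke c i) = 0.
  by apply/eqP; apply/negP => /negP n0; apply: ns; exists c, i, n.
have [[i [n n0]]|nh] := pselect (exists i (n : N), n ∙ e (hub i) != 0).
  exact: (step _ (MS i) (split_S Nf spoke0 n0)).
exists 0%N, \0, \0 => x /=; rewrite -[x]ract1 -(h_one H) ract_sumr big1 // => -[i|[c i]] _.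
  by apply/eqP; apply/negP => /negP n0; apply: nh; exists i, x.
exact: spoke0.
Qed.

(** For such a target Ext vanishes for a crude reason: in degree 1 every map is a coboundary, and in
    degree 2 only the zero map is a cocycle. The hub simples and the modules [U] are nice, which
    settles Ext between the summands of the candidate. *)
Definition nice W :=
  (forall i (nt nf : W), nt ∙ e (spoke true i) = nt -> nf ∙ e (spoke false i) = nf ->
     exists m, m ∙ p true i = nt /\ m ∙ p false i = nf) /\
  (forall i (nt nf : W), nt ∙ e (spoke true i) = nt -> nf ∙ e (spoke false i) = nf ->
     nt ∙ q true i + nf ∙ q false i = 0 -> nt = 0 /\ nf = 0).

Lemma nice_p W c i (n : W) : nice W -> n ∙ e (spoke c i) = n -> exists m, m ∙ p c i = n.
Proof.
move=> [h _] ne; have z0 d : (0 : W) ∙ e (spoke d i) = 0 by rewrite ract0l.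
by case: c ne => ne; [have [m [? ?]] := h i n 0 ne (z0 _)
  |have [m [? ?]] := h i 0 n (z0 _) ne]; exists m.
Qed.

Lemma nice_q W c i (n : W) : nice W -> n ∙ e (spoke c i) = n -> n ∙ q c i = 0 -> n = 0.
Proof.
move=> [_ h] ne; have z0 d : (0 : W) ∙ e (spoke d i) = 0 by rewrite ract0l.
case: c ne => ne nq.
  by have [] := h i n 0 ne (z0 _); rewrite // nq ract0l addr0.
by have [] := h i 0 n (z0 _) ne; rewrite // nq ract0l addr0.
Qed.

Lemma ext12_zero_simple W i : nice W -> ext12_zero (S i) W.
Proof.
move=> nW; have [Y [T [Ys exT TE]]] := simple_presentation H hS i.
have [R [G [T' [RE GE T'E exR exG]]]] := hub_complex H i.
have TT x : T x = T' x by apply: aval_inj; rewrite TE T'E.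
split.
  apply: (ext1_zero_pres (stable_retract_refl _) (Pm_projective H _) Ys exT) => f _.
  have [nt [nf [ntE nfE fE]]] := Jm_mapE H f.
  have [m [mt mf]] := proj1 nW i nt nf ntE nfE.
  have [k kE] := linear_act (e (hub i)) 0 m.
  by exists k => x; rewrite fE kE TE /tau ractDr !ractM mt mf.
have exG' : exact_at G T by move=> x; rewrite TT; apply: exG.
apply: (ext2_zero_pres (Pm_projective H _) Ys exT (Jm_projective H _) exG') => f fG.
have [nt [nf [ntE nfE fE]]] := Jm_mapE H f.
have [y yE] := Pm_e H (hub i).
have : f (R y) = 0 by apply: fG; apply: (proj2 (exR _)); exists y.
rewrite fE -[aval _]/(jval (R y) true) -[aval _.2]/(jval (R y) false) !RE yE !(q_eK H).
move=> /(proj2 nW (nx i) nt nf ntE nfE)[nt0 nf0].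
by exists \0 => x; rewrite fE nt0 nf0 !ract0l addr0.
Qed.

Lemma ext12_zero_U W c i : nice W -> ext12_zero (Um c i) W.
Proof.
move=> nW.
have [F [B [E [j [Q [[FE BE EE jE QE] [exQ exF exB Es exj]]]]]]] := spoke_complex H c i.
split.
  apply: (ext1_zero_pres (stable_retract_refl _) (Pm_projective H _) Es exB) => f _.
  have [n [nE fE]] := Pm_mapE H f; have [m mE] := nice_p nW nE.
  have [k kE] := linear_act (e (hub i)) 0 m.
  by exists k => x; rewrite fE kE BE ractM mE.
apply: (ext2_zero_pres (Pm_projective H _) Es exB (Pm_projective H _) exF) => f fF.
have [n [nE fE]] := Pm_mapE H f.
have [y yE] := Pm_e H (hub (nx i)).
have : f (Q y) = 0 by apply: fF; apply: (proj2 (exQ _)); exists y.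
rewrite fE QE yE (h_tgtq H) => /(nice_q nW nE) n0.
by exists \0 => x; rewrite fE n0 ract0l.
Qed.

Lemma nice_simple i : nice (S i).
Proof.
have [s0 sspan se sarr] := hS i.
have z0 c j (n : S i) : n ∙ e (spoke c j) = n -> n = 0.
  move=> <-; have [a ->] := sspan n.
  by rewrite ractZl -se -ractM (h_idem H) /= ract0r kscaler0.
split=> j nt nf /z0 -> /z0 ->; last by [].
by exists 0; rewrite !ract0l.
Qed.

(** [U d j] is uniserial, with basis its generator [hD], the product of the generator with
    [p (~~ d) j], and the socle. Its spoke part is thus a line at the single spoke [(~~ d, j)]. *)
Lemma U_spoke d j c i (n : Um d j) : n ∙ e (spoke c i) = n ->
  exists2 a, aval n = a *: (D d (nx j) * p (~~ d) j) & n != 0 -> c = ~~ d /\ i = j.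
Proof.
move=> ne.
have [F [B [E [jj [Q [[FE BE EE jE QE] [exQ exF exB Es exj]]]]]]] := spoke_complex H d j.
have [y yE] := Es n.
have := hub_coordinates H (PmP y) => -[c0 [cc [k [l [c4 yc]]]]].
have nD : aval n = D d (nx j) * (aval y * e (spoke c i)).
  by rewrite mulrA -EE yE -aval_act ne.
have Dp b : D d (nx j) * p b j = if d == b then 0 else D d (nx j) * p (~~ d) j.
  case: eqP => [<-|/eqP]; first exact: (hD_p H).
  by rewrite eq_sym => /neq_negb ->.
have Du b : D d (nx j) * u b j = 0.
  rewrite /hD mulrDl -!scalerAl /hu /hZ -!mulrA.
  have h c1 : q c1 (nx j) * (p true j * (q true j * p b (nx j))) = (if c1 == b then zs c1 (nx j) else 0).
    by have := h_qu H c1 b (nx j); rewrite /hu /hZ (nxK H) -!mulrA.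
  rewrite !h; case: b {h} => /=; rewrite (h_pzs H) !mulr0 !scaler0 addr0 //.
have DX : aval n = (if spoke c i == spoke (~~ d) j then cc (~~ d) else 0) *: (D d (nx j) * p (~~ d) j).
  have Ze b : Z b j * e (spoke c i) = 0 by rewrite /hZ -mulrA (qe H) mulr0.
  have ze : z j * e (spoke c i) = 0.
    by rewrite /hz [Z true (nx j)]/hZ -!mulrA (qe H) !mulr0.
  have De b : D d (nx j) * (p b j * e (spoke c i)) =
      if (d != b) && (spoke c i == spoke b j) then D d (nx j) * p (~~ d) j else 0.
    rewrite (pe H); case: ifP; rewrite ?andbF ?mulr0 // andbT => _.
    by rewrite Dp; case: eqP.
  move: nD De Du; move: (D d (nx j)) => DD -> De Du.
  rewrite yc /hubc !mulrDl -!scalerAl (h_idem H) !Ze ze /=.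
  rewrite !scaler0 !addr0 add0r !mulrDr -!scalerAr !(mulrA DD (u _ _)) !Du.
  rewrite !mul0r !scaler0 !addr0 !De.
  by case: (d) => /=; case: ifP; rewrite ?scaler0 ?scale0r ?add0r ?addr0.
exists (if spoke c i == spoke (~~ d) j then cc (~~ d) else 0) => // n0.
move: DX; case: eqP => [[-> ->] //|_]; rewrite scale0r => DX.
by case/eqP: n0; apply: aval_inj; rewrite DX.
Qed.

Lemma nice_U d j : nice (Um d j).
Proof.
have z0 i (n : Um d j) : n ∙ e (spoke d i) = n -> n = 0.
  move=> /U_spoke[a _ h]; apply/eqP; apply/negP => /negP /h[].
  by case: (d).
have DZ : t (D d (nx j) * p (~~ d) j * q (~~ d) j) = theta d.
  rewrite -mulrA -/(Z (~~ d) j) /hD mulrDl -!scalerAl.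
  have h b : Z b (nx j) * Z (~~ d) j = hgram mu b (~~ d) *: z (nx j).
    by have := hZ_Z H b (~~ d) (nx j); rewrite (nxK H).
  by rewrite !h (tD H) !(tZ H) (h_tz H) /htheta; congr (_ * _ + _ * _); apply: mulr1.
have th : theta d != 0 by apply: (htheta_neq0 H).
have q0 i (n : Um d j) : n ∙ e (spoke (~~ d) i) = n -> n ∙ q (~~ d) i = 0 -> n = 0.
  move=> ne nq; apply/eqP; apply/negP => /negP n0.
  have [a aE h] := U_spoke ne; have [_ ij] := h n0.
  have := congr1 (fun x => t (aval x)) nq; rewrite aval_act aE ij -scalerAl (tZ H) DZ.
  rewrite (t0 H) => /eqP; rewrite mulf_eq0 (negPf th) orbF => /eqP a0.
  by case/eqP: n0; apply: aval_inj; rewrite aE a0 scale0r.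
have p0 i (n : Um d j) : n ∙ e (spoke (~~ d) i) = n ->
    exists m : Um d j, m ∙ p (~~ d) i = n /\ m ∙ p d i = 0.
  move=> ne; have [n0|n0] := eqVneq n 0.
    by exists 0; rewrite !ract0l n0.
  have [a aE h] := U_spoke ne; have [_ ij] := h n0.
  have [||m mE] := @exists_aval _ _ (e (hub (nx j))) (q d j) (a *: D d (nx j)).
  - by rewrite -scalerAr (e_hD H).
  - by rewrite -scalerAr (q_hD H) scaler0.
  exists m; split; apply: aval_inj; rewrite aval_act mE ij -scalerAl ?aE //.
  by rewrite (hD_p H) scaler0.
have zc c i (n : Um d j) : c = d -> n ∙ e (spoke c i) = n -> n = 0 by move=> ->; apply: z0.
have qc c i (n : Um d j) : c = ~~ d -> n ∙ e (spoke c i) = n -> n ∙ q c i = 0 -> n = 0.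
  by move=> ->; apply: q0.
have pc c i (n : Um d j) : c = ~~ d -> n ∙ e (spoke c i) = n ->
    exists m : Um d j, m ∙ p c i = n /\ m ∙ p (~~ c) i = 0.
  by move=> ->; rewrite negbK; apply: p0.
(* [d] occurs in the type of the vectors, so the two cases are taken as equations. *)
have [Ed|Ed] : true = d \/ false = d by case: (d); [left|right].
  have Ed' : false = ~~ d by rewrite -Ed.
  split=> i nt nf /(zc _ _ _ Ed) -> nfE; first by have [m [? ?]] := pc _ _ _ Ed' nfE; exists m.
  by rewrite ract0l add0r => /(qc _ _ _ Ed' nfE).
have Ed' : true = ~~ d by rewrite -Ed.
split=> i nt nf ntE /(zc _ _ _ Ed) ->; first by have [m [? ?]] := pc _ _ _ Ed' ntE; exists m.
by rewrite ract0l addr0 => /(qc _ _ _ Ed' ntE).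
Qed.

End HubStructure.

(** * The cluster tilting module of a hub algebra *)

Section HubStructure.
Variables (K : fieldType) (A : algType K) (I : finType) (nx : I -> I) (mu : K).
Variables (e : hvertex I -> A) (p q : bool -> I -> A) (t : A -> K).
Hypothesis H : hub_algebra nx mu e p q t.
Implicit Types (M N V W : rmodType A).

Local Notation D := (hD mu p q).
Local Notation Z := (hZ p q).
Local Notation zs := (hzs nx p q).
Local Notation z := (hz nx p q).
Local Notation u := (hu nx p q).
Local Notation Pm := (Pm e).
Local Notation Um := (Um nx e q).

(** Together with [radical] below, a substitute for the powers of the Jacobson radical: [a] is
    annihilated from the left by all products of [n] arrows. *)
Fixpoint kills n (a : A) : Prop :=
  if n is n'.+1 then forall c i, kills n' (p c i * a) /\ kills n' (q c i * a) else a = 0.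

Lemma killsI n a : (forall c i, kills n (p c i * a) /\ kills n (q c i * a)) -> kills n.+1 a.
Proof. by []. Qed.

Lemma kills0 n : kills n 0.
Proof. by elim: n => [//|n IH] c i; rewrite !mulr0. Qed.

Lemma killsD n a b : kills n a -> kills n b -> kills n (a + b).
Proof.
elim: n a b => [|n IH] a b; first by move=> /= -> ->; rewrite addr0.
move=> ha hb c i; have [pa qa] := ha c i; have [pb qb] := hb c i.
by rewrite !mulrDr; split; apply: IH.
Qed.

Lemma killsZ n k a : kills n a -> kills n (k *: a).
Proof.
elim: n a => [|n IH] a; first by move=> /= ->; rewrite scaler0.
by move=> ha c i; have [pa qa] := ha c i; rewrite -!scalerAr; split; apply: IH.
Qed.

Lemma killsS n a : kills n a -> kills n.+1 a.
Proof.
elim: n a => [|n IH] a; first by move=> /= -> c i; rewrite !mulr0.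
by move=> ha c i; have [pa qa] := ha c i; split; apply: IH.
Qed.

Lemma kills_e n v a : kills n a -> kills n (e v * a).
Proof.
case: n => [|n]; first by move=> /= ->; rewrite mulr0.
move=> ha c i; have [pa qa] := ha c i; rewrite !mulrA (pe H) (qe H).
by split; case: ifP; rewrite ?mul0r //; move=> _; apply: kills0.
Qed.

Lemma kills_mul n b a : kills n a -> kills n (b * a).
Proof.
move=> ha; move: b; apply: (h_gen H) => [|x y hx hy|k x hx|v x hx|c i x hx|c i x hx].
- by rewrite mul1r.
- by rewrite mulrDl; apply: killsD.
- by rewrite -scalerAl; apply: killsZ.
- by rewrite -mulrA; apply: kills_e.
- by rewrite -mulrA; have [] := killsS hx c i.
- by rewrite -mulrA; have [] := killsS hx c i.
Qed.

Lemma p_hub0 c j i x : e (hub i) * x = x -> p c j * x = 0.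
Proof. by move=> <-; rewrite mulrA (pe H) mul0r. Qed.

Lemma q_spoke0 c j d i x : e (spoke d i) * x = x -> q c j * x = 0.
Proof. by move=> <-; rewrite mulrA (qe H) mul0r. Qed.

Lemma p_spokeP (P : A -> Prop) c j d i x : e (spoke d i) * x = x -> P 0 ->
  P (p d i * x) -> P (p c j * x).
Proof.
move=> ex P0 Pd; have [[-> ->] //|ne] := eqVneq (c, j) (d, i).
rewrite -ex mulrA (pe H); case: eqP => [[E1 E2]|_]; last by rewrite mul0r.
by rewrite E1 E2 eqxx in ne.
Qed.

Lemma q_hubP (P : A -> Prop) c j i x : e (hub i) * x = x -> P 0 ->
  (nx j = i -> P (q c j * x)) -> P (q c j * x).
Proof.
move=> ex P0 Pd; have [E|ne] := eqVneq (nx j) i; first exact: Pd.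
rewrite -ex mulrA (qe H); case: eqP => [[E]|_]; last by rewrite mul0r.
by rewrite E eqxx in ne.
Qed.

(** A normal-form word of length [l] is killed by [5 - l] further arrows on the left; the bounds are
    obtained from the socle upwards. *)
Lemma kills_one : kills 5 1.
Proof.
have eh i x y : e (hub i) * x = x -> e (hub i) * (x * y) = x * y.
  by move=> E; rewrite mulrA E.
have es c i x y : e (spoke c i) * x = x -> e (spoke c i) * (x * y) = x * y.
  by move=> E; rewrite mulrA E.
have eZ c i : e (hub i) * Z c i = Z c i by apply/eh/(h_srcp H).
have eu c i : e (hub i) * u c i = u c i by apply/eh/eZ.
have ev c i : e (spoke c i) * hv nx p q c i = hv nx p q c i by apply/es/(h_srcq H).
have k_zs c i : kills 1 (zs c i).
  move=> d j; split; last exact: q_spoke0 (e_zs H c i).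
  by apply: (@p_spokeP (kills 0) _ _ _ _ _ (e_zs H c i)) => //=; apply: (h_pzs H).
have k_u c i : kills 2 (u c i).
  move=> d j; split; first by rewrite (p_hub0 _ _ (eu c i)); apply: kills0.
  apply: (@q_hubP (kills 1) _ _ _ _ (eu c i)) => [|<-]; first exact: kills0.
  by rewrite (h_qu H); case: eqP => _; [apply: k_zs|apply: kills0].
have k_z i : kills 1 (z i).
  by move=> d j; split; [apply: p_hub0 (e_z H i)|apply: (q_z H)].
have k_v c i : kills 2 (hv nx p q c i).
  move=> d j; split; last by rewrite (q_spoke0 _ _ (ev c i)); apply: kills0.
  apply: (@p_spokeP (kills 1) _ _ _ _ _ (ev c i)); first exact: kills0.
  by rewrite (h_pv H); apply: k_z.
have k_Z c i : kills 3 (Z c i).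
  move=> d j; split; first by rewrite (p_hub0 _ _ (eZ c i)); apply: kills0.
  apply: (@q_hubP (kills 2) _ _ _ _ (eZ c i)) => [|<-]; first exact: kills0.
  by rewrite (h_qZ H); apply/killsZ/k_v.
have k_qp c d j : kills 3 (q c j * p d (nx j)).
  have E : e (spoke c j) * (q c j * p d (nx j)) = q c j * p d (nx j) by apply/es/(h_srcq H).
  move=> d' j'; split; last by rewrite (q_spoke0 _ _ E); apply: kills0.
  apply: (@p_spokeP (kills 2) _ _ _ _ _ E); first exact: kills0.
  by rewrite mulrA -/(Z c j) (h_Zp H); apply/killsZ/k_u.
apply: killsI => c i; rewrite !mulr1; split; apply: killsI => d j; split.
- by rewrite (pp H); apply: kills0.
- apply: (@q_hubP (kills 3) _ _ _ _ (h_srcp H c i)) => [|<-]; first exact: kills0.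
  exact: k_qp.
- apply: (@p_spokeP (kills 3) _ _ _ _ _ (h_srcq H c i)); first exact: kills0.
  exact: k_Z.
by rewrite (qq H); apply: kills0.
Qed.

Definition radical x := forall n a, kills n.+1 a -> kills n (x * a).

Lemma radical_q c i y : radical (q c i * y).
Proof. by move=> n a ka; rewrite -mulrA; have [] := kills_mul y ka c i. Qed.

Lemma radical_hD c i y : radical (D c i * y).
Proof.
move=> n a ka; rewrite /hD mulrDl mulrDl -!scalerAl /hZ -!mulrA.
have h d j : kills n (p d j * (q d j * (y * a))).
  by apply: kills_mul; have [] := kills_mul y ka d j.
by apply: killsD; apply: killsZ; apply: h.
Qed.

(** Nakayama's argument: with the generator written as [x + y], [x] in the kernel, [p0 ∙ a] differs
    from [y ∙ a] by a vector whose coefficient is killed by one arrow fewer. *)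
Lemma superfluous_radical v V (f : {linear Pm v -> V}) :
  (forall x, f x = 0 -> radical (aval x)) -> superfluous (fun x => f x = 0).
Proof.
move=> frad Y [Y0 YD] YP; have [p0 p0E] := Pm_e H v.
have p0K (w : Pm v) : w = p0 ∙ aval w by apply: aval_inj; rewrite aval_act p0E PmP.
have [x [y [fx yY xy]]] := YP p0.
have act_Y (w : Pm v) a : w \in Y -> w ∙ a \in Y.
  by move=> wY; rewrite -[w ∙ a]addr0; apply: YD.
have key n a : kills n a -> p0 ∙ a \in Y.
  elim: n a => [|n IH] a ka; first by rewrite (ka : a = 0) ract0r.
  have -> : p0 ∙ a = y ∙ a + x ∙ a by rewrite -ractDl addrC -xy.
  have xaY : x ∙ a \in Y.
    by rewrite [x ∙ a]p0K aval_act; apply: IH; apply: (frad x fx).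
  by rewrite -[y ∙ a]ract1; apply: YD => //; apply: act_Y.
by move=> w; rewrite [w]p0K; apply: (key 5); rewrite -[aval w]mulr1; apply/kills_mul/kills_one.
Qed.

(** The radical of the projective at the spoke is the kernel of [hzs]. It is generated by [q c i],
    hence covered by the projective at the hub [nx i], with kernel [Um c i]. *)
Lemma syzygy2_spoke c i (S0 : rmodType A) (s0 : S0) (Om : rmodType A) :
  simple_module_at e p q (spoke c i) s0 -> is_syzygy2 S0 Om -> rmod_iso Om (Um c i).
Proof.
move=> hS0 [U [SU UO]].
have [Y [YE Ys Yker]] := simple_spoke H hS0.
pose W := annihilator (e (spoke c i)) (zs c i).
have SW : is_syzygy S0 W.
  have [||j jE] := @linear_lmul _ _ (e (spoke c i)) (zs c i) (e (spoke c i)) 0 1.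
  - by move=> x; rewrite mul1r; have [] := avalP x.
  - by move=> x; rewrite mul0r.
  exists (Pm (spoke c i)), Y, j; split.
  - split=> //; first exact: Pm_projective H _.
    apply: superfluous_radical => x /Yker x0.
    have [y _ ->] := zs_ker H (PmP x) x0; exact: radical_q.
  - by move=> x y /(congr1 (@aval _ _ _ _)); rewrite !jE !mul1r => /aval_inj.
  move=> x; rewrite Yker; split=> [x0|[y <-]]; last first.
    by rewrite jE mul1r; have [] := avalP y.
  have [y yE] := exists_aval (PmP x) x0.
  by exists y; apply: aval_inj; rewrite jE mul1r yE.
have WU : is_syzygy W (Um c i).
  have [F [B [E [j [Q [[FE BE EE jE QE] [exQ exF exB Es exj]]]]]]] := spoke_complex H c i.
  have [||Q' Q'E] := @linear_lmul _ _ (e (hub (nx i))) 0 (e (spoke c i)) (zs c i) (q c i).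
  - by move=> x; rewrite mulrA (h_srcq H).
  - by move=> x; rewrite mulrA (h_zsq H) mul0r.
  have QQ x : Q' x = 0 <-> Q x = 0.
    by split=> x0; apply: aval_inj; rewrite ?QE -?Q'E ?x0 // Q'E -QE x0.
  exists (Pm (hub (nx i))), Q', j; split.
  - split; first exact: Pm_projective H _.
      move=> x; have [xe xz] := avalP x.
      have [y ye yE] := zs_ker H xe xz.
      by have [y' y'E] := exists_Pm ye; exists y'; apply: aval_inj; rewrite Q'E y'E yE.
    apply: superfluous_radical => x /QQ Qx.
    have Qx' : q c i * aval x = 0 by rewrite -QE Qx.
    have [y _ ->] := q_ker H (PmP x) Qx'; exact: radical_hD.
  - by move=> x y /(congr1 (@aval _ _ _ _)); rewrite !jE => /aval_inj.
  by move=> x; rewrite QQ; apply: exj.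
have UW := is_syzygy_unique SU SW.
exact: is_syzygy_unique (is_syzygy_iso UW UO) WU.
Qed.

Variables (S : I -> rmodType A) (s : forall i, S i).
Hypothesis hS : forall i, simple_module_at e p q (hub i) (s i).
Variables (S' : bool -> I -> rmodType A) (s' : forall c i, S' c i).
Hypothesis hS' : forall c i, simple_module_at e p q (spoke c i) (s' c i).
Variable Om : bool -> I -> rmodType A.
Hypothesis hOm : forall c i, is_syzygy2 (S' c i) (Om c i).

(** [M] enters only through its summands and an induction principle, so the bracketing of the direct
    sum does not matter. *)
Variable M : rmodType A.
Hypothesis regular_M : retract (regular_rmod A) M.
Hypothesis simple_M : forall i, retract (S i) M.
Hypothesis Om_M : forall c i, retract (Om c i) M.
Hypothesis M_ind : forall Q : rmodType A -> Prop, Q 'rV[A^c]_0 ->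
  (forall V W, Q V -> Q W -> Q (V * W)%type) ->
  Q (regular_rmod A) -> (forall i, Q (S i)) -> (forall c i, Q (Om c i)) -> Q M.

Lemma Om_retract c i : retract (Om c i) (Um c i) /\ retract (Um c i) (Om c i).
Proof. exact/retract_iso/(syzygy2_spoke (hS' c i))/hOm. Qed.

Lemma Um_fin c i : fin_dim (Um c i).
Proof. exact: annihilator_fin_dim H _ _. Qed.

Lemma Om_fin c i : fin_dim (Om c i).
Proof. exact: fin_dim_retract (proj1 (Om_retract c i)) (Um_fin c i). Qed.

Lemma S_fin i : fin_dim (S i).
Proof.
have [_ sp _ _] := hS i; apply: (@fin_dim_family _ _ _ 'I_1 (fun=> s i)) => x.
by have [a ->] := sp x; exists (fun=> a); rewrite big_ord1.
Qed.

Lemma M_fin : fin_dim M.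
Proof.
apply: M_ind; [exact: fin_dim0|exact: fin_dim_prod|exact: hub_fin_dim H|exact: S_fin|exact: Om_fin].
Qed.

Lemma retract_zero V : retract ('rV[A^c]_0 : rmodType A) V.
Proof. by exists \0, \0 => x; apply/rowP => -[]. Qed.

Let Af := hub_fin_dim H.

Lemma ext12_zero_M V : fin_dim V -> (forall W, nice e p q W -> ext12_zero V W) -> ext12_zero V M.
Proof.
move=> Vf h.
have hA : ext12_zero V (regular_rmod A) by apply: (ext12_zero_injective Af Vf); apply: injective_regular H.
apply: M_ind => [|W W' hW hW'||i|c i].
- exact: ext12_zero_retractr (retract_zero _) hA.
- exact: ext12_zero_prodr.
- exact: hA.
- exact/h/(nice_simple H hS).
apply: ext12_zero_retractr (proj1 (Om_retract c i)) _.
exact/h/(nice_U H).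
Qed.

Lemma ext12_zero_MM : ext12_zero M M.
Proof.
suff [] : fin_dim M /\ ext12_zero M M by [].
apply: (M_ind (Q := fun V => fin_dim V /\ ext12_zero V M)) => [|V W [Vf hV] [Wf hW]||i|c i].
- by split; [exact: fin_dim0|apply/ext12_zero_projective/projective_free].
- by split; [exact: fin_dim_prod|exact: (ext12_zero_prodl Af Vf Wf)].
- by split; [exact: Af|apply/ext12_zero_projective/projective_regular].
- split; first exact: S_fin.
  by apply: ext12_zero_M => [|W nW]; [exact: S_fin|exact: (ext12_zero_simple H hS)].
split; first exact: Om_fin.
apply: ext12_zero_M => [|W nW]; first exact: Om_fin.
exact: (ext12_zero_retractl Af (Um_fin c i) (proj1 (Om_retract c i)) (ext12_zero_U H c i nW)).
Qed.

Lemma Um_M c i : retract (Um c i) M.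
Proof. exact: retract_trans (proj2 (Om_retract c i)) (Om_M c i). Qed.

Lemma Pm_add v : add_closure M (Pm v).
Proof. exact/add_closure_self/(retract_trans (Pm_retract H v) regular_M). Qed.

Theorem hub_cluster_tilting : cluster_tilting3 M.
Proof.
split; first exact: M_fin.
have nf n : fin_dim (dsum (nseq n M)).
  by elim: n => [|n IH]; [exact: fin_dim0|apply: fin_dim_prod; [exact: M_fin|]].
move=> N Nf; rewrite in_addE; split; split=> [[n Nn]|].
- apply/(ext12_zeroE Af _ M_fin); apply: ext12_zero_retractr Nn _.
  elim: n => [|n IH] /=; last by apply: ext12_zero_prodr => //; exact: ext12_zero_MM.
  exact: ext12_zero_retractr (retract_zero M) ext12_zero_MM.
- move/(ext12_zeroE Af _ M_fin) => hN.
  apply: (add_closure_of_good H hS (T := fun N => fin_dim N /\ ext12_zero M N)) => //.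
  + move=> N1 N2 r [N1f h]; split; first exact: fin_dim_retract r N1f.
    exact: ext12_zero_retractr r h.
  + by move=> N1 [].
  + move=> N1 [N1f h]; apply: (good_left H hS) => [i|c i].
      exact: (ext12_zero_retractl Af M_fin (simple_M i) h).
    exact: (ext12_zero_retractl Af M_fin (Um_M c i) h).
  + exact: Pm_add.
  + by move=> c i; apply/add_closure_self/Um_M.
  + by move=> i; apply/add_closure_self/simple_M.
- apply/(ext12_zeroE Af _ Nf).
  apply: (ext12_zero_retractl Af (nf n) Nn).
  elim: n {Nn} => [|n IH] /=; first exact/ext12_zero_projective/projective_free.
  by apply: (ext12_zero_prodl Af M_fin (nf n) _ IH); exact: ext12_zero_MM.
move/(ext12_zeroE Af _ Nf) => hN.
apply: (add_closure_of_good H hS (T := fun N => fin_dim N /\ ext12_zero N M)) => //.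
- move=> N1 N2 r [N1f h]; split; first exact: fin_dim_retract r N1f.
  exact: (ext12_zero_retractl Af N1f r h).
- by move=> N1 [].
- move=> N1 [N1f h]; apply: (good_right H hS N1f) => [i|c i].
    exact: ext12_zero_retractr (simple_M i) h.
  exact: ext12_zero_retractr (Um_M c i) h.
- exact: Pm_add.
- by move=> c i; apply/add_closure_self/Um_M.
by move=> i; apply/add_closure_self/simple_M.
Qed.

End HubStructure.

(** * Bound quivers giving hub algebras *)

Section PathTrace.
Variables (K : fieldType) (Q : quiver) (weight : seq (arrow Q) -> K).
Hypothesis weight_catC : forall s s', weight (s ++ s') = weight (s' ++ s).
Local Notation KQ := (path_algebra K Q).

Definition ptrivial (v : vertex Q) : KQ := pbasis 1 (ptriv v).

(** The length is 4 because the socle elements of both algebras are classes of cycles of length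
    4. *)
Definition path_weight (p : qpath Q) : K :=
  if (ptarget p == psource p) && (size (parrows p) == 4) then weight (parrows p) else 0.

Definition path_trace (x : KQ) : K := \sum_(p <- msupp x) pcoeff p x * path_weight p.

Lemma path_trace_widen (d : {fset qpath Q}) (x : KQ) : (msupp x `<=` d)%fset ->
  path_trace x = \sum_(p <- d) pcoeff p x * path_weight p.
Proof.
move=> le; rewrite /path_trace (big_fset_incl _ le) //= => p _ /mcoeff_outdom h.
by rewrite /pcoeff h mul0r.
Qed.

Lemma path_traceD (x y : KQ) : path_trace (x + y) = path_trace x + path_trace y.
Proof.
rewrite (path_trace_widen (msuppD_le x y)).
rewrite (path_trace_widen (fsubsetUl (msupp x) (msupp y))).
rewrite (path_trace_widen (fsubsetUr (msupp x) (msupp y))).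
by rewrite -big_split /=; apply: eq_bigr => p _; rewrite raddfD mulrDl.
Qed.

Lemma path_traceZ c (x : KQ) : path_trace (c *: x) = c * path_trace x.
Proof.
rewrite (path_trace_widen (msuppZ_le c x)) /path_trace mulr_sumr.
by apply: eq_bigr => p _; rewrite pcoeffZ mulrA.
Qed.

Lemma path_trace0 : path_trace 0 = 0.
Proof. by rewrite -(scale0r (0 : KQ)) path_traceZ mul0r. Qed.

Lemma path_trace_basis c p : path_trace (pbasis c p) = c * path_weight p.
Proof.
rewrite (path_trace_widen (d := [fset p]%fset)); last by rewrite pbasisE msuppU_le.
by rewrite big_seq_fset1 pcoeff_basis eqxx.
Qed.

Lemma path_mulE c d (p q : qpath Q) : pbasis c p * pbasis d q = obasis (pcat p q) (c * d) :> KQ.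
Proof. exact: pa_mulBB. Qed.

Lemma path_trace_basisC c d p q :
  path_trace (pbasis c p * pbasis d q) = path_trace (pbasis d q * pbasis c p).
Proof.
rewrite !path_mulE.
case: pcatP => [r e1 rs rt ra|ne1]; case: pcatP => [r' e2 rs' rt' ra'|ne2] //=;
  rewrite ?path_trace_basis ?path_trace0 ?mulr0 // /path_weight.
- rewrite rs rt rs' rt' e1 e2 !eqxx ra ra' !size_cat (mulrC d c) /=.
  by rewrite (addnC (size (parrows q))) weight_catC.
- by rewrite rs rt; case: eqP => [//|_]; rewrite mulr0.
by rewrite rs' rt'; case: eqP => [//|_]; rewrite mulr0.
Qed.

Lemma path_traceC (x y : KQ) : path_trace (x * y) = path_trace (y * x).
Proof.
elim/pa_ind: x => [|x1 x2 h1 h2|c p]; first by rewrite mul0r mulr0.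
  by rewrite mulrDl mulrDr !path_traceD h1 h2.
elim/pa_ind: y => [|y1 y2 h1 h2|d q]; first by rewrite mul0r mulr0.
  by rewrite mulrDl mulrDr !path_traceD h1 h2.
exact: path_trace_basisC.
Qed.

Definition word (s : seq (arrow Q)) : KQ := foldr (fun a x => qarrow K a * x) 1 s.

Lemma ptrivial_mul v w : ptrivial v * ptrivial w = if v == w then ptrivial v else 0.
Proof.
rewrite path_mulE; case: pcatP => [r e es et ea|ne] /=; last first.
  by case: eqP => // e; case: ne.
have e' : v = w by [].
rewrite mulr1 e' eqxx; congr pbasis; apply: qpath_eq; rewrite ?es ?ea //.
Qed.

Lemma ptrivial_sum : \sum_v ptrivial v = 1 :> KQ.
Proof. by []. Qed.

Lemma path_source (p : qpath Q) c : ptrivial (psource p) * pbasis c p = pbasis c p.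
Proof.
rewrite path_mulE; case: pcatP => [r e es et ea|[]//] /=.
by rewrite mul1r; congr pbasis; apply: qpath_eq; rewrite ?es ?ea.
Qed.

Lemma path_target (p : qpath Q) c : pbasis c p * ptrivial (ptarget p) = pbasis c p.
Proof.
rewrite path_mulE; case: pcatP => [r e es et ea|[]//] /=.
by rewrite mulr1; congr pbasis; apply: qpath_eq; rewrite ?es ?ea // cats0.
Qed.

Lemma qarrow_source a : ptrivial (source a) * qarrow K a = qarrow K a.
Proof. exact: (path_source (parrow a)). Qed.

Lemma qarrow_target a : qarrow K a * ptrivial (target a) = qarrow K a.
Proof. exact: (path_target (parrow a)). Qed.

Lemma wordE a s : word (a :: s) = obasis (insub (source a, a :: s)) 1.
Proof.
elim: s a => [|b s IH] a.
  by have /= := valK (parrow a); rewrite mulr1 => ->.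
rewrite -[LHS]/(qarrow K a * word (b :: s)) IH.
have [wb|wb] := boolP (walk (source b) (b :: s)); last first.
  rewrite insubN // mulr0 insubN //=; apply: contra wb => /=.
  by case/and3P => _ _ ->; rewrite eqxx.
have [r0 r0E] : exists r : qpath Q, val r = (source b, b :: s).
  by exists (QPath (wb : walk (source b, b :: s).1 (source b, b :: s).2)).
rewrite -r0E valK /= path_mulE mulr1; case: pcatP => [r e es et ea|ne] /=.
  have rE : val r = (source a, a :: b :: s).
    by rewrite [val r]surjective_pairing -/(psource r) -/(parrows r) es ea /parrows r0E.
  by rewrite -rE valK.
rewrite insubN //=; apply/negP => /and3P[_ /eqP e _]; apply: ne.
by rewrite /ptarget /psource /= r0E /walk_end /= e.
Qed.

Definition word_weight (s : seq (arrow Q)) : K :=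
  if s is a :: _ then
    if [&& walk (source a) s, walk_end (source a) s == source a & size s == 4]
    then weight s else 0
  else 0.

Lemma path_trace_word s : s != [::] -> path_trace (word s) = word_weight s.
Proof.
case: s => // a s _; rewrite wordE /word_weight.
case: insubP => [r wr rE|/negPf wr]; last by move: wr => /= wr; rewrite wr path_trace0.
rewrite /obasis /= path_trace_basis mul1r /path_weight /ptarget /psource /parrows rE /=.
by move: wr => /= ->.
Qed.

Lemma path_cases (P : qpath Q -> Prop) : (forall v, P (ptriv v)) -> (forall a, P (parrow a)) ->
  (forall p, (1 < size (parrows p))%N -> P p) -> forall p, P p.
Proof.
move=> P0 P1 P2 p; case E : (parrows p) => [|a [|b s]].
- by have -> : p = ptriv (psource p) by apply: qpath_eq.
- have -> : p = parrow a; last exact: P1.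
  apply: qpath_eq => //; have := valP p; rewrite -/(parrows p) E /= andbT => /eqP.
  by rewrite -/(psource p) => <-.
by apply: P2; rewrite E.
Qed.

Lemma path_trace_mul_word p a s : (size (parrows p) + size (a :: s) != 4)%N ->
  path_trace (pbasis 1 p * word (a :: s)) = 0.
Proof.
move=> ne; rewrite wordE; case: insubP => [r wr rE|_] /=; last by rewrite mulr0 path_trace0.
rewrite path_mulE; case: pcatP => [r' e es et ea|_] /=; last exact: path_trace0.
rewrite path_trace_basis /path_weight ea size_cat /parrows rE (negPf ne) andbF.
exact: mulr0.
Qed.

(** Multiplying by paths on one side suffices: the trace is cyclic, so it then vanishes on the
    two-sided ideal. *)
Definition traceless (r : KQ) := forall p, path_trace (pbasis 1 p * r) = 0.

Lemma tracelessM r x : traceless r -> path_trace (x * r) = 0.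
Proof.
move=> h; elim/pa_ind: x => [|x y hx hy|c p]; first by rewrite mul0r path_trace0.
  by rewrite mulrDl path_traceD hx hy addr0.
by rewrite -[c]mulr1 -scale_basis -scalerAl path_traceZ h mulr0.
Qed.

(** With a word of length at least 4, only a trivial path can give total length 4; with words of
    length 3, as in [traceless_sub], only a single arrow can. *)
Lemma traceless_word s : (3 < size s)%N -> word_weight s = 0 -> traceless (word s).
Proof.
case: s => // a s sz w0 p.
have [E|ne] := eqVneq (size (parrows p) + size (a :: s))%N 4; last exact: path_trace_mul_word.
have p0 : parrows p = [::].
  by apply/nilP; rewrite /nilp -leqn0 -(leq_add2r (size (a :: s))) E.
have -> : p = ptriv (psource p) by apply: qpath_eq.
rewrite -[word _]/(qarrow K a * word s) -qarrow_source -mulrA mulrA.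
rewrite -/(ptrivial _) ptrivial_mul; case: eqP => [->|_]; last by rewrite mul0r path_trace0.
by rewrite mulrA qarrow_source -[_ * _]/(word (a :: s)) path_trace_word.
Qed.

Lemma traceless_sub c s s' : size s = 3 -> size s' = 3 ->
  (forall a, word_weight (a :: s) = c * word_weight (a :: s')) ->
  traceless (word s - c *: word s').
Proof.
move=> sz sz' h p; rewrite mulrBr -scaleN1r -scalerAr path_traceD !path_traceZ mulN1r.
case: s sz h => // b s sz h; case: s' sz' h => // b' s' sz' h.
elim/path_cases: p => [v|a|p lt].
- by rewrite !path_trace_mul_word ?sz ?sz' // mulr0 oppr0 addr0.
- have E x : pbasis 1 (parrow a) * word x = word (a :: x) by [].
  by rewrite !E !path_trace_word // h subrr.
rewrite !path_trace_mul_word ?sz ?sz' ?mulr0 ?oppr0 ?addr0 //;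
  by apply/eqP => E; move: lt; rewrite -(ltn_add2r 3) E.
Qed.

Lemma path_generation (P : KQ -> Prop) : P 1 ->
  (forall x y, P x -> P y -> P (x + y)) -> (forall c x, P x -> P (c *: x)) ->
  (forall v x, P x -> P (ptrivial v * x)) -> (forall a x, P x -> P (qarrow K a * x)) ->
  forall x, P x.
Proof.
move=> P1 PD PZ Pe Pa; apply: pa_ind => [|x y|c p]; [|exact: PD|].
  by rewrite -(scale0r (1 : KQ)); apply: PZ.
rewrite -[c]mulr1 -scale_basis; apply: PZ.
move pE : (val p) => [v s]; elim: s v p pE => [|a s IH] v p pE.
  have -> : p = ptriv v by apply: val_inj.
  by rewrite -[pbasis 1 _]mulr1; apply: Pe.
have := valP p; rewrite pE /= => /andP[/eqP va ws].
have [p' p'E] : exists p' : qpath Q, val p' = (target a, s).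
  by exists (QPath (ws : walk (target a, s).1 (target a, s).2)).
have -> : pbasis 1 p = qarrow K a * pbasis 1 p'.
  rewrite path_mulE mulr1; case: pcatP => [r e es et ea|ne] /=; last first.
    by case: ne; rewrite /psource p'E.
  congr pbasis; apply: qpath_eq; rewrite ?es ?ea /psource /parrows pE ?p'E //= va.
exact/Pa/(IH (target a)).
Qed.

End PathTrace.

Section BoundQuiver.
Variables (K : fieldType) (B : bound_quiver K) (weight : seq (arrow B) -> K).
Hypothesis weight_catC : forall s s', weight (s ++ s') = weight (s' ++ s).
Hypothesis rels_traceless : {in bq_rels B, forall r, traceless weight r}.
Local Notation L := (bq_algebra B).

Definition bq_trace (x : L) : K := path_trace weight (bq_repr x).

Lemma bq_trace_class x : bq_trace (bq_class x) = path_trace weight x.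
Proof.
have : bq_repr (bq_class x : L) - x \in @bq_ideal K B by apply/bq_classP; rewrite bq_reprK.
rewrite /bq_trace; move: (bq_repr _) => y /bq_idealP h.
suff : path_trace weight (y - x) = 0.
  by rewrite -scaleN1r path_traceD path_traceZ mulN1r => /eqP; rewrite subr_eq0 => /eqP.
elim: h => [|z a r b _ IH hr]; first exact: path_trace0.
rewrite path_traceD IH add0r (path_traceC weight_catC) mulrA.
exact/tracelessM/rels_traceless.
Qed.

Lemma bq_rel_eq0 (r : path_algebra K B) : r \in bq_rels B -> bq_class r = 0 :> L.
Proof.
move=> hr; rewrite -(raddf0 (@bq_class K B)); apply/bq_classP; apply/bq_idealP.
by have := InIdealD 1 1 (@InIdeal0 K B) hr; rewrite add0r mul1r mulr1 subr0.
Qed.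

Lemma bq_classZ c (x : path_algebra K B) : bq_class (c *: x) = c *: (bq_class x : L).
Proof. by rewrite -bq_scaleE. Qed.

End BoundQuiver.

Section Dsum.
Variables (K : fieldType) (A : algType K) (X : eqType) (F : X -> rmodType A).

Lemma retract_dsum (s : seq X) x : x \in s -> retract (F x) (dsum [seq F y | y <- s]).
Proof.
elim: s => //= y s IH; rewrite inE => /predU1P[->|/IH r]; first exact: retract_fst.
exact: retract_trans r (retract_snd _ _).
Qed.

Lemma dsum_ind (P : rmodType A -> Prop) (s : seq X) : P 'rV[A^c]_0 ->
  (forall V W, P V -> P W -> P (V * W)%type) -> (forall x, x \in s -> P (F x)) ->
  P (dsum [seq F y | y <- s]).
Proof.
move=> P0 PD; elim: s => //= y s IH Ps; apply: PD; first by apply: Ps; rewrite mem_head.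
by apply: IH => x xs; apply: Ps; rewrite inE xs orbT.
Qed.

End Dsum.

Section HubQuiver.
Variables (K : fieldType) (B : bound_quiver K) (I : finType) (nx : I -> I) (mu : K).
Variables (vx : hvertex I -> vertex B) (vx' : vertex B -> hvertex I).
Variables (ap aq : bool -> I -> arrow B) (weight : seq (arrow B) -> K).
Local Notation L := (bq_algebra B).

Definition hq_e (v : hvertex I) : L := bq_class (ptrivial K (vx v)).
Definition hq_p c i : L := bq_class (qarrow K (ap c i)).
Definition hq_q c i : L := bq_class (qarrow K (aq c i)).
Local Notation e := hq_e.
Local Notation p := hq_p.
Local Notation q := hq_q.
Local Notation t := (bq_trace weight).

Hypotheses (vxK : cancel vx vx') (vx'K : cancel vx' vx) (nxK : involutive nx).
Hypotheses (mu_neq0 : mu != 0) (mu_neq1 : mu != 1).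
Hypothesis ap_source : forall c i, source (ap c i) = vx (hub i).
Hypothesis ap_target : forall c i, target (ap c i) = vx (spoke c i).
Hypothesis aq_source : forall c i, source (aq c i) = vx (spoke c i).
Hypothesis aq_target : forall c i, target (aq c i) = vx (hub (nx i)).
Hypothesis arrows : forall P : arrow B -> Prop,
  (forall c i, P (ap c i)) -> (forall c i, P (aq c i)) -> forall a, P a.
Hypothesis weight_catC : forall s s', weight (s ++ s') = weight (s' ++ s).
Hypothesis rels_traceless : {in bq_rels B, forall r, traceless weight r}.
Hypothesis weight_z : forall i,
  word_weight weight [:: ap true i; aq true i; ap true (nx i); aq true (nx i)] = 1.
Hypothesis q_Z : forall c d i, q c i * hZ p q d (nx i) = hgram mu c d *: hv nx p q c i.
Hypothesis Z_p : forall c d i, hZ p q d i * p c (nx i) = hgram mu d c *: hu nx p q c i.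
Hypothesis v_p : forall c i, hv nx p q c i * p (~~ c) i = 0.
Hypothesis z_p : forall c i, hz nx p q i * p c i = 0.
Hypothesis zs_q : forall c i, hzs nx p q c i * q c i = 0.

Lemma class_word1 a : bq_class (word K [:: a]) = bq_class (qarrow K a) :> L.
Proof. by rewrite /word /= mulr1. Qed.

Lemma class_word a s : bq_class (word K (a :: s)) = bq_class (qarrow K a) * bq_class (word K s) :> L.
Proof. by rewrite /= rmorphM. Qed.

Lemma trace_word s : s != [::] -> t (bq_class (word K s)) = word_weight weight s.
Proof. by move=> s0; rewrite (bq_trace_class weight_catC rels_traceless) path_trace_word. Qed.

Lemma trace_short s : s != [::] -> size s != 4 -> t (bq_class (word K s)) = 0.
Proof.
move=> s0 s4; rewrite trace_word //; case: s s0 s4 => // a s _ /= /negPf E.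
by rewrite E !andbF.
Qed.

Lemma hub_algebra_of_quiver : hub_algebra nx mu e p q t.
Proof.
have qw c i : q c i = bq_class (word K [:: aq c i]) by rewrite class_word1.
have pw c i : p c i = bq_class (word K [:: ap c i]) by rewrite class_word1.
have tc := bq_trace_class weight_catC rels_traceless.
split.
- exact: nxK.
- exact: mu_neq0.
- exact: mu_neq1.
- move=> v w; rewrite /e -rmorphM ptrivial_mul (inj_eq (can_inj vxK)).
  by case: eqP => _; rewrite ?raddf0.
- rewrite /e -(raddf_sum (@bq_class K B)).
  have -> : \sum_v ptrivial K (vx v) = 1; last exact: rmorph1.
  rewrite -(ptrivial_sum K B) [RHS](reindex vx) //.
  by exists vx' => ? _; [exact: vxK|exact: vx'K].
- by move=> c i; rewrite /e /p -rmorphM -(ap_source c i) qarrow_source.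
- by move=> c i; rewrite /e /p -rmorphM -(ap_target c i) qarrow_target.
- by move=> c i; rewrite /e /q -rmorphM -(aq_source c i) qarrow_source.
- by move=> c i; rewrite /e /q -rmorphM -(aq_target c i) qarrow_target.
- move=> P P1 PD PZ Pe Pp Pq; apply: bq_ind; apply: path_generation.
  + by rewrite rmorph1.
  + by move=> x y Px Py; rewrite raddfD; apply: PD.
  + by move=> k x Px; rewrite bq_classZ; apply: PZ.
  + by move=> v x Px; rewrite rmorphM -[v]vx'K; apply: Pe.
  by move=> a x Px; rewrite rmorphM; move: a; apply: arrows => c i; [apply: Pp|apply: Pq].
- exact: q_Z.
- exact: Z_p.
- exact: v_p.
- exact: z_p.
- exact: zs_q.
- move=> c x y; elim/bq_ind: x => x; elim/bq_ind: y => y.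
  by rewrite -bq_classZ -raddfD !tc path_traceD path_traceZ.
- move=> x y; elim/bq_ind: x => x; elim/bq_ind: y => y.
  by rewrite -!rmorphM !tc (path_traceC weight_catC).
- by move=> v; rewrite /e tc path_trace_basis /path_weight /= andbF mulr0.
- by move=> c i; rewrite pw trace_short.
- by move=> c i; rewrite qw trace_short.
- by move=> c i; rewrite /hZ qw -class_word trace_short.
- by move=> c d i; rewrite pw -class_word trace_short.
- by move=> c i; rewrite /hu /hZ -mulrA [p c _]pw -!class_word trace_short.
- by move=> c i; rewrite /hv /hZ [q true _]qw -!class_word trace_short.
by move=> i; rewrite /hz /hZ -mulrA [q true (nx i)]qw -!class_word trace_word.
Qed.

Lemma simple_rmodP v : simple_module_at e p q v (1 : simple_rmod (vx v)).
Proof.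
have act (a : path_algebra K B) (x : simple_rmod (vx v)) :
    x ∙ bq_class a = (x : K) * vertex_coeff (vx v) a.
  by rewrite -bq_vertex_coeffE.
split.
- exact: oner_neq0.
- move=> x; exists x; rewrite -[RHS]/((1 : simple_rmod (vx v)) ∙ (x : K)%:A).
  have -> : (x : K)%:A = bq_class ((x : K) *: 1) :> L by rewrite bq_classZ rmorph1.
  by rewrite act mul1r vertex_coeffZ rmorph1 mulr1.
- by rewrite /e act mul1r /ptrivial vertex_coeff_basis eqxx.
by move=> c i; rewrite !act !vertex_coeff_arrow !mulr0.
Qed.

Theorem quiver_cluster_tilting (Gamma : {set vertex B}) (Om : vertex B -> rmodType L) :
  (forall i, vx (hub i) \in Gamma) -> (forall c i, vx (spoke c i) \notin Gamma) ->
  (forall v, v \notin Gamma -> is_syzygy2 (simple_rmod v) (Om v)) ->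
  cluster_tilting3 (candidate Gamma Om).
Proof.
move=> hubG spokeG hOm.
apply: (hub_cluster_tilting hub_algebra_of_quiver (fun i => simple_rmodP (hub i))
  (fun c i => simple_rmodP (spoke c i)) (Om := fun c i => Om (vx (spoke c i)))).
- by move=> c i; apply/hOm/spokeG.
- exact: retract_fst.
- move=> i; apply: retract_trans (retract_trans _ (retract_fst _ _)) (retract_snd _ _).
  by apply: (retract_dsum (@simple_rmod K B)); rewrite mem_enum hubG.
- move=> c i; apply: retract_trans (retract_trans _ (retract_snd _ _)) (retract_snd _ _).
  by apply: (retract_dsum Om); rewrite mem_enum inE spokeG.
move=> P P0 PD PA PS PO; apply: (PD) => //; apply: (PD); apply: dsum_ind => // v.
  rewrite mem_enum -[v]vx'K; case: (vx' v) => [i _|[c i]]; first exact: PS.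
  by move=> h; have := spokeG c i; rewrite h.
rewrite mem_enum inE -[v]vx'K; case: (vx' v) => [i|[c i] _]; last exact: PO.
by move=> h; have := hubG i; rewrite (negPf h).
Qed.

End HubQuiver.

(** * The triangle and spherical algebras *)

Section Words.
Variables (K : fieldType) (Q : quiver).
Local Notation arr := (@qarrow K Q).

Lemma word3 a b c : word K [:: a; b; c] = arr a * arr b * arr c.
Proof. by rewrite /= mulr1 mulrA. Qed.

Lemma word4 a b c d : word K [:: a; b; c; d] = arr a * arr b * arr c * arr d.
Proof. by rewrite /= mulr1 !mulrA. Qed.

Lemma word5 a b c d f : word K [:: a; b; c; d; f] = arr a * arr b * arr c * arr d * arr f.
Proof. by rewrite /= mulr1 !mulrA. Qed.

(* [mu] is the value of the form on the cycles of length 4 whose arrows all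
   satisfy [Y]. *)
Definition cycle_weight (Y : pred (arrow Q)) (mu : K) (s : seq (arrow Q)) : K :=
  if all Y s then mu else 1.

Lemma cycle_weight_catC Y mu s s' :
  cycle_weight Y mu (s ++ s') = cycle_weight Y mu (s' ++ s).
Proof. by rewrite /cycle_weight !all_cat andbC. Qed.

End Words.

Section Relations.
Variables (K : fieldType) (B : bound_quiver K).
Local Notation cls := (@bq_class K B).

Lemma rel_nth k : (k < size (bq_rels B))%N -> cls (bq_rels B)`_k = 0.
Proof. by move=> /(mem_nth 0)/bq_rel_eq0. Qed.

Lemma class_sub_eq0 x y : cls (x - y) = 0 -> cls x = cls y.
Proof. by move/eqP; rewrite raddfB subr_eq0 => /eqP. Qed.

Lemma class_subZ_eq0 c x y : c != 0 -> cls (x - c *: y) = 0 -> cls y = c^-1 *: cls x.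
Proof. by move=> c0 /class_sub_eq0 ->; rewrite bq_classZ scalerA mulVf ?scale1r. Qed.

Lemma class_word3 a b c : cls (word K [:: a; b; c]) =
  cls (qarrow K a) * cls (qarrow K b) * cls (qarrow K c).
Proof. by rewrite word3 !rmorphM. Qed.

Lemma class_word4 a b c d : cls (word K [:: a; b; c; d]) =
  cls (qarrow K a) * cls (qarrow K b) * cls (qarrow K c) * cls (qarrow K d).
Proof. by rewrite word4 !rmorphM. Qed.

Lemma class_word5 a b c d f : cls (word K [:: a; b; c; d; f]) =
  cls (qarrow K a) * cls (qarrow K b) * cls (qarrow K c) * cls (qarrow K d) * cls (qarrow K f).
Proof. by rewrite word5 !rmorphM. Qed.

End Relations.

Lemma forall_in_nil (X : eqType) (P : X -> Prop) : {in [::], forall x, P x}.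
Proof. by []. Qed.

Lemma forall_in_cons (X : eqType) (P : X -> Prop) x (s : seq X) :
  P x -> {in s, forall x, P x} -> {in x :: s, forall x, P x}.
Proof. by move=> Px Ps y; rewrite inE => /predU1P[->|/Ps]. Qed.

Lemma traceless_sub1 (K : fieldType) (Q : quiver) (weight : seq (arrow Q) -> K) s s' :
  size s = 3 -> size s' = 3 ->
  (forall a, word_weight weight (a :: s) = word_weight weight (a :: s')) ->
  traceless weight (word K s - word K s').
Proof.
by move=> sz sz' h; rewrite -[word K s']scale1r; apply: traceless_sub => // a; rewrite mul1r.
Qed.

Lemma tri_hub_relations (K : fieldType) (A : algType K) (mu : K) (a b g d : A)
    (p q : bool -> unit -> A) :
  p true tt = b -> p false tt = g -> q true tt = a -> q false tt = d -> mu != 0 ->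
  a * b * a = a * g * d -> d * g * d = mu *: (d * b * a) ->
  b * a * b = g * d * b -> g * d * g = mu *: (b * a * g) ->
  a * b * a * g = 0 -> d * b * a * b = 0 -> b * a * b * a * b = 0 ->
  a * b * a * b * a = 0 -> d * g * d * g * d = 0 ->
  [/\ forall c d i, q c i * hZ p q d i = hgram mu c d *: hv id p q c i,
      forall c d i, hZ p q d i * p c i = hgram mu d c *: hu id p q c i,
      forall c i, hv id p q c i * p (~~ c) i = 0,
      forall c i, hz id p q i * p c i = 0 &
      forall c i, hzs id p q c i * q c i = 0].
Proof.
move=> pt pf qt qf mu0 r0 r1 r2 r3 z1 z2 z3 z4 z5; rewrite /hzs /hv /hu /hz /hZ /hgram.
split=> [[] [] []|[] [] []|[] []|[] []|[] []] /=; rewrite ?(pt, pf, qt, qf) ?scale1r ?mulrA //.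
- have -> : b * a * b * a * g = b * (a * b * a * g) by rewrite !mulrA.
  by rewrite z1 mulr0.
(* By [r1] the zero path [d * g * d * g * d] is [mu] times the path of the goal. *)
apply: (scalerI mu0); rewrite scaler0.
have -> : mu *: (d * b * a * g * d) = (mu *: (d * b * a)) * g * d by rewrite -!scalerAl.
by rewrite -r1.
Qed.

Section TriangleAlgebra.
Variables (K : fieldType) (lambda : K).
Hypotheses (lambda_neq0 : lambda != 0) (lambda_neq1 : lambda != 1).
Local Notation B := (triangle lambda).
Local Notation L := (bq_algebra B).
Local Notation mu := lambda^-1.

(** The equality test inherited from the ordinals goes through [inord]; this one evaluates by
    computation. *)
Definition tri_eqb (v w : tri_vertex) : bool :=
  match v, w with T1, T1 | T2, T2 | T3, T3 => true | _, _ => false end.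

Lemma tri_eqE (v w : tri_vertex) : (v == w) = tri_eqb v w.
Proof. by apply/eqP/idP => [->|]; [case: w|case: v; case: w]. Qed.

(** The arrows through the spoke marked [false]. The closed paths of length 4 made of them are the
    rotations of [Z_false Z_false], and their weight [mu] matches [hgram false false]. *)
Definition tri_Y (a : tri_arrow) : bool := match a with Tgamma | Tdelta => true | _ => false end.

Definition tri_vx (v : hvertex unit) : tri_vertex :=
  match v with inl _ => T2 | inr (c, _) => if c then T1 else T3 end.
Definition tri_vx' (v : tri_vertex) : hvertex unit :=
  match v with T1 => spoke true tt | T2 => hub tt | T3 => spoke false tt end.
Definition tri_ap (c : bool) (_ : unit) : tri_arrow := if c then Tbeta else Tgamma.
Definition tri_aq (c : bool) (_ : unit) : tri_arrow := if c then Talpha else Tdelta.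

Let weight : seq (arrow tri_quiver) -> K := @cycle_weight K tri_quiver tri_Y mu.

Local Notation w := (@word K tri_quiver).

Lemma tri_relsE : bq_rels B =
  [:: w [:: Talpha; Tbeta; Talpha] - w [:: Talpha; Tgamma; Tdelta];
      w [:: Tdelta; Tbeta; Talpha] - lambda *: w [:: Tdelta; Tgamma; Tdelta];
      w [:: Tbeta; Talpha; Tbeta] - w [:: Tgamma; Tdelta; Tbeta];
      w [:: Tbeta; Talpha; Tgamma] - lambda *: w [:: Tgamma; Tdelta; Tgamma];
      w [:: Talpha; Tbeta; Talpha; Tgamma];
      w [:: Tbeta; Talpha; Tbeta; Talpha; Tbeta];
      w [:: Tdelta; Tgamma; Tdelta; Tbeta];
      w [:: Tgamma; Tdelta; Tgamma; Tdelta; Tgamma];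
      w [:: Talpha; Tbeta; Talpha; Tbeta; Talpha];
      w [:: Tdelta; Tgamma; Tdelta; Tgamma; Tdelta];
      w [:: Tdelta; Tbeta; Talpha; Tbeta]].
Proof. by rewrite !word3 !word4 !word5. Qed.

Lemma tri_traceless : {in bq_rels B, forall r, traceless weight r}.
Proof.
have ml : lambda * mu = 1 by rewrite divff.
(* The weight of a word of length 4 in a form that evaluates: each relation of length 3 is then
   settled by running over the closing arrow. *)
have ev b c d f : word_weight weight [:: b; c; d; f] =
    if [&& tri_eqb (tri_source c) (tri_target b), tri_eqb (tri_source d) (tri_target c),
        tri_eqb (tri_source f) (tri_target d) & tri_eqb (tri_target f) (tri_source b)]
    then (if [&& tri_Y b, tri_Y c, tri_Y d & tri_Y f] then mu else 1) else 0.
  rewrite /word_weight /weight /cycle_weight /= !tri_eqE !andbT.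
  have -> : tri_eqb (tri_source b) (tri_source b) by case: b.
  by rewrite -!andbA.
rewrite tri_relsE.
apply: forall_in_cons; first by apply: traceless_sub1 => // -[]; rewrite !ev.
apply: forall_in_cons; first by apply: traceless_sub => // -[]; rewrite !ev /= ?mulr0 ?mulr1 ?ml.
apply: forall_in_cons; first by apply: traceless_sub1 => // -[]; rewrite !ev.
apply: forall_in_cons; first by apply: traceless_sub => // -[]; rewrite !ev /= ?mulr0 ?mulr1 ?ml.
apply: forall_in_cons; first by apply: traceless_word => //; rewrite ev.
apply: forall_in_cons; first by apply: traceless_word => //; rewrite /word_weight !andbF.
apply: forall_in_cons; first by apply: traceless_word => //; rewrite ev.
apply: forall_in_cons; first by apply: traceless_word => //; rewrite /word_weight !andbF.
apply: forall_in_cons; first by apply: traceless_word => //; rewrite /word_weight !andbF.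
apply: forall_in_cons; first by apply: traceless_word => //; rewrite /word_weight !andbF.
apply: forall_in_cons; first by apply: traceless_word => //; rewrite ev.
exact: forall_in_nil.
Qed.

Lemma triangle_cluster_tilting (Om : tri_vertex -> rmodType L) :
  (forall v, v \notin tri_Gamma -> is_syzygy2 (simple_rmod (B := B) v) (Om v)) ->
  cluster_tilting3 (candidate (B := B) tri_Gamma Om).
Proof.
have rel k : (k < 11)%N -> bq_class (bq_rels B)`_k = 0 :> L.
  by move=> h; apply: rel_nth; rewrite tri_relsE.
rewrite tri_relsE in rel.
have r0 := class_sub_eq0 (rel 0%N isT).
have r1 := class_subZ_eq0 lambda_neq0 (rel 1%N isT).
have r2 := class_sub_eq0 (rel 2%N isT).
have r3 := class_subZ_eq0 lambda_neq0 (rel 3%N isT).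
have r4 := rel 4%N isT; have r5 := rel 5%N isT; have r8 := rel 8%N isT.
have r9 := rel 9%N isT; have r10 := rel 10%N isT.
rewrite /= in r4 r5 r8 r9 r10.
rewrite !class_word3 in r0 r1 r2 r3; rewrite !class_word4 in r4 r10.
rewrite !class_word5 in r5 r8 r9.
have mu0 : mu != 0 by rewrite invr_eq0.
have [R1 R2 R3 R4 R5] := tri_hub_relations (p := @hq_p K B unit tri_ap) (q := @hq_q K B unit tri_aq)
  erefl erefl erefl erefl mu0 r0 r1 r2 r3 r4 r10 r5 r8 r9.
apply: (@quiver_cluster_tilting K B unit id mu tri_vx tri_vx' tri_ap tri_aq weight).
- by case=> [[]|[[] []]].
- by case.
- by [].
- exact: mu0.
- by rewrite invr_eq1.
- by case.
- by case.
- by case.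
- by case.
- by move=> P Pp Pq [];
    [exact: (Pq true tt)|exact: (Pp true tt)|exact: (Pp false tt)|exact: (Pq false tt)].
- exact: cycle_weight_catC.
- exact: tri_traceless.
- by move=> i; rewrite /word_weight /= !tri_eqE.
- exact: R1.
- exact: R2.
- exact: R3.
- exact: R4.
- exact: R5.
- by case; rewrite inE.
- by case=> -[]; rewrite inE /= tri_eqE.
Qed.

End TriangleAlgebra.

Lemma sph_hub_relations (K : fieldType) (A : algType K) (mu : K)
    (a b n d r o g s : A) (p q : bool -> bool -> A) :
  p true true = r -> q true true = o -> p false true = a -> q false true = b ->
  p true false = n -> q true false = d -> p false false = g -> q false false = s ->
  mu != 0 ->
  a * b * n = r * o * n -> b * g * s = mu *: (b * n * d) ->
  g * s * a = mu *: (n * d * a) -> d * a * b = d * r * o ->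
  g * s * r = n * d * r -> s * a * b = mu *: (s * r * o) ->
  a * b * g = mu *: (r * o * g) -> o * g * s = o * n * d ->
  b * n * d * r = 0 -> n * d * a * b * n = 0 -> s * r * o * n = 0 ->
  r * o * g * s * r = 0 -> d * r * o * g = 0 -> o * n * d * a = 0 ->
  b * n * d * a * b = 0 -> d * a * b * n * d = 0 -> s * r * o * g * s = 0 ->
  o * g * s * r * o = 0 ->
  [/\ forall c d i, q c i * hZ p q d (~~ i) = hgram mu c d *: hv negb p q c i,
      forall c d i, hZ p q d i * p c (~~ i) = hgram mu d c *: hu negb p q c i,
      forall c i, hv negb p q c i * p (~~ c) i = 0,
      forall c i, hz negb p q i * p c i = 0 &
      forall c i, hzs negb p q c i * q c i = 0].
Proof.
move=> e1 e2 e3 e4 e5 e6 e7 e8 mu0 r0 r1 r2 r3 r4 r5 r6 r7.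
move=> z1 z2 z3 z4 z5 z6 z7 z8 z9 z10; rewrite /hzs /hv /hu /hz /hZ /hgram.
split=> [[] [] []|[] [] []|[] []|[] []|[] []] /=;
  rewrite ?(e1, e2, e3, e4, e5, e6, e7, e8) ?scale1r ?mulrA //.
(* In the cases left, either a subpath of length 3 is exchanged for the parallel one to reach a zero
   path, or a zero path of length 4 is already contained in the product. *)
- have -> : r * o * n * d * r = r * (o * n * d) * r by rewrite !mulrA.
  by rewrite -r7 !mulrA.
- have -> : n * d * r * o * n = n * (d * r * o) * n by rewrite !mulrA.
  by rewrite -r3 !mulrA.
- have -> : r * o * n * d * a = r * (o * n * d * a) by rewrite !mulrA.
  by rewrite z6 mulr0.
- have -> : n * d * r * o * g = n * (d * r * o * g) by rewrite !mulrA.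
  by rewrite z5 mulr0.
- by rewrite -r7.
by rewrite -r3.
Qed.

Section SphericalAlgebra.
Variables (K : fieldType) (lambda : K).
Hypotheses (lambda_neq0 : lambda != 0) (lambda_neq1 : lambda != 1).
Local Notation B := (spherical lambda).
Local Notation L := (bq_algebra B).
Local Notation mu := lambda^-1.

Definition sph_eqb (v w : sph_vertex) : bool :=
  match v, w with
  | S1, S1 | S2, S2 | S3, S3 | S4, S4 | S5, S5 | S6, S6 => true
  | _, _ => false
  end.

Lemma sph_eqE (v w : sph_vertex) : (v == w) = sph_eqb v w.
Proof. by apply/eqP/idP => [->|]; [case: w|case: v; case: w]. Qed.

Definition sph_Y (a : sph_arrow) : bool :=
  match a with Salpha | Sbeta | Sgamma | Ssigma => true | _ => false end.

(* The hub [true] is the vertex 1 and the hub [false] is the vertex 3. *)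
Definition sph_vx (v : hvertex bool) : sph_vertex :=
  match v with
  | inl i => if i then S1 else S3
  | inr (c, i) => if i then (if c then S6 else S2) else (if c then S5 else S4)
  end.
Definition sph_vx' (v : sph_vertex) : hvertex bool :=
  match v with
  | S1 => hub true | S3 => hub false
  | S6 => spoke true true | S2 => spoke false true
  | S5 => spoke true false | S4 => spoke false false
  end.
Definition sph_ap (c i : bool) : sph_arrow :=
  if i then (if c then Srho else Salpha) else (if c then Snu else Sgamma).
Definition sph_aq (c i : bool) : sph_arrow :=
  if i then (if c then Somega else Sbeta) else (if c then Sdelta else Ssigma).

Let weight : seq (arrow sph_quiver) -> K := @cycle_weight K sph_quiver sph_Y mu.
Local Notation w := (@word K sph_quiver).

Lemma sph_relsE : bq_rels B =
  [:: w [:: Salpha; Sbeta; Snu] - w [:: Srho; Somega; Snu];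
      w [:: Sbeta; Snu; Sdelta] - lambda *: w [:: Sbeta; Sgamma; Ssigma];
      w [:: Snu; Sdelta; Salpha] - lambda *: w [:: Sgamma; Ssigma; Salpha];
      w [:: Sdelta; Salpha; Sbeta] - w [:: Sdelta; Srho; Somega];
      w [:: Sgamma; Ssigma; Srho] - w [:: Snu; Sdelta; Srho];
      w [:: Ssigma; Srho; Somega] - lambda *: w [:: Ssigma; Salpha; Sbeta];
      w [:: Srho; Somega; Sgamma] - lambda *: w [:: Salpha; Sbeta; Sgamma];
      w [:: Somega; Sgamma; Ssigma] - w [:: Somega; Snu; Sdelta];
      w [:: Salpha; Sbeta; Snu; Sdelta; Salpha];
      w [:: Sbeta; Snu; Sdelta; Srho];
      w [:: Snu; Sdelta; Salpha; Sbeta; Snu];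
      w [:: Sdelta; Salpha; Sbeta; Sgamma];
      w [:: Sgamma; Ssigma; Srho; Somega; Sgamma];
      w [:: Ssigma; Srho; Somega; Snu];
      w [:: Srho; Somega; Sgamma; Ssigma; Srho];
      w [:: Somega; Sgamma; Ssigma; Salpha];
      w [:: Sbeta; Sgamma; Ssigma; Srho];
      w [:: Ssigma; Salpha; Sbeta; Snu];
      w [:: Sdelta; Srho; Somega; Sgamma];
      w [:: Somega; Snu; Sdelta; Salpha];
      w [:: Sbeta; Snu; Sdelta; Salpha; Sbeta];
      w [:: Sdelta; Salpha; Sbeta; Snu; Sdelta];
      w [:: Ssigma; Srho; Somega; Sgamma; Ssigma];
      w [:: Somega; Sgamma; Ssigma; Srho; Somega]].
Proof. by rewrite !word3 !word4 !word5. Qed.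

Lemma sph_traceless : {in bq_rels B, forall r, traceless weight r}.
Proof.
have ml : lambda * mu = 1 by rewrite divff.
have ev b c d f : word_weight weight [:: b; c; d; f] =
    if [&& sph_eqb (sph_source c) (sph_target b), sph_eqb (sph_source d) (sph_target c),
        sph_eqb (sph_source f) (sph_target d) & sph_eqb (sph_target f) (sph_source b)]
    then (if [&& sph_Y b, sph_Y c, sph_Y d & sph_Y f] then mu else 1) else 0.
  rewrite /word_weight /weight /cycle_weight /= !sph_eqE !andbT.
  have -> : sph_eqb (sph_source b) (sph_source b) by case: b.
  by rewrite -!andbA.
rewrite sph_relsE.
apply: forall_in_cons; first by apply: traceless_sub1 => // -[]; rewrite !ev.
apply: forall_in_cons; first by apply: traceless_sub => // -[]; rewrite !ev /= ?mulr0 ?mulr1 ?ml.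
apply: forall_in_cons; first by apply: traceless_sub => // -[]; rewrite !ev /= ?mulr0 ?mulr1 ?ml.
apply: forall_in_cons; first by apply: traceless_sub1 => // -[]; rewrite !ev.
apply: forall_in_cons; first by apply: traceless_sub1 => // -[]; rewrite !ev.
apply: forall_in_cons; first by apply: traceless_sub => // -[]; rewrite !ev /= ?mulr0 ?mulr1 ?ml.
apply: forall_in_cons; first by apply: traceless_sub => // -[]; rewrite !ev /= ?mulr0 ?mulr1 ?ml.
apply: forall_in_cons; first by apply: traceless_sub1 => // -[]; rewrite !ev.
apply: forall_in_cons; first by apply: traceless_word => //; rewrite /word_weight !andbF.
apply: forall_in_cons; first by apply: traceless_word => //; rewrite ev.
apply: forall_in_cons; first by apply: traceless_word => //; rewrite /word_weight !andbF.
apply: forall_in_cons; first by apply: traceless_word => //; rewrite ev.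
apply: forall_in_cons; first by apply: traceless_word => //; rewrite /word_weight !andbF.
apply: forall_in_cons; first by apply: traceless_word => //; rewrite ev.
apply: forall_in_cons; first by apply: traceless_word => //; rewrite /word_weight !andbF.
apply: forall_in_cons; first by apply: traceless_word => //; rewrite ev.
apply: forall_in_cons; first by apply: traceless_word => //; rewrite ev.
apply: forall_in_cons; first by apply: traceless_word => //; rewrite ev.
apply: forall_in_cons; first by apply: traceless_word => //; rewrite ev.
apply: forall_in_cons; first by apply: traceless_word => //; rewrite ev.
apply: forall_in_cons; first by apply: traceless_word => //; rewrite /word_weight !andbF.
apply: forall_in_cons; first by apply: traceless_word => //; rewrite /word_weight !andbF.
apply: forall_in_cons; first by apply: traceless_word => //; rewrite /word_weight !andbF.
apply: forall_in_cons; first by apply: traceless_word => //; rewrite /word_weight !andbF.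
exact: forall_in_nil.
Qed.

Lemma spherical_cluster_tilting (Om : sph_vertex -> rmodType L) :
  (forall v, v \notin sph_Gamma -> is_syzygy2 (simple_rmod (B := B) v) (Om v)) ->
  cluster_tilting3 (candidate (B := B) sph_Gamma Om).
Proof.
have rel k : (k < 24)%N -> bq_class (bq_rels B)`_k = 0 :> L.
  by move=> h; apply: rel_nth; rewrite sph_relsE.
rewrite sph_relsE in rel.
have r0 := class_sub_eq0 (rel 0%N isT).
have r1 := class_subZ_eq0 lambda_neq0 (rel 1%N isT).
have r2 := class_subZ_eq0 lambda_neq0 (rel 2%N isT).
have r3 := class_sub_eq0 (rel 3%N isT).
have r4 := class_sub_eq0 (rel 4%N isT).
have r5 := class_subZ_eq0 lambda_neq0 (rel 5%N isT).
have r6 := class_subZ_eq0 lambda_neq0 (rel 6%N isT).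
have r7 := class_sub_eq0 (rel 7%N isT).
rewrite !class_word3 in r0 r1 r2 r3 r4 r5 r6 r7.
have z9 := rel 9%N isT; have z10 := rel 10%N isT; have z13 := rel 13%N isT.
have z14 := rel 14%N isT; have z18 := rel 18%N isT; have z19 := rel 19%N isT.
have z20 := rel 20%N isT; have z21 := rel 21%N isT; have z22 := rel 22%N isT.
have z23 := rel 23%N isT.
rewrite /= in z9 z10 z13 z14 z18 z19 z20 z21 z22 z23.
rewrite !class_word4 in z9 z13 z18 z19.
rewrite !class_word5 in z10 z14 z20 z21 z22 z23.
have mu0 : mu != 0 by rewrite invr_eq0.
have [R1 R2 R3 R4 R5] := sph_hub_relations
  (p := @hq_p K B bool sph_ap) (q := @hq_q K B bool sph_aq)
  erefl erefl erefl erefl erefl erefl erefl erefl mu0 r0 r1 r2 r3 r4 r5 r6 r7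
  z9 z10 z13 z14 z18 z19 z20 z21 z22 z23.
apply: (@quiver_cluster_tilting K B bool negb mu sph_vx sph_vx' sph_ap sph_aq weight).
- by case=> [[]|[[] []]].
- by case.
- exact: negbK.
- exact: mu0.
- by rewrite invr_eq1.
- by case=> [] [].
- by case=> [] [].
- by case=> [] [].
- by case=> [] [].
- move=> P Pp Pq []; by [exact: (Pp false true)|exact: (Pq false true)|exact: (Pp true false)
    |exact: (Pq true false)|exact: (Pp true true)|exact: (Pq true true)
    |exact: (Pp false false)|exact: (Pq false false)].
- exact: cycle_weight_catC.
- exact: sph_traceless.
- by case; rewrite /word_weight /= !sph_eqE.
- exact: R1.
- exact: R2.
- exact: R3.
- exact: R4.
- exact: R5.
- by case; rewrite !inE /= !sph_eqE.
- by case=> [] []; rewrite !inE /= !sph_eqE.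
Qed.

End SphericalAlgebra.

Theorem corollary5p6 (K : closedFieldType) (lambda : K)
    (lambda_neq0 : lambda != 0) (lambda_neq1 : lambda != 1) :
  (forall Omega2 : tri_vertex -> rmodType (bq_algebra (triangle lambda)),
     (forall v, v \notin tri_Gamma ->
        is_syzygy2 (simple_rmod (B := triangle lambda) v) (Omega2 v)) ->
     cluster_tilting3 (candidate (B := triangle lambda) tri_Gamma Omega2)) /\
  (forall Omega2 : sph_vertex -> rmodType (bq_algebra (spherical lambda)),
     (forall v, v \notin sph_Gamma ->
        is_syzygy2 (simple_rmod (B := spherical lambda) v) (Omega2 v)) ->
     cluster_tilting3 (candidate (B := spherical lambda) sph_Gamma Omega2)).
Proof.
split=> Om hOm; [exact: triangle_cluster_tilting|exact: spherical_cluster_tilting].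
Qed.
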